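(* Let $\beta>0$, $z\in(0,1)^2$, $\alpha>\tfrac12$ and $\varepsilon>0$. Define $$\varphi(\alpha)=\begin{cases}2\alpha-1, & \tfrac12<\alpha\le 1,\\ 3\alpha-2, & 1\le\alpha\le 2,\\ 2\alpha, & \alpha\ge 2.\end{cases}$$ Then there exists $R_0=R_0(\alpha,\beta,z,\varepsilon)$ such that for every $R>R_0$ there is $n_0$ (which may depend on $R,\alpha,\beta,z,\varepsilon$) such that for all $n\ge n_0$ $$\exp\big(-R^{\varphi(\alpha)+\varepsilon}\big)\le \mathbb{P}\Big[\big|\mu_n(\mathbb{D}_n(z,R))-\pi R^2\big|\ge R^\alpha\Big]\le \exp\big(-R^{\varphi(\alpha)-\varepsilon}\big),$$ where $\mu_n$ is the counting measure of the two-dimensional hierarchical Coulomb gas with $n$ points at inverse temperature $\beta$, and $\mathbb{D}_n(z,R)=\{x\in\mathbb{R}^2: |x-z|\le R/\sqrt n\}$.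
   Context: For $k\ge 0$ let $\mathcal{D}_k$ be the collection of the $4^k$ dyadic sub-squares of $[0,1]^2$ of side length $2^{-k}$ (say half-open; points on boundaries of dyadic squares form a null set and do not matter). For $x\ne y$ in $[0,1]^2$ let $w(x,y)=\min\{k\ge1: x,y \text{ belong to distinct squares of }\mathcal{D}_k\}$. For $n\ge2$ and $\beta>0$, the hierarchical Coulomb gas with $n$ points at inverse temperature $\beta$ is the random vector $(p_1,\dots,p_n)\in([0,1]^2)^n$ with density $$\frac{1}{Z(n,\beta)}\exp\Big(-\beta\sum_{1\le i<j\le n}w(x_i,x_j)\Big)$$ with respect to Lebesgue measure, where $Z(n,\beta)$ is the normalizing constant. Its counting measure is $\mu_n=\sum_{j=1}^n\delta_{p_j}$. *)

(* Defs.v *)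
From HB Require Import structures.
From mathcomp Require Import all_boot all_order all_algebra.
From mathcomp Require Import all_classical all_reals all_analysis.
Import Order.TTheory GRing.Theory Num.Theory.
Import numFieldNormedType.Exports.

Set Implicit Arguments.
Unset Strict Implicit.
Unset Printing Implicit Defensive.

Local Open Scope classical_set_scope.
Local Open Scope ring_scope.

(* Local copy of mu \x nu carrying its sigma-finite structure: for the product
   itself the library only infers that structure from subprobabilities. *)
Section sigma_finite_product.
Context d1 d2 (T1 : measurableType d1) (T2 : measurableType d2) (R : realType).
Context (mu : {sigma_finite_measure set T1 -> \bar R}).
Context (nu : {sigma_finite_measure set T2 -> \bar R}).

Definition product_measure := (mu \x nu)%E.

HB.instance Definition _ := Measure.on product_measure.

Lemma product_measure_sigma_finite : sigma_finite setT product_measure.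
Proof.
have /sigma_finiteP[F [TF ndF Foo]] := sigma_finiteT mu.
have /sigma_finiteP[G [TG ndG Goo]] := sigma_finiteT nu.
exists (fun n => F n `*` G n).
  rewrite -setXTT TF TG predeqE => -[x y]; split.
    move=> [/= [n _ Fnx] [k _ Gky]]; exists (maxn n k) => //; split.
    - by move: x Fnx; exact/subsetPset/ndF/leq_maxl.
    - by move: y Gky; exact/subsetPset/ndG/leq_maxr.
  by move=> [n _ []/= ? ?]; split; exists n.
move=> k; have [? ?] := Foo k; have [? ?] := Goo k.
split; first exact: measurableX.
by rewrite /product_measure product_measure1E// lte_mul_pinfty// ge0_fin_numE.
Qed.

HB.instance Definition _ := Measure_isSigmaFinite.Build _ _ _
  product_measure product_measure_sigma_finite.

End sigma_finite_product.

Section tuple_product_measure.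
Context d (T : measurableType d) (R : realType).

Definition tcons (n : nat) (x : T * n.-tuple T) : n.+1.-tuple T :=
  [tuple of x.1 :: x.2].

Lemma measurable_tcons n :
  measurable_fun [set: (T * n.-tuple T)%type] (@tcons n).
Proof. exact: measurable_cons. Qed.

Section product_tcons.
Context (n : nat) (mu : {sigma_finite_measure set T -> \bar R}).
Context (nu : {sigma_finite_measure set (n.-tuple T) -> \bar R}).

Definition product_tcons := pushforward (product_measure mu nu) (@tcons n).

Let product_tcons0 : product_tcons set0 = 0%E.
Proof. by rewrite /product_tcons /pushforward preimage_set0 measure0. Qed.

Let product_tcons_ge0 A : (0 <= product_tcons A)%E.
Proof. by rewrite /product_tcons /pushforward measure_ge0. Qed.

Let product_tcons_sigma_additive : semi_sigma_additive product_tcons.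
Proof.
rewrite /product_tcons; apply: measure_semi_sigma_additive.
exact: measurable_tcons.
Qed.

HB.instance Definition _ := isMeasure.Build _ _ _ product_tcons
  product_tcons0 product_tcons_ge0 product_tcons_sigma_additive.

Lemma product_tcons_sigma_finite :
  sigma_finite [set: n.+1.-tuple T] product_tcons.
Proof.
have [F FT Foo] : sigma_finite setT (product_measure mu nu) := sigma_finiteT _.
pose g (t : n.+1.-tuple T) := (thead t, [tuple of behead t]).
have gK : cancel (@tcons n) g.
  by move=> [x t]; congr pair; rewrite ?theadE//; apply/val_inj.
have mg : measurable_fun setT g.
  apply: measurable_fun_pair; last exact: measurable_behead.
  exact: measurable_tnth.
exists (fun i => g @^-1` F i).
  by rewrite -preimage_bigcup -FT preimage_setT.
move=> i; have [mF Fioo] := Foo i; split.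
  by rewrite -[X in measurable X]setTI; exact: mg.
rewrite /product_tcons /pushforward -comp_preimage.
by rewrite (_ : g \o _ = id) ?preimage_id//; apply/funext => x /=; rewrite gK.
Qed.

HB.instance Definition _ := @Measure_isSigmaFinite.Build _ _ _
  product_tcons product_tcons_sigma_finite.

End product_tcons.

(* The n-fold product mu \x ... \x mu; the product over zero factors is the
   unit mass at the empty tuple. *)
Fixpoint tuple_measure (mu : {sigma_finite_measure set T -> \bar R}) n :
    {sigma_finite_measure set (n.-tuple T) -> \bar R} :=
  match n with
  | 0 => \d_([tuple] : 0.-tuple T)
  | m.+1 => product_tcons mu (tuple_measure mu m)
  end.

End tuple_product_measure.

Section hierarchical_coulomb_gas.
Context (R : realType).

Local Notation plane := (measurableTypeR R * measurableTypeR R)%type.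

Definition lebesgue2 : {sigma_finite_measure set plane -> \bar R} :=
  product_measure (@lebesgue_measure R) (@lebesgue_measure R).

Definition unit_square : set plane := `[0, 1] `*` `[0, 1].

Definition dyadic_squares (k : nat) : set (set plane) :=
  [set Q | exists i j : 'I_(2 ^ k),
     Q = `[i%:R / 2 ^+ k, i.+1%:R / 2 ^+ k[ `*`
         `[j%:R / 2 ^+ k, j.+1%:R / 2 ^+ k[].

Definition dyadic_separated (k : nat) (x y : plane) : Prop :=
  exists Q1 Q2 : set plane, [/\ dyadic_squares k Q1, dyadic_squares k Q2,
    Q1 <> Q2, Q1 x & Q2 y].

(* The infimum is a minimum as soon as some level separates x and y.
   Otherwise (x = y, or one of the points lies outside [0, 1[^2) it is +oo,
   which only concerns a null set of configurations of the unit square. *)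
Definition hier_w (x y : plane) : \bar R :=
  ereal_inf [set k%:R%:E |
    k in [set k : nat | (1 <= k)%N /\ dyadic_separated k x y]].

Definition hier_energy n (p : n.-tuple plane) : \bar R :=
  (\sum_(i < n) \sum_(j < n | (i < j)%N) hier_w (tnth p i) (tnth p j))%E.

Definition configurations n : set (n.-tuple plane) :=
  [set p | forall i, unit_square (tnth p i)].
Local Arguments configurations n : clear implicits.

(* Its values lie in ]0, 1], so that taking fine below is harmless. *)
Definition partition_function n (beta : R) : \bar R :=
  (\int[tuple_measure lebesgue2 n]_(p in configurations n)
    expeR (- (beta%:E * hier_energy p)))%E.

Definition coulomb_density n (beta : R) (p : n.-tuple plane) : \bar R :=
  ((fine (partition_function n beta))^-1%:E
    * expeR (- (beta%:E * hier_energy p)))%E.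

Definition coulomb_prob n (beta : R) (A : set (n.-tuple plane)) : \bar R :=
  (\int[tuple_measure lebesgue2 n]_(p in configurations n `&` A)
    coulomb_density beta p)%E.

Definition point_count n (p : n.-tuple plane) (A : set plane) : \bar R :=
  (\sum_(j < n) \d_(tnth p j) A)%E.

(* The library norm on a product is the sup norm, hence the explicit formula. *)
Definition euclidean_dist (x y : R * R) : R :=
  Num.sqrt ((x.1 - y.1) ^+ 2 + (x.2 - y.2) ^+ 2).

Definition disc n (z : R * R) (r : R) : set plane :=
  [set x | euclidean_dist x z <= r / Num.sqrt n%:R].

Definition large_discrepancy n (z : R * R) (r alpha : R) :
    set (n.-tuple plane) :=
  [set p | ((r `^ alpha)%:E
    <= `| point_count p (disc n z r) - (pi * r ^+ 2)%:E |)%E].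

Definition phi (alpha : R) : R :=
  if alpha <= 1 then 2 * alpha - 1
  else if alpha <= 2 then 3 * alpha - 2
  else 2 * alpha.

End hierarchical_coulomb_gas.

Arguments configurations {R} n.
Arguments large_discrepancy {R} n z r alpha _.

(* Main.v *)
Require Import Defs.
From mathcomp Require Import all_boot all_order all_algebra.
From mathcomp Require Import all_classical all_reals all_analysis.
From mathcomp Require Import measurable_realfun ring lra zify.
Import Order.TTheory GRing.Theory Num.Theory.
Import numFieldNormedType.Exports.

Set Implicit Arguments.
Unset Strict Implicit.
Unset Printing Implicit Defensive.

Local Open Scope classical_set_scope.
Local Open Scope ring_scope.

                                                                          
                                                                               
                                                             
                                                                                  
                                                                                  
                                                                                  

                                                                                   
                                                                    
                                                                               
                                                                  
                                                                                     
                           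

                                                                           
                                                                                
                                                                                  
                                                                                  
                                                                                 
                                                                                        
                                                                                
                                                                                    
                                                            

(** A pair of points pays [beta] once for every dyadic level at which it still shares a cell. The
    Gibbs weight therefore factors along the quadtree: a cell holding m points contributes exp(-beta
    C(m,2)), and summing over the ways these points split among the four children is a fourfold
    convolution. Truncated at level K, with a factor g for each point of a leaf cell, this recursion
    is [tree]; [ell] is the case g = 1. By [label_sum_energy] (labelled points against occupation
    numbers) and [gas_limit] (dominated convergence in K), n! times [tree] tends to the integral of
    the gas weight. With N the number of points in the disc and g the mean of exp(th 1_disc) over a
    leaf cell, everything reduces to comparing [tree] with [ell] uniformly in K, that is, to
    estimating the logarithm of E exp(th (N - pi r^2)).

    Rigidity comes from log-concavity. Convolution preserves it ([conv_log_concave]), and the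
    repulsion of one level improves a(n+1)^2 / (a(n) a(n+2)) by the factor e^beta, so
    [ell_log_concave] holds at every positive depth with the same constant. Hence, given m points in
    a cell, the four child counts are sub-Gaussian around m/4 with parameters depending on beta only
    ([wquad_gauss], [wquad_var]).

    The fraction W of a cell covered by the disc is a martingale down the tree, and only the cells
    cut by the circle matter: at level k there are O(1 + rho 2^k) of them ([bd_count]), rho being
    the rescaled radius. Stop at the level M where a cell holds about l^2 points; about r/l cells
    are then cut.

    Upper bound. The splits above level M cost O(th^2 r / l) in the exponent ([tree_root_upper]). At
    level M either l = 1 and th is small, so that each cut cell fluctuates by O(th^2)
    ([mgf_upper_small]), or each cut cell is rounded to full or empty in the unfavourable direction,
    which costs O(|th| l^2) for each of the r/l cells ([mgf_upper_large]). The Chernoff bound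
    [gas_markov] with l = 1 and th of order r^(alpha-1) gives r^(2 alpha - 1) for alpha at most 1;
    with l of order r^g, g = min(alpha - 1, 1), and th of order r^(alpha-1) l it gives r^(2 alpha -
    1 + g), which is the rest of [phi].

    Lower bound. [gas_paley_zygmund] converts a lower bound of the exponential moment at th and an
    upper bound at 2 th into a lower bound of the probability. The moment at th must beat Jensen's
    value exp(th pi r^2) by more than th r^alpha. For alpha < 1 the gain is the variance, of order
    th^2, of about r unevenly cut cells of bounded population ([mgf_lower_variance]). For 1 <= alpha
    < 2, in each of about r/l unevenly cut cells all l^2 points are pushed into a richer child, at a
    price l^4 for a gain th l^2 ([mgf_lower_good]); l is about r^(alpha-1) and th about l^2. For
    alpha >= 2 a single cell much larger than the disc, with about r^alpha points, is emptied into
    the disc through a chain of cells ([mgf_lower_chain]). In each case alpha is replaced by a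
    slightly larger exponent, so that the gain wins, and the loss is absorbed by eps. *)

(** * Elementary inequalities for the exponential *)

Section exp_bounds.
Context {R : realType}.
Implicit Types x : R.

(** Square e^(x/2) (1 - x/2) <= 1 and compare with (1 + x + 2x^2)(1 - x/2)^2 = 1 + x^2 (1 - x)(5 -
    2x)/4. *)
Lemma expR_le_quadratic x : x <= 1 -> expR x <= 1 + x + 2 * x ^+ 2.
Proof.
move=> x1; have y0 : 0 < 1 - x / 2 by lra.
have y1 : 1 - x / 2 <= expR (- (x / 2)) by exact: expR_ge1Dx.
have e0 : 0 < expR (x / 2) by exact: expR_gt0.
have E1 : expR (x / 2) * (1 - x / 2) <= 1.
  by rewrite (le_trans (ler_wpM2l (ltW e0) y1))// expRxMexpNx_1.
have -> : expR x = expR (x / 2) ^+ 2.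
  by rewrite -expRM_natl; congr expR; rewrite mulrC divfK ?pnatr_eq0.
have E2 : (expR (x / 2) * (1 - x / 2)) ^+ 2 <= 1.
  by rewrite expr_le1// mulr_ge0// ltW.
rewrite -(ler_pM2r (exprn_gt0 2 y0)) -exprMn.
apply: (le_trans E2).
have -> : (1 + x + 2 * x ^+ 2) * (1 - x / 2) ^+ 2 =
  1 + x ^+ 2 * (1 - x) * (5 - 2 * x) / 4 by field.
rewrite lerDl divr_ge0// mulr_ge0//; last by lra.
by rewrite mulr_ge0 ?sqr_ge0// subr_ge0.
Qed.

(** The form used for centred variables: on averaging, the linear term disappears and a Gaussian
    bound remains. *)
Lemma expR_le_Dx_gauss x : expR x <= x + expR (2 * x ^+ 2).
Proof.
have [x1|x1] := leP x 1.
  apply: (le_trans (expR_le_quadratic x1)).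
  have := expR_ge1Dx (2 * x ^+ 2); lra.
have : expR x <= expR (2 * x ^+ 2) by rewrite ler_expR; nra.
lra.
Qed.

Lemma expR_ge_quadratic x : 0 <= x -> 1 + x + x ^+ 2 / 4 <= expR x.
Proof.
move=> x0; have -> : expR x = expR (x / 2) ^+ 2.
  by rewrite -expRM_natl; congr expR; rewrite mulrC divfK ?pnatr_eq0.
have -> : 1 + x + x ^+ 2 / 4 = (1 + x / 2) ^+ 2 by field.
by rewrite lerXn2r// ?nnegrE ?expR_ge0 ?expR_ge1Dx//; lra.
Qed.

Lemma cosh_le_gauss x : expR x + expR (- x) <= 2 * expR (2 * x ^+ 2).
Proof.
have := expR_le_Dx_gauss x; have := expR_le_Dx_gauss (- x).
rewrite sqrrN; lra.
Qed.

(** Convexity: the tangent of exp at [th * s] lies below exp at 0 and at [th * m], and its two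
    values there average back to [expR (th * s)]. *)
Lemma expR_le_chord (th m s : R) : 0 <= s <= m -> 0 < m ->
  expR (th * s) <= 1 - s / m + s / m * expR (th * m).
Proof.
move=> /andP[s0 sm] m0.
have tge0 : 0 <= s / m by rewrite divr_ge0// ltW.
have tle1 : s / m <= 1 by rewrite ler_pdivrMr// mul1r.
have e0 : 0 < expR (th * s) by exact: expR_gt0.
set t := s / m in tge0 tle1 *; set a := th * s.
have sE : s = t * m by rewrite /t divfK// gt_eqF.
                                    
have h0 : expR a * (1 - a) <= 1.
  rewrite -[leRHS](expRxMexpNx_1 a) ler_wpM2l ?expR_ge0//.
  exact: expR_ge1Dx.
have h1 : expR a * (1 + (th * m - a)) <= expR (th * m).
  have -> : th * m = a + (th * m - a) by ring.
  rewrite expRD ler_wpM2l ?expR_ge0//; apply: le_trans (expR_ge1Dx _).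
  by rewrite le_eqVlt; apply/orP; left; apply/eqP; ring.
have aE : t * (th * m) - a = 0 by rewrite /a sE; ring.
have -> : expR a = (1 - t) * (expR a * (1 - a)) + t * (expR a * (1 + (th * m - a))).
  transitivity (expR a * (1 + (t * (th * m) - a))); last by ring.
  by rewrite aE addr0 mulr1.
by apply: lerD; [rewrite ler_piMr ?subr_ge0|exact: ler_wpM2l].
Qed.

End exp_bounds.

                                               

(** * Log-concave sequences and convolution *)

Section convol.
Context {R : realFieldType}.
Implicit Types a b : nat -> R.

Definition convol a b (n : nat) : R := \sum_(i < n.+1) a i * b (n - i)%N.

(** The constant measures strength: c = 1 is ordinary log-concavity, and c = expR gam bounds the
    second differences of log a by -gam. *)
Definition log_concave (c : R) a :=
  (forall n, 0 < a n) /\ forall n, c * (a n * a n.+2) <= a n.+1 ^+ 2.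

Lemma log_concaveW (c c' : R) a : c' <= c -> log_concave c a -> log_concave c' a.
Proof.
move=> cc [a0 ac]; split=> // n; apply: le_trans (ac n).
by rewrite ler_wpM2r// mulr_ge0// ltW.
Qed.

Lemma conv_gt0 a b : (forall n, 0 < a n) -> (forall n, 0 < b n) ->
  forall n, 0 < convol a b n.
Proof.
move=> a0 b0 n; rewrite /convol big_ord_recl.
rewrite ltr_pwDl ?mulr_gt0//; apply: sumr_ge0 => i _.
by rewrite mulr_ge0// ltW.
Qed.

Lemma log_concave_minor a i j : log_concave 1 a -> (i <= j)%N ->
  a i * a j.+1 <= a i.+1 * a j.
Proof.
move=> [a0 ac] /subnKC <-; elim: (j - i)%N => [|d IH].
  by rewrite addn0 mulrC.
have := ac (i + d)%N; rewrite mul1r addnS => H.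
rewrite -(ler_pM2r (a0 (i + d)%N)).
have H1 : a i * a (i + d).+2 * a (i + d)%N <= a i * a (i + d).+1 ^+ 2.
  by rewrite -mulrA ler_pM2l// mulrC.
apply: (le_trans H1).
rewrite [leRHS](_ : _ = a i.+1 * a (i + d)%N * a (i + d).+1); last by ring.
by rewrite expr2 mulrA ler_pM2r.
Qed.

(** Cauchy-Binet: twice the difference of the two sides is a double sum of products of two 2x2
    minors, and the hypotheses give both minors the same sign. *)
Lemma cauchy_binet_ge0 N (p q r s : nat -> R) :
  (forall k l, (k < l < N)%N -> p l * r k <= p k * r l) ->
  (forall k l, (k < l < N)%N -> q l * s k <= q k * s l) ->
  (\sum_(k < N) r k * q k) * (\sum_(k < N) p k * s k) <=
  (\sum_(k < N) p k * q k) * (\sum_(k < N) r k * s k).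
Proof.
move=> pr qs; rewrite -subr_ge0.
set D := (X in 0 <= X).
have D1 : D = \sum_(k < N) \sum_(l < N) p k * r l * (q k * s l - q l * s k).
  rewrite /D [X in _ - X]mulrC !big_distrlr -sumrB; apply: eq_bigr => k _.
  by rewrite -sumrB; apply: eq_bigr => l _ /=; ring.
have D2 : D + D = \sum_(k < N) \sum_(l < N)
    (p k * r l - p l * r k) * (q k * s l - q l * s k).
  rewrite {1}D1 D1 [X in _ + X]exchange_big /= -big_split; apply: eq_bigr => k _.
  by rewrite -big_split; apply: eq_bigr => l _ /=; ring.
have : 0 <= D + D; last by rewrite -mulr2n pmulrn_lge0.
rewrite D2; apply: sumr_ge0 => k _; apply: sumr_ge0 => l _.
have [kl|lk|->] := ltngtP k l.
- by rewrite mulr_ge0// subr_ge0 ?pr ?qs// kl/=.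
- by rewrite mulr_le0// subr_le0 ?pr ?qs// lk/=.
- by rewrite !subrr mulr0.
Qed.

(** The claim is the nonnegativity of a 2x2 minor of the product of two Toeplitz matrices. The rows
    p, r come from a, the columns b, s from b, padded by zeros to a common index range; the middle
    value [convol a b n.+1] is written in two ways, once as p against b and once as r against s. *)
Lemma conv_log_concave a b : log_concave 1 a -> log_concave 1 b ->
  log_concave 1 (convol a b).
Proof.
move=> la lb; have [[a0 _] [b0 _]] := (la, lb).
split; first exact: conv_gt0.
move=> n; rewrite mul1r.
pose p k : R := if (k <= n.+1)%N then a (n.+1 - k)%N else 0.
pose r k := a (n.+2 - k)%N.
pose s k : R := if k is k'.+1 then b k' else 0.
have E1 : convol a b n.+1 = \sum_(k < n.+3) p k * b k.
  rewrite big_ord_recr /= /p ltnn mul0r addr0 /convol (reindex_inj rev_ord_inj) /=.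
  apply: eq_bigr => i _; have := ltn_ord i; rewrite ltnS => h.
  by rewrite h subSS subKn.
have E2 : convol a b n.+1 = \sum_(k < n.+3) r k * s k.
  rewrite big_ord_recl /= mulr0 add0r /convol (reindex_inj rev_ord_inj) /=.
  apply: eq_bigr => i _; have := ltn_ord i; rewrite ltnS => h.
  by rewrite /r /= subSS subKn.
have E3 : convol a b n.+2 = \sum_(k < n.+3) r k * b k.
  rewrite /convol (reindex_inj rev_ord_inj) /=.
  apply: eq_bigr => i _; have := ltn_ord i; rewrite ltnS => h.
  by rewrite /r /= subSS subKn.
have E4 : convol a b n = \sum_(k < n.+3) p k * s k.
  rewrite big_ord_recl /= mulr0 add0r big_ord_recr /= /p ltnn mul0r addr0.
  rewrite /convol (reindex_inj rev_ord_inj) /=.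
  apply: eq_bigr => i _; have := ltn_ord i; rewrite ltnS => h.
  by rewrite /= /bump /= add1n h !subSS subKn.
rewrite expr2 {1}E1 E2 [convol _ _ _ * _]mulrC E3 E4.
apply: cauchy_binet_ge0 => k l /andP[kl lN].
- rewrite /p /r; have kn : (k <= n.+1)%N by lia.
  rewrite kn; case: ifPn => ln; last first.
    by rewrite mul0r mulr_ge0// ltW.
  have := @log_concave_minor a (n.+1 - l) (n.+1 - k) la ltac:(lia).
  have -> : ((n.+1 - k).+1 = n.+2 - k)%N by lia.
  have -> : ((n.+1 - l).+1 = n.+2 - l)%N by lia.
  by rewrite [leRHS]mulrC.
- rewrite /s; case: k kl => [|k] kl; first by rewrite mulr0; case: l kl {lN} => // l _; rewrite mulr_ge0// ltW.
  case: l kl lN => // l kl lN.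
  have := @log_concave_minor b k l lb ltac:(lia).
  by rewrite mulrC.
Qed.

End convol.

(** * Sums over the splits of m points among four children *)

Section quad.
Context {R : realFieldType}.
Implicit Types (F G : nat -> nat -> nat -> nat -> R) (m : nat).

(** All four indices have the same range and the constraint is a factor, so the sums can be
    exchanged freely. *)
Definition quad m F : R :=
  \sum_(i < m.+1) \sum_(j < m.+1) \sum_(k < m.+1) \sum_(l < m.+1)
    F i j k l *+ (i + j + k + l == m)%N.

Lemma eq_quad m F G :
  (forall i j k l, (i + j + k + l = m)%N -> F i j k l = G i j k l) ->
  quad m F = quad m G.
Proof.
move=> FG; do 4!(apply: eq_bigr => ? _).
by case: eqP => // /FG ->.
Qed.

Lemma quad_le m F G :
  (forall i j k l, (i + j + k + l = m)%N -> F i j k l <= G i j k l) ->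
  quad m F <= quad m G.
Proof.
move=> FG; do 4!(apply: ler_sum => ? _).
by case: eqP => // /FG.
Qed.

Lemma quad_ge0 m F :
  (forall i j k l, (i + j + k + l = m)%N -> 0 <= F i j k l) -> 0 <= quad m F.
Proof.
move=> FG; do 4!(apply: sumr_ge0 => ? _).
by case: eqP => // /FG.
Qed.

Lemma quadD m F G :
  quad m (fun i j k l => F i j k l + G i j k l) = quad m F + quad m G.
Proof.
rewrite /quad -big_split; apply: eq_bigr => i _; rewrite -big_split.
apply: eq_bigr => j _; rewrite -big_split; apply: eq_bigr => k _.
by rewrite -big_split; apply: eq_bigr => l _ /=; rewrite mulrnDl.
Qed.

Lemma quadZ m c F : quad m (fun i j k l => c * F i j k l) = c * quad m F.
Proof.
rewrite /quad mulr_sumr; apply: eq_bigr => i _; rewrite mulr_sumr.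
apply: eq_bigr => j _; rewrite mulr_sumr; apply: eq_bigr => k _.
by rewrite mulr_sumr; apply: eq_bigr => l _ /=; rewrite mulrnAr.
Qed.

Lemma quad_swap12 m F : quad m F = quad m (fun i j k l => F j i k l).
Proof.
rewrite /quad exchange_big; apply: eq_bigr => i _; apply: eq_bigr => j _.
by apply: eq_bigr => k _; apply: eq_bigr => l _; rewrite [(j + i)%N]addnC.
Qed.

Lemma quad_swap23 m F : quad m F = quad m (fun i j k l => F i k j l).
Proof.
rewrite /quad; apply: eq_bigr => i _.
rewrite exchange_big; apply: eq_bigr => j _.
by apply: eq_bigr => k _; apply: eq_bigr => l _; rewrite [(i + k + j)%N]addnAC.
Qed.

Lemma quad_swap34 m F : quad m F = quad m (fun i j k l => F i j l k).
Proof.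
rewrite /quad; apply: eq_bigr => i _; apply: eq_bigr => j _.
rewrite exchange_big; apply: eq_bigr => k _.
by apply: eq_bigr => l _; rewrite addnAC.
Qed.

Lemma sum_pair n m (f : nat -> nat -> R) : (n <= m)%N ->
  \sum_(i < m.+1) \sum_(j < m.+1) f i j *+ (i + j == n)%N =
  \sum_(i < n.+1) f i (n - i)%N.
Proof.
move=> nm; rewrite (big_ord_widen m.+1 (fun i => f i (n - i)%N))//.
rewrite [RHS]big_mkcond; apply: eq_bigr => i _.
rewrite ltnS; case: leqP => h.
  have jm : (n - i < m.+1)%N by lia.
  rewrite (bigD1 (Ordinal jm)) //= subnKC// eqxx mulr1n big1 ?addr0// => j.
  rewrite -val_eqE /= => ji.
  by have -> : (i + j == n)%N = false by lia.
by rewrite big1// => j _; have -> : (i + j == n)%N = false by lia.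
Qed.

Lemma quad_conv m (a b c d : nat -> R) :
  quad m (fun i j k l => a i * b j * (c k * d l)) =
  convol (convol a b) (convol c d) m.
Proof.
rewrite {1}/convol.
transitivity (\sum_(s < m.+1) \sum_(i < m.+1) \sum_(j < m.+1)
   \sum_(k < m.+1) \sum_(l < m.+1)
   (a i * b j * (c k * d l)) *+ ((i + j == s) && (k + l == m - s))%N).
  rewrite /quad [RHS]exchange_big; apply: eq_bigr => i _.
  rewrite [RHS]exchange_big; apply: eq_bigr => j _.
  rewrite [RHS]exchange_big; apply: eq_bigr => k _.
  rewrite [RHS]exchange_big; apply: eq_bigr => l _ /=.
  have [E|E] := eqVneq (i + j + k + l)%N m.
    have h : (i + j < m.+1)%N by lia.
    rewrite (bigD1 (Ordinal h))//= eqxx big1 ?addr0 => [|s].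
      by have -> : (k + l == m - (i + j))%N by lia.
    by rewrite -val_eqE /= eq_sym => /negbTE ->.
  rewrite big1// => s _.
  by case: eqP => // h1; case: eqP => // h2; have := ltn_ord s; lia.
apply: eq_bigr => s _; have sm : (s <= m)%N by have := ltn_ord s; lia.
rewrite /convol -(sum_pair (fun i j => a i * b j) sm).
rewrite -(sum_pair (fun i j => c i * d j) (leq_subr s m)).
rewrite big_distrl; apply: eq_bigr => i _.
rewrite big_distrl; apply: eq_bigr => j _.
rewrite big_distrr; apply: eq_bigr => k _.
rewrite big_distrr; apply: eq_bigr => l _ /=.
by rewrite -mulnb mulrnA mulrnAr mulrnAl mulrnAC.
Qed.

(** Conditioning on the last two counts; this is how the two-child estimate [pair_gauss] enters the
    four-child sums. *)
Lemma quad_pair_le m F G :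
  (forall k l s, (s + k + l = m)%N ->
    \sum_(i < s.+1) F i (s - i)%N k l <= \sum_(i < s.+1) G i (s - i)%N k l) ->
  quad m F <= quad m G.
Proof.
move=> FG; have E H : quad m H =
    \sum_(k < m.+1) \sum_(l < m.+1) \sum_(i < m.+1) \sum_(j < m.+1)
       H i j k l *+ (i + j + k + l == m)%N.
  rewrite /quad.
  under eq_bigr do rewrite exchange_big.
  rewrite exchange_big; apply: eq_bigr => k _ /=.
  under eq_bigr do rewrite exchange_big.
  by rewrite exchange_big.
rewrite !E; apply: ler_sum => k _; apply: ler_sum => l _.
have [kl|kl] := leqP (k + l) m; last first.
  by rewrite !big1// => i _; rewrite big1// => j _;
    have -> : (i + j + k + l == m)%N = false by lia.
have E2 (H : nat -> nat -> nat -> nat -> R) :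
    \sum_(i < m.+1) \sum_(j < m.+1) H i j k l *+ (i + j + k + l == m)%N =
    \sum_(i < (m - (k + l)).+1) H i (m - (k + l) - i)%N k l.
  rewrite -(sum_pair (fun i j => H i j k l) (leq_subr _ m)).
  apply: eq_bigr => i _; apply: eq_bigr => j _.
  by congr (_ *+ nat_of_bool _); lia.
by rewrite !E2; apply: FG; lia.
Qed.

End quad.

(** * Gaussian concentration of the split between two children *)

Section gaussian_pair.
Context {R : realType} (gam : R) (p : nat -> R).
Hypotheses (gam0 : 0 < gam) (lp : log_concave (expR gam) p).

Let p_gt0 n : 0 < p n. Proof. by case: lp. Qed.

Lemma log_concave_ratio a d :
  expR (gam * d%:R) * (p a * p (a + d).+1) <= p a.+1 * p (a + d).
Proof.
elim: d => [|d IH]; first by rewrite mulr0 expR0 mul1r addn0 mulrC.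
have h := (proj2 lp) (a + d)%N.
rewrite addnS -(ler_pM2r (p_gt0 (a + d))).
have -> : expR (gam * d.+1%:R) * (p a * p (a + d).+2) * p (a + d) =
  (expR (gam * d%:R) * p a) * (expR gam * (p (a + d) * p (a + d).+2)).
  by rewrite -natr1 mulrDr mulr1 expRD; ring.
apply: (@le_trans _ _ ((expR (gam * d%:R) * p a) * p (a + d).+1 ^+ 2)).
  by rewrite ler_wpM2l// mulr_ge0 ?expR_ge0// ltW.
have -> : expR (gam * d%:R) * p a * p (a + d).+1 ^+ 2 =
  (expR (gam * d%:R) * (p a * p (a + d).+1)) * p (a + d).+1 by ring.
have -> : p a.+1 * p (a + d).+1 * p (a + d) = p a.+1 * p (a + d) * p (a + d).+1.
  by ring.
by rewrite ler_pM2r.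
Qed.

(** The step from t to t+1 widens a gap of at least 2t+1, so it gains a factor e^(-gam (2t+1)) by
    [log_concave_ratio]; the odd numbers add up to t^2. *)
Lemma pair_decay c c' t : (c' <= c)%N ->  (t <= c')%N ->
  p (c + t) * p (c' - t)%N <= expR (- gam * (t ^ 2)%:R) * (p c * p c').
Proof.
move=> cc'; elim: t => [|t IH] tc.
  by rewrite mulr0 expR0 mul1r addn0 subn0.
have {}IH := IH ltac:(lia).
have h := @log_concave_ratio (c' - t.+1) (c - c' + t.*2.+1).
have E1 : (c' - t.+1 + (c - c' + t.*2.+1) = c + t)%N by lia.
have E2 : ((c' - t.+1).+1 = c' - t)%N by lia.
rewrite E1 E2 -addnS in h.
have h2 : expR (gam * t.*2.+1%:R) * (p (c' - t.+1)%N * p (c + t.+1)%N) <=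
   expR (- gam * (t ^ 2)%:R) * (p c * p c').
  apply: le_trans IH; rewrite [leRHS]mulrC; apply: le_trans h.
  rewrite ler_wpM2r ?mulr_ge0 ?(ltW (p_gt0 _))//.
  by rewrite ler_expR ler_wpM2l ?(ltW gam0)// ler_nat; lia.
rewrite -(ler_pM2l (expR_gt0 (gam * t.*2.+1%:R))) [p (c + _)%N * _]mulrC.
apply: (le_trans h2); rewrite [leRHS]mulrA -expRD.
rewrite ler_wpM2r ?mulr_ge0 ?(ltW (p_gt0 _))// ler_expR.
rewrite le_eqVlt; apply/orP; left; apply/eqP.
have -> : (t.+1 ^ 2 = t ^ 2 + t.*2.+1)%N by rewrite -!mulnn; lia.
by rewrite natrD; ring.
Qed.

(** This rate leaves half of the decay e^(-gam t^2): for u in {0, 1} one has (u + 2t)^2 <= 8t^2 + 2,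
    so the weighted terms are at most e^(gam/8) q^t with q = e^(-gam/2). Their geometric series,
    counted for both halves, is [pair_const]. *)
Let b0 := gam / 16.
Definition pair_const := 2 * expR (gam / 8) / (1 - expR (- (gam / 2))).

Lemma pair_const_gt0 : 0 < pair_const.
Proof.
apply: divr_gt0; first by rewrite mulr_gt0 ?expR_gt0.
by rewrite subr_gt0 expR_lt1 oppr_lt0 divr_gt0.
Qed.

Lemma pair_gauss_half c c' n : (c' <= c <= c'.+1)%N -> (n <= c'.+1)%N ->
  \sum_(t < n) p (c + t) * p (c' - t)%N *
     expR (b0 * ((c + t)%:R - (c' - t)%:R) ^+ 2)
  <= pair_const / 2 * (p c * p c').
Proof.
move=> /andP[cc' c'c] nc.
set q := expR (- (gam / 2)).
have q0 : 0 <= q by exact: expR_ge0.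
have q1 : q < 1 by rewrite /q expR_lt1 oppr_lt0 divr_gt0.
have step (t : 'I_n) : p (c + t) * p (c' - t)%N *
     expR (b0 * ((c + t)%:R - (c' - t)%:R) ^+ 2) <=
   expR (gam / 8) * (p c * p c') * q ^+ t.
  have tc : (t <= c')%N by have := ltn_ord t; lia.
  have h := pair_decay cc' tc.
  apply: (le_trans (ler_wpM2r (expR_ge0 _) h)).
  rewrite mulrAC -expRD [leRHS]mulrAC ler_wpM2r//.
    by rewrite mulr_ge0 ?(ltW (p_gt0 _)).
  rewrite /q -expRM_natr -expRD ler_expR natrX.
  have : (c%:R - c'%:R : R) ^+ 2 <= (c%:R - c'%:R).
    have /orP[/eqP->|/eqP->] : (c == c') || (c == c'.+1) by lia.
      by rewrite subrr expr0n.
    by rewrite -natr1 addrAC subrr add0r expr1n.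
  have : (c%:R - c'%:R : R) <= 1 by rewrite lerBlDr addrC natr1 ler_nat.
  have : 0 <= (c%:R - c'%:R : R) by rewrite subr_ge0 ler_nat.
  rewrite natrD natrB// /b0.
  set u := c%:R - c'%:R; have -> : c%:R + t%:R - (c'%:R - t%:R) = u + 2 * t%:R :> R.
    by rewrite /u; ring.
  have t0 : t%:R <= (t%:R : R) ^+ 2 by rewrite -natrX ler_nat; nia.
  have t1 : 0 <= (t%:R : R) by [].
  move: (t%:R : R) t0 t1 (u : R) => x t0 t1 v u0 u1 u2.
  have : (v + 2 * x) ^+ 2 <= 8 * x ^+ 2 + 2.
    have : 0 <= (v - 2 * x) ^+ 2 by exact: sqr_ge0.
    by rewrite !expr2 in u2 *; nra.
  move=> h3; have := ler_wpM2l (ltW gam0) h3.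
  have := ler_wpM2l (ltW gam0) t0; lra.
apply: (le_trans (ler_sum _ (fun t _ => step t))).
rewrite -mulr_sumr.
have geo : \sum_(t < n) q ^+ t <= (1 - q)^-1.
  rewrite -[leRHS]mul1r ler_pdivlMr ?subr_gt0//.
  have -> : (\sum_(t < n) q ^+ t) * (1 - q) = 1 - q ^+ n.
    by rewrite -[RHS]opprB subrX1 -mulNr opprB mulrC.
  by rewrite gerBl exprn_ge0.
rewrite /pair_const -/q.
have -> : 2 * expR (gam / 8) / (1 - q) / 2 * (p c * p c') =
   expR (gam / 8) * (p c * p c') * (1 - q)^-1 by field; lra.
by rewrite ler_wpM2l// !mulr_ge0 ?expR_ge0 ?(ltW (p_gt0 _)).
Qed.

(** Fold the sum at the middle indices c and c' of s; the central product, which bounds each half by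
    [pair_gauss_half], is itself one term of the unweighted sum. *)
Lemma pair_gauss s :
  \sum_(i < s.+1) p i * p (s - i)%N * expR (b0 * (i%:R - (s - i)%:R) ^+ 2)
  <= pair_const * \sum_(i < s.+1) p i * p (s - i)%N.
Proof.
pose f i := p i * p (s - i)%N * expR (b0 * (i%:R - (s - i)%:R) ^+ 2).
pose c := uphalf s; pose c' := (s - c)%N.
have cE : (c' <= c <= c'.+1)%N /\ (c + c' = s)%N by rewrite /c' /c; lia.
have pp i : 0 <= p i * p (s - i)%N by rewrite mulr_ge0 ?(ltW (p_gt0 _)).
have big_c : p c * p c' <= \sum_(i < s.+1) p i * p (s - i)%N.
  have cs : (c < s.+1)%N by lia.
  rewrite (bigD1 (Ordinal cs))//= lerDl; apply: sumr_ge0 => i _; exact: pp.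
have -> : \sum_(i < s.+1) p i * p (s - i)%N * expR (b0 * (i%:R - (s - i)%:R) ^+ 2)
   = \sum_(i < s.+1) f i by [].
have f_sym i : (i <= s)%N -> f (s - i)%N = f i.
  move=> is_; rewrite /f subKn// [p (s - i)%N * _]mulrC; congr (_ * expR (_ * _)).
  by rewrite -sqrrN opprB.
have half : \sum_(t < c'.+1) f (c + t)%N <= pair_const / 2 * (p c * p c').
  rewrite (le_trans _ (@pair_gauss_half c c' c'.+1 _ _))//; last by lia.
  apply: ler_sum => t _; rewrite /f.
  by have -> : (s - (c + t) = c' - t)%N by lia.
have f0 i : 0 <= f i by rewrite /f mulr_ge0 ?expR_ge0.
have -> : \sum_(i < s.+1) f i = \sum_(i < c) f i + \sum_(t < c'.+1) f (c + t)%N.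
  have -> : s.+1 = (c + c'.+1)%N by lia.
  by rewrite big_split_ord /=.
(* Reflecting i to s - i maps the lower part onto the upper one, shifted past the central term when
   s is even. *)
have low : \sum_(i < c) f i <= \sum_(t < c'.+1) f (c + t)%N.
  have E : \sum_(i < c) f i = \sum_(t < c) f (c + (c' + 1 - c) + t)%N.
    rewrite (reindex_inj rev_ord_inj); apply: eq_bigr => i _ /=.
    have := ltn_ord i => ic.
    by rewrite -(@f_sym (c - i.+1)%N); [congr f; lia|lia].
  rewrite {}E.
  have [ccE|ccE] := leqP c c'.
    have -> : (c' + 1 - c = 1)%N by lia.
    rewrite [leRHS]big_ord_recl addrC -[leLHS]addr0 lerD//.
    have -> : c' = c by lia.
    by apply: ler_sum => t _; rewrite /bump /= -addnA.
  have -> : (c' + 1 - c = 0)%N by lia.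
  have -> : c = c'.+1 by lia.
  by rewrite addn0.
apply: (le_trans (lerD (le_trans low half) half)).
rewrite -mulrDl -splitr ler_wpM2l//; exact: ltW pair_const_gt0.
Qed.

End gaussian_pair.

(** * Sub-Gaussian estimates for the four child counts *)

Section quad_gauss.
Context {R : realType} (gam : R) (p : nat -> R).
Hypotheses (gam0 : 0 < gam) (lp : log_concave (expR gam) p).
Implicit Types (m : nat) (f h : nat -> nat -> nat -> nat -> R).

Let p_gt0 n : 0 < p n. Proof. by case: lp. Qed.

(** Unnormalised expectation under the law that splits m points among four exchangeable children
    with weights p; [wquad m (fun _ _ _ _ => 1)] is its normalisation. *)
Definition wquad m f : R :=
  quad m (fun i j k l => p i * p j * (p k * p l) * f i j k l).

Lemma wquad_le m f h :
  (forall i j k l, (i + j + k + l = m)%N -> f i j k l <= h i j k l) ->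
  wquad m f <= wquad m h.
Proof.
move=> fh; apply: quad_le => i j k l /fh.
by move=> H; rewrite ler_wpM2l// !mulr_ge0// ltW.
Qed.

Lemma eq_wquad m f h :
  (forall i j k l, (i + j + k + l = m)%N -> f i j k l = h i j k l) ->
  wquad m f = wquad m h.
Proof. by move=> fh; apply: eq_quad => i j k l /fh ->. Qed.

Lemma wquadD m f h :
  wquad m (fun i j k l => f i j k l + h i j k l) = wquad m f + wquad m h.
Proof.
rewrite /wquad -quadD; apply: eq_quad => i j k l _.
by rewrite mulrDr.
Qed.

Lemma wquadZ m c f : wquad m (fun i j k l => c * f i j k l) = c * wquad m f.
Proof.
by rewrite /wquad -quadZ; apply: eq_quad => i j k l _; rewrite mulrCA.
Qed.

Lemma wquad_cst m c : wquad m (fun _ _ _ _ => c) = c * wquad m (fun _ _ _ _ => 1).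
Proof. by rewrite -wquadZ; apply: eq_wquad => *; rewrite mulr1. Qed.

Lemma wquad1_gt0 m : 0 < wquad m (fun _ _ _ _ => 1).
Proof.
rewrite [ltRHS](_ : _ = convol (convol p p) (convol p p) m).
  by apply: conv_gt0 => n; exact: conv_gt0.
by rewrite -quad_conv; apply: eq_quad => *; rewrite mulr1.
Qed.

Lemma wquad_swap12 m f : wquad m f = wquad m (fun i j k l => f j i k l).
Proof.
by rewrite /wquad quad_swap12; apply: eq_quad => *; congr (_ * _); rewrite [p _ * p _]mulrC.
Qed.

Lemma wquad_swap23 m f : wquad m f = wquad m (fun i j k l => f i k j l).
Proof. by rewrite /wquad quad_swap23; apply: eq_quad => *; congr (_ * _); ring. Qed.

Lemma wquad_swap34 m f : wquad m f = wquad m (fun i j k l => f i j l k).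
Proof.
rewrite /wquad quad_swap34; apply: eq_quad => i j k l _; congr (_ * _).
by rewrite [p l * _]mulrC.
Qed.

                                                                   
Lemma wquad_pairs m (h : nat -> nat -> R) (q := wquad m (fun i j _ _ => h i j)) :
  [/\ wquad m (fun i j k l => h i k) = q, wquad m (fun i j k l => h i l) = q &
      [/\ wquad m (fun i j k l => h j k) = q, wquad m (fun i j k l => h j l) = q &
      wquad m (fun i j k l => h k l) = q]].
Proof.
have E13 : wquad m (fun i j k l => h i k) = q by rewrite wquad_swap23.
have E14 : wquad m (fun i j k l => h i l) = q by rewrite wquad_swap34.
have E23 : wquad m (fun i j k l => h j k) = q by rewrite wquad_swap12.
have E24 : wquad m (fun i j k l => h j l) = q by rewrite wquad_swap12.
by do !split => //; rewrite wquad_swap23.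
Qed.

Let b0 := gam / 16.
Let K := pair_const gam.

Lemma wquad_pair_gauss m :
  wquad m (fun i j _ _ => expR (b0 * (i%:R - j%:R) ^+ 2)) <=
  K * wquad m (fun _ _ _ _ => 1).
Proof.
rewrite -wquadZ; apply: quad_pair_le => k l s _.
have := ler_wpM2r (_ : 0 <= p k * p l) (pair_gauss gam0 lp s).
rewrite -/b0 -/K => H.
rewrite [leLHS](_ : _ =
  (\sum_(i < s.+1) p i * p (s - i)%N * expR (b0 * (i%:R - (s - i)%:R) ^+ 2)) *
  (p k * p l)); last first.
  by rewrite mulr_suml; apply: eq_bigr => i _; rewrite mulrAC.
rewrite [leRHS](_ : _ = K * (\sum_(i < s.+1) p i * p (s - i)%N) * (p k * p l)).
  by apply: H; rewrite mulr_ge0// ltW.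
rewrite mulr_sumr mulr_suml; apply: eq_bigr => i _.
by rewrite mulr1 [LHS]mulrC [LHS]mulrA.
Qed.

Lemma pair_const_ge1 : 1 <= K.
Proof.
rewrite /K /pair_const ler_pdivlMr.
  have : 1 <= expR (gam / 8) by rewrite -expR0 ler_expR divr_ge0// ltW.
  have := expR_ge0 (- (gam / 2)); lra.
by rewrite subr_gt0 expR_lt1 oppr_lt0 divr_gt0.
Qed.

Let b0_gt0 : 0 < b0. Proof. by rewrite divr_gt0. Qed.

Let lnK : 0 <= ln K. Proof. by rewrite ln_ge0// pair_const_ge1. Qed.

Definition sub_gauss_const : R := (2^-1 + 4 * ln K) / b0.

Lemma sub_gauss_const_ge0 : 0 <= sub_gauss_const.
Proof. apply: divr_ge0; last exact: ltW.
by apply: addr_ge0; rewrite ?invr_ge0// mulr_ge0. Qed.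

(** When 2 th^2 + b <= b0, symmetrising turns the linear tilt into a Gaussian weight, which is
    interpolated between 1 and e^(b0 (i-j)^2) so that the cost is only a small power of K. Otherwise
    th^2 exceeds b0/4, completing the square suffices, and the constant ln K is absorbed by th^2. *)
Lemma wquad_sub_gauss m (th b : R) : 0 <= b -> b <= b0 / 2 ->
  wquad m (fun i j _ _ => expR (th * (i%:R - j%:R) + b * (i%:R - j%:R) ^+ 2)) <=
  expR (sub_gauss_const * (th ^+ 2 + b)) * wquad m (fun _ _ _ _ => 1).
Proof.
move=> bge0 bb0; set q1 := wquad m (fun _ _ _ _ => 1).
have q1_gt0 : 0 < q1 by exact: wquad1_gt0.
pose Y (i j : nat) := expR (b0 * (i%:R - j%:R) ^+ 2).
have YK : wquad m (fun i j _ _ => Y i j) <= K * q1 by exact: wquad_pair_gauss.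
have K0 : 0 < K by rewrite (lt_le_trans _ pair_const_ge1).
have KE : K = expR (ln K) by rewrite exp.lnK.
have [small|large] := leP (2 * th ^+ 2 + b) b0.
  (* The Gaussian weight that is wanted, as a fraction of the available [b0]. *)
  pose lam := (2 * th ^+ 2 + b) / b0.
  have lam0 : 0 <= lam by rewrite divr_ge0 ?(ltW b0_gt0)// addr_ge0// mulr_ge0 ?sqr_ge0.
  have lam1 : lam <= 1 by rewrite ler_pdivrMr// mul1r.
  have lamE : lam * b0 = 2 * th ^+ 2 + b by rewrite divfK// gt_eqF.
  have S1 : wquad m (fun i j _ _ => expR (th * (i%:R - j%:R) + b * (i%:R - j%:R) ^+ 2))
      <= wquad m (fun i j _ _ => expR (lam * (b0 * (i%:R - j%:R) ^+ 2))).
    set A := (X in X <= _); set B := (X in _ <= X).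
    (* Exchanging i and j in one copy of A makes the sum a hyperbolic cosine. *)
    suff : A + A <= 2 * B by lra.
    rewrite {2}/A wquad_swap12 /A /B -wquadD -wquadZ; apply: wquad_le => i j k l _.
    set u := i%:R - j%:R.
    have -> : j%:R - i%:R = - u :> R by rewrite opprB.
    have -> : lam * (b0 * u ^+ 2) = 2 * (th * u) ^+ 2 + b * u ^+ 2.
      by rewrite mulrA lamE exprMn; ring.
    rewrite mulrN sqrrN !expRD -mulrDl mulrA.
    by rewrite ler_wpM2r ?expR_ge0// (le_trans (cosh_le_gauss _)).
  apply: (le_trans S1).
  have S2 : wquad m (fun i j _ _ => expR (lam * (b0 * (i%:R - j%:R) ^+ 2))) <=
     expR (lam * ln K) * q1.
    rewrite -[leRHS]mulr1.
    apply: (@le_trans _ _ (wquad m (fun i j _ _ =>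
      expR (lam * ln K) * ((1 - lam) + lam * (K^-1 * Y i j))))).
      apply: wquad_le => i j k l _.
      (* Pull out K^lam, then use convexity of the exponential in lam between 0 and 1; the
         expectation of e^y / K is at most the normalisation. *)
      set y := b0 * _; have -> : lam * y = lam * ln K + (y - ln K) * lam by ring.
      rewrite expRD ler_wpM2l ?expR_ge0//.
      have := @expR_le_chord R (y - ln K) 1 lam.
      rewrite divr1 mulr1 lam0 lam1 => /(_ isT ltr01) /le_trans; apply.
      by rewrite expRD expRN -KE /Y -/y [expR y * _]mulrC.
    rewrite wquadZ -mulrA ler_wpM2l ?expR_ge0// wquadD wquad_cst -/q1 !wquadZ mulr1.
    have : K^-1 * wquad m (fun i j _ _ => Y i j) <= q1.
      by rewrite mulrC ler_pdivrMr// mulrC.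
    move=> /(ler_wpM2l lam0); lra.
  apply: (le_trans S2); rewrite ler_wpM2r ?(ltW q1_gt0)// ler_expR.
  rewrite /lam /sub_gauss_const mulrAC [leRHS]mulrAC ler_wpM2r ?invr_ge0 ?(ltW b0_gt0)//.
  have t2 := sqr_ge0 th; have := lnK; nra.
have th2 : b0 / 4 <= th ^+ 2 by lra.
apply: (@le_trans _ _ (expR (th ^+ 2 / (2 * b0)) * (K * q1))).
  apply: le_trans (ler_wpM2l (expR_ge0 _) YK).
  rewrite -wquadZ; apply: wquad_le => i j k l _.
  rewrite /Y -expRD ler_expR; set u := i%:R - j%:R.
  have h : th * u <= th ^+ 2 / (2 * b0) + b0 / 2 * u ^+ 2.
    rewrite -subr_ge0.
    have -> : th ^+ 2 / (2 * b0) + b0 / 2 * u ^+ 2 - th * u =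
      (th - b0 * u) ^+ 2 / (2 * b0) by field; rewrite gt_eqF.
    by rewrite divr_ge0 ?sqr_ge0// mulr_ge0// ltW.
  have := ler_wpM2r (sqr_ge0 u) bb0; lra.
rewrite mulrA ler_wpM2r ?(ltW q1_gt0)// {1}KE -expRD ler_expR.
have -> : sub_gauss_const * (th ^+ 2 + b) =
   th ^+ 2 / (2 * b0) + (4 * ln K * th ^+ 2 / b0 + sub_gauss_const * b).
  by rewrite /sub_gauss_const; field; rewrite gt_eqF.
rewrite lerD2l; apply: (@le_trans _ _ (4 * ln K * th ^+ 2 / b0)).
  rewrite ler_pdivlMr//; have := ler_wpM2l lnK th2; lra.
by rewrite lerDl mulr_ge0// sub_gauss_const_ge0.
Qed.

Lemma expR_mean6 (x1 x2 x3 x4 x5 x6 : R) :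
  expR ((x1 + x2 + x3 + x4 + x5 + x6) / 6) <=
  6^-1 * (expR x1 + expR x2 + expR x3 + expR x4 + expR x5 + expR x6).
Proof.
set a := (_ / 6).
have h x : expR a * (1 + (x - a)) <= expR x.
  rewrite -[in leRHS](subrKC a x) expRD ler_wpM2l ?expR_ge0//; exact: expR_ge1Dx.
have aE : x1 + x2 + x3 + x4 + x5 + x6 = 6 * a by rewrite /a mulrC divfK.
rewrite mulrC ler_pdivlMr//.
have := h x1; have := h x2; have := h x3; have := h x4; have := h x5; have := h x6.
have : expR a * 6 = expR a * (1 + (x1 - a)) + expR a * (1 + (x2 - a)) +
  expR a * (1 + (x3 - a)) + expR a * (1 + (x4 - a)) + expR a * (1 + (x5 - a)) +
  expR a * (1 + (x6 - a)).
  by rewrite -!mulrDr; congr (_ * _); lra.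
lra.
Qed.

Definition quad_gauss_const := 9 / 4 * sub_gauss_const.

                                                             
                                                        
(** Since the centred counts sum to zero, the exponent is the mean, over the six pairs of children,
    of 3/2 (a_p - a_q)(i_p - i_q) + 3/2 b (i_p - i_q)^2. So only differences of tilts matter, and
    [expR_mean6] with exchangeability reduces to [wquad_sub_gauss]. *)
Lemma wquad_gauss m (a1 a2 a3 a4 b o : R) : 0 <= b -> b <= b0 / 3 ->
  (a1 - a2) ^+ 2 <= o -> (a1 - a3) ^+ 2 <= o -> (a1 - a4) ^+ 2 <= o ->
  (a2 - a3) ^+ 2 <= o -> (a2 - a4) ^+ 2 <= o -> (a3 - a4) ^+ 2 <= o ->
  wquad m (fun i j k l =>
    expR (a1 * (i%:R - m%:R / 4) + a2 * (j%:R - m%:R / 4) +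
          a3 * (k%:R - m%:R / 4) + a4 * (l%:R - m%:R / 4) +
          b * ((i%:R - m%:R / 4) ^+ 2 + (j%:R - m%:R / 4) ^+ 2 +
               (k%:R - m%:R / 4) ^+ 2 + (l%:R - m%:R / 4) ^+ 2))) <=
  expR (quad_gauss_const * (o + b)) * wquad m (fun _ _ _ _ => 1).
Proof.
move=> bge0 bb0 o12 o13 o14 o23 o24 o34.
set q1 := wquad m (fun _ _ _ _ => 1).
have q1_gt0 : 0 < q1 by exact: wquad1_gt0.
pose h a (i j : nat) := expR (3 / 2 * a * (i%:R - j%:R) + 3 / 2 * b * (i%:R - j%:R) ^+ 2).
have hle (a : R) : a ^+ 2 <= o -> wquad m (fun i j _ _ => h a i j) <= 
    expR (quad_gauss_const * (o + b)) * q1.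
  move=> ao; apply: (le_trans (@wquad_sub_gauss m (3 / 2 * a) (3 / 2 * b) _ _)).
  - by rewrite mulr_ge0.
  - by lra.
  rewrite ler_wpM2r ?(ltW q1_gt0)// ler_expR /quad_gauss_const.
  have -> : 9 / 4 * sub_gauss_const * (o + b) = sub_gauss_const * (9 / 4 * (o + b)) by ring.
  rewrite ler_wpM2l ?sub_gauss_const_ge0//.
  by rewrite exprMn; lra.
have [P13 P14 [P23 P24 P34]] := wquad_pairs m (h (a1 - a2)).
apply: (@le_trans _ _ (wquad m (fun i j k l => 6^-1 * (h (a1 - a2) i j +
  h (a1 - a3) i k + h (a1 - a4) i l + h (a2 - a3) j k + h (a2 - a4) j l +
  h (a3 - a4) k l)))).
  apply: wquad_le => i j k l ijkl.
  apply: le_trans (expR_mean6 _ _ _ _ _ _); rewrite ler_expR.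
  by rewrite -ijkl !natrD le_eqVlt; apply/orP; left; apply/eqP; field.
rewrite wquadZ !wquadD.
have [-> _ _] := wquad_pairs m (h (a1 - a3)).
have [_ -> _] := wquad_pairs m (h (a1 - a4)).
have [_ _ [-> _ _]] := wquad_pairs m (h (a2 - a3)).
have [_ _ [_ -> _]] := wquad_pairs m (h (a2 - a4)).
have [_ _ [_ _ ->]] := wquad_pairs m (h (a3 - a4)).
have := hle _ o12; have := hle _ o13; have := hle _ o14; have := hle _ o23.
have := hle _ o24; have := hle _ o34; lra.
Qed.

Lemma wquad_mean m : 
  [/\ wquad m (fun i _ _ _ => i%:R) = m%:R / 4 * wquad m (fun _ _ _ _ => 1),
      wquad m (fun _ i _ _ => i%:R) = m%:R / 4 * wquad m (fun _ _ _ _ => 1),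
      wquad m (fun _ _ i _ => i%:R) = m%:R / 4 * wquad m (fun _ _ _ _ => 1) &
      wquad m (fun _ _ _ i => i%:R) = m%:R / 4 * wquad m (fun _ _ _ _ => 1)].
Proof.
set q1 := wquad m (fun _ _ _ _ => 1).
have E2 : wquad m (fun _ i _ _ => i%:R) = wquad m (fun i _ _ _ => i%:R).
  by rewrite wquad_swap12.
have E3 : wquad m (fun _ _ i _ => i%:R) = wquad m (fun i _ _ _ => i%:R).
  by rewrite wquad_swap23.
have E4 : wquad m (fun _ _ _ i => i%:R) = wquad m (fun i _ _ _ => i%:R).
  by rewrite wquad_swap34.
suff E1 : wquad m (fun i _ _ _ => i%:R) = m%:R / 4 * q1 by rewrite E2 E3 E4.
have : wquad m (fun i j k l => i%:R + j%:R + k%:R + l%:R) = m%:R * q1.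
  by rewrite -wquad_cst; apply: eq_wquad => i j k l <-; rewrite !natrD.
rewrite !wquadD E2 E3 E4; lra.
Qed.

Definition quad_var_const := 9 * K / (16 * b0).

Lemma quad_var_const_gt0 : 0 < quad_var_const.
Proof.
apply: divr_gt0; last by rewrite mulr_gt0.
by rewrite mulr_gt0// (lt_le_trans ltr01 pair_const_ge1).
Qed.

(** i - m/4 is a quarter of the sum of the differences with the three other counts, and b0 u^2 <=
    e^(b0 u^2). *)
Lemma wquad_var m (V := quad_var_const * wquad m (fun _ _ _ _ => 1)) :
  [/\ wquad m (fun i _ _ _ => (i%:R - m%:R / 4) ^+ 2) <= V,
      wquad m (fun _ i _ _ => (i%:R - m%:R / 4) ^+ 2) <= V,
      wquad m (fun _ _ i _ => (i%:R - m%:R / 4) ^+ 2) <= V &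
      wquad m (fun _ _ _ i => (i%:R - m%:R / 4) ^+ 2) <= V].
Proof.
set f := fun i : nat => (i%:R - m%:R / 4) ^+ 2.
have E2 : wquad m (fun _ i _ _ => f i) = wquad m (fun i _ _ _ => f i).
  by rewrite wquad_swap12.
have E3 : wquad m (fun _ _ i _ => f i) = wquad m (fun i _ _ _ => f i).
  by rewrite wquad_swap23.
have E4 : wquad m (fun _ _ _ i => f i) = wquad m (fun i _ _ _ => f i).
  by rewrite wquad_swap34.
suff E1 : wquad m (fun i _ _ _ => f i) <= V by rewrite E4 E3 E2.
pose h (i j : nat) := expR (b0 * (i%:R - j%:R) ^+ 2).
apply: (@le_trans _ _ (wquad m (fun i j k l => 3 / (16 * b0) * (h i j + h i k + h i l)))).
  apply: wquad_le => i j k l ijkl; rewrite /f -ijkl !natrD.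
  have hb a b : (a%:R - b%:R) ^+ 2 <= h a b / b0.
    rewrite ler_pdivlMr// mulrC; apply: le_trans (expR_ge1Dx _).
    by rewrite lerDr.
  have := hb i j; have := hb i k; have := hb i l.
  have -> : 3 / (16 * b0) * (h i j + h i k + h i l) =
    3 / 16 * (h i j / b0 + h i k / b0 + h i l / b0) by field; rewrite gt_eqF.
  set x := i%:R; set y := j%:R; set z := k%:R; set t := l%:R.
  have := sqr_ge0 ((x - y) - (x - z)); have := sqr_ge0 ((x - y) - (x - t)).
  have := sqr_ge0 ((x - z) - (x - t)).
  rewrite !expr2; lra.
rewrite wquadZ !wquadD; have [-> -> _] := wquad_pairs m h.
have := wquad_pair_gauss m; rewrite -/h => H.
have c0 : 0 <= 3 / (16 * b0) by rewrite divr_ge0// mulr_ge0// ltW.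
apply: (@le_trans _ _ (3 / (16 * b0) * (3 * (K * wquad m (fun _ _ _ _ => 1))))).
  rewrite ler_wpM2l//; lra.
by rewrite /V /quad_var_const le_eqVlt; apply/orP; left; apply/eqP; field; rewrite gt_eqF.
Qed.

(** Jensen's inequality through the tangent of exp at a. *)
Lemma wquad_jensen m f a :
  a * wquad m (fun _ _ _ _ => 1) <= wquad m f ->
  expR a * wquad m (fun _ _ _ _ => 1) <= wquad m (fun i j k l => expR (f i j k l)).
Proof.
move=> af; apply: (@le_trans _ _ (wquad m (fun i j k l => expR a * (1 + (f i j k l - a))))).
  rewrite wquadZ ler_wpM2l ?expR_ge0// wquadD lerDl.
  by rewrite wquadD wquad_cst mulNr subr_ge0.
apply: wquad_le => i j k l _.
rewrite -[in leRHS](subrKC a (f i j k l)) expRD ler_wpM2l ?expR_ge0//.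
exact: expR_ge1Dx.
Qed.

End quad_gauss.

                                               

(** * Quadtree partition functions *)

Section tree.
Context {R : realType} (beta : R).
Hypothesis beta_gt0 : 0 < beta.
Implicit Types (g : nat -> nat -> R) (W : nat -> nat -> nat -> R).

Definition repulsion (m : nat) : R := expR (- (beta * 'C(m, 2)%:R)).

                                                                           
                                                                         
                                                
(** Partition function of m points in the cell (x, y) with d further subdivisions. Doubling the
    coordinates descends to the children, the factor 1/m! at a leaf makes the points
    indistinguishable, and a leaf carries no repulsion of its own. *)
Fixpoint tree g (d m x y : nat) : R :=
  if d is d'.+1 then
    repulsion m * quad m (fun i j k l =>
      tree g d' i x.*2 y.*2 * tree g d' j x.*2 y.*2.+1 *
      (tree g d' k x.*2.+1 y.*2 * tree g d' l x.*2.+1 y.*2.+1))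
  else g x y ^+ m / m`!%:R.

Definition ell d m : R := tree (fun _ _ => 1) d m 0 0.

Lemma repulsion_gt0 m : 0 < repulsion m. Proof. exact: expR_gt0. Qed.

Lemma tree_cst c d m x y : tree (fun _ _ => c) d m x y = tree (fun _ _ => c) d m 0 0.
Proof.
elim: d m x y => [//|d IH] m x y /=; congr (_ * _); apply: eq_quad => i j k l _.
by rewrite !(IH _ x.*2) !(IH _ x.*2.+1) !(IH _ 0.*2) !(IH _ 0.*2.+1).
Qed.

Lemma ellS d m : ell d.+1 m = repulsion m * wquad (ell d) m (fun _ _ _ _ => 1).
Proof.
rewrite /ell /=; congr (_ * _); apply: eq_quad => i j k l _.
by rewrite mulr1 !(tree_cst _ _ _ 0.*2) !(tree_cst _ _ _ 0.*2.+1).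
Qed.

Lemma ell0 m : ell 0 m = m`!%:R^-1.
Proof. by rewrite /ell /= expr1n mul1r. Qed.

Lemma tree_scale c g d m x y :
  tree (fun a b => c * g a b) d m x y = c ^+ m * tree g d m x y.
Proof.
elim: d m x y => [|d IH] m x y /=; first by rewrite exprMn mulrA.
rewrite mulrCA; congr (_ * _); rewrite -quadZ; apply: eq_quad => i j k l <-.
by rewrite !IH !exprD; ring.
Qed.

Lemma ellSE d m :
  ell d.+1 m = repulsion m * convol (convol (ell d) (ell d)) (convol (ell d) (ell d)) m.
Proof.
by rewrite ellS -quad_conv; congr (_ * _); apply: eq_quad => *; rewrite mulr1.
Qed.

Lemma ell0_log_concave : log_concave 1 (ell 0).
Proof.
split=> [n|n]; first by rewrite ell0 invr_gt0 ltr0n fact_gt0.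
rewrite !ell0 mul1r expr2 -!invfM lef_pV2 ?posrE ?mulr_gt0 ?ltr0n ?fact_gt0//.
by rewrite -!natrM ler_nat !factS; have := fact_gt0 n; nia.
Qed.

Lemma bin2SS n : ('C(n, 2) + 'C(n.+2, 2) = 'C(n.+1, 2) + 'C(n.+1, 2) + 1)%N.
Proof. by rewrite !(binS _ 1) !bin1; lia. Qed.

(** Only ordinary log-concavity of the children is passed through the convolutions; the repulsion of
    the top level then supplies the whole factor e^beta, because C(n,2) + C(n+2,2) = 2 C(n+1,2) + 1.
    The constant is thus the same at every depth. *)
Lemma ell_log_concave d : log_concave (expR beta) (ell d.+1).
Proof.
have step b : log_concave 1 b ->
    log_concave (expR beta) (fun m => repulsion m * convol (convol b b) (convol b b) m).
  move=> lb; have lbb := conv_log_concave lb lb.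
  have [c0 cc] := conv_log_concave lbb lbb.
  split=> n; first by rewrite mulr_gt0 ?repulsion_gt0.
  set c := convol _ _ in c0 cc *.
  have -> : expR beta * (repulsion n * c n * (repulsion n.+2 * c n.+2)) =
    (expR beta * (repulsion n * repulsion n.+2)) * (1 * (c n * c n.+2)) by ring.
  rewrite exprMn (_ : expR beta * _ = repulsion n.+1 ^+ 2).
    by rewrite ler_wpM2l ?sqr_ge0.
  rewrite /repulsion -!expRD -expRM_natl; congr expR.
  have := congr1 (fun k => k%:R : R) (bin2SS n); rewrite /= !natrD => h.
  have := congr1 (fun k => beta * k) h; rewrite /=; lra.
have b1 : 1 <= expR beta by rewrite -expR0 ler_expR ltW.
have eqlc (a b : nat -> R) c : a =1 b -> log_concave c b -> log_concave c a.
  by move=> ab [b0 bc]; split=> n; rewrite ?ab.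
elim: d => [|d IH]; apply: (eqlc _ _ _ (ellSE _)); apply: step.
- exact: ell0_log_concave.
- exact: log_concaveW IH.
Qed.

Lemma ell_log_concave0 d : log_concave (expR 0) (ell d).
Proof.
rewrite expR0; case: d => [|d]; first exact: ell0_log_concave.
apply: log_concaveW (ell_log_concave d).
by rewrite -expR0 ler_expR ltW.
Qed.

Lemma ell_gt0 d m : 0 < ell d m.
Proof.
case: d => [|d]; first by case: ell0_log_concave.
by case: (ell_log_concave d).
Qed.

Lemma tree_ge0 g d m x y : (forall a b, 0 <= g a b) -> 0 <= tree g d m x y.
Proof.
move=> g0; elim: d m x y => [|d IH] m x y /=.
  by rewrite divr_ge0// exprn_ge0.
by rewrite mulr_ge0 ?expR_ge0//; apply: quad_ge0 => *; rewrite !mulr_ge0.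
Qed.

Lemma quad0 (f : nat -> nat -> nat -> nat -> R) : quad 0 f = f 0%N 0%N 0%N 0%N.
Proof. by rewrite /quad !big_ord1. Qed.

Lemma tree_m0 g d x y : tree g d 0 x y = 1.
Proof.
elim: d x y => [|d IH] x y /=; first by rewrite expr0 fact0 divr1.
by rewrite quad0 !IH !mulr1 /repulsion bin_small// mulr0 oppr0 expR0.
Qed.

Lemma conv_expn_fact (a b : R) m :
  convol (fun n => a ^+ n / n`!%:R) (fun n => b ^+ n / n`!%:R) m = (a + b) ^+ m / m`!%:R.
Proof.
rewrite /convol exprDn (reindex_inj rev_ord_inj) mulr_suml; apply: eq_bigr => i _ /=.
have im : (i <= m)%N by have := ltn_ord i.
rewrite subSS subKn// -mulr_natr -(bin_fact im) !natrM.
have u n : n`!%:R != 0 :> R by rewrite pnatr_eq0 -lt0n fact_gt0.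
have ub : 'C(m, i)%:R != 0 :> R by rewrite pnatr_eq0 -lt0n bin_gt0.
by field; rewrite ub !u.
Qed.

Lemma repulsion_le1 m : repulsion m <= 1.
Proof. by rewrite -expR0 ler_expR oppr_le0 mulr_ge0// ltW. Qed.

(** One more level offers each point four subcells and adds a repulsion of at most 1. At depth 0 the
    fourfold convolution of 1/n! is 4^n / n!. *)
Lemma ell_le d m : ell d.+1 m <= 4 ^+ m * ell d m.
Proof.
elim: d m => [|d IH] m.
  rewrite ellSE (_ : convol _ _ m = 4 ^+ m * ell 0 m).
    by rewrite ger_pMl ?repulsion_le1// mulr_gt0 ?exprn_gt0 ?ell_gt0.
  have E (b : R) : convol (fun n => b ^+ n / n`!%:R) (fun n => b ^+ n / n`!%:R) =
     (fun n => (b + b) ^+ n / n`!%:R).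
    by apply/funext => n; rewrite conv_expn_fact.
  have -> : ell 0 = fun n => 1 ^+ n / n`!%:R.
    by apply/funext => n; rewrite ell0 expr1n mul1r.
  by rewrite !E expr1n mul1r; congr (_ ^+ _ / _); lra.
rewrite ellS [in leRHS]ellS mulrCA ler_pM2l ?repulsion_gt0// /wquad -quadZ.
apply: quad_le => i j k l <-; rewrite !mulr1 !exprD.
have -> : 4 ^+ i * 4 ^+ j * 4 ^+ k * 4 ^+ l * (ell d i * ell d j * (ell d k * ell d l)) =
  (4 ^+ i * ell d i) * (4 ^+ j * ell d j) * ((4 ^+ k * ell d k) * (4 ^+ l * ell d l)) by ring.
have e0 d' n : 0 <= ell d' n by exact/ltW/ell_gt0.
by apply: ler_pM; [exact: mulr_ge0|exact: mulr_ge0|exact: ler_pM|exact: ler_pM].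
Qed.

(** A lower bound, uniform in the depth, for the probability that all m points of a cell fall into
    one prescribed child; see [allin_wquad]. *)
Definition allin (m : nat) : R := repulsion m / 4 ^+ m.

Lemma allin_gt0 m : 0 < allin m.
Proof. by rewrite divr_gt0 ?repulsion_gt0 ?exprn_gt0. Qed.

Lemma allin_ge m : expR (- ((beta + ln 4) * m%:R ^+ 2)) <= allin m.
Proof.
have -> : allin m = expR (- (beta * 'C(m, 2)%:R + ln 4 * m%:R)).
  by rewrite /allin /repulsion opprD expRD (expRN (_ * m%:R)) expRM_natr lnK// posrE.
rewrite ler_expR lerN2 mulrDl lerD//.
  rewrite ler_wpM2l ?(ltW beta_gt0)// -natrX ler_nat.
  by rewrite bin2; have := half_leq (leq_mul (leqnn m) (leq_pred m)); lia.
by rewrite ler_wpM2l ?ln_ge0 ?ler1n// -natrX ler_nat; case: m => // m; rewrite leq_pmulr.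
Qed.

Lemma allin_wquad d m :
  allin m * wquad (ell d) m (fun _ _ _ _ => 1) <= ell d m.
Proof.
have := ell_le d m; rewrite ellS => h.
rewrite /allin mulrAC ler_pdivrMr ?exprn_gt0//.
by rewrite [leRHS]mulrC.
Qed.

Lemma quad_single (f : nat -> nat -> nat -> nat -> R) m :
  (forall i j k l, (i + j + k + l = m)%N -> 0 <= f i j k l) ->
  [/\ f m 0%N 0%N 0%N <= quad m f, f 0%N m 0%N 0%N <= quad m f,
      f 0%N 0%N m 0%N <= quad m f & f 0%N 0%N 0%N m <= quad m f].
Proof.
have key (h : nat -> nat -> nat -> nat -> R) :
    (forall i j k l, (i + j + k + l = m)%N -> 0 <= h i j k l) ->
    h m 0%N 0%N 0%N <= quad m h.
  move=> h0; have hge (i j k l : 'I_m.+1) : 0 <= h i j k l *+ (i + j + k + l == m)%N.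
    by case: eqP => // /h0.
  have term (F : 'I_m.+1 -> R) i : (forall j, 0 <= F j) -> F i <= \sum_j F j.
    by move=> F0; rewrite (bigD1 i)//= lerDl sumr_ge0.
  apply: le_trans (term _ ord_max _) => [|i]; last by do !(apply: sumr_ge0 => ? _).
  do 3!(apply: le_trans (term _ ord0 _) => [|i]; last by do ?(apply: sumr_ge0 => ? _)).
  by rewrite /= !addn0 eqxx.
move=> f0; split; first exact: key.
- rewrite quad_swap12; apply: (key (fun i j k l => f j i k l)) => i j k l e.
  by apply: f0; lia.
- rewrite quad_swap23 quad_swap12; apply: (key (fun i j k l => f j k i l)) => i j k l e.
  by apply: f0; lia.
- rewrite quad_swap34 quad_swap23 quad_swap12.
  by apply: (key (fun i j k l => f j k l i)) => i j k l e; apply: f0; lia.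
Qed.

(** Keep only the configurations with all points in one child: in terms of the ratios of [tree] to
    [ell], forcing the descent costs at most the factor [allin m]. *)
Lemma tree_child_ge g d m x y x' y' : (forall a b, 0 <= g a b) ->
  x' \in [:: x.*2; x.*2.+1] -> y' \in [:: y.*2; y.*2.+1] ->
  allin m * ell d.+1 m * tree g d m x' y' <= ell d m * tree g d.+1 m x y.
Proof.
move=> g0 xx yy.
have h : repulsion m * tree g d m x' y' <= tree g d.+1 m x y.
  rewrite /= ler_wpM2l ?expR_ge0//.
  set f := fun i j k l => _.
  have f0 i j k l : (i + j + k + l = m)%N -> 0 <= f i j k l.
    by move=> _; rewrite /f !mulr_ge0 ?tree_ge0.
  have [h1 h2 h3 h4] := quad_single f0.
  move: xx yy; rewrite !inE => /orP[]/eqP -> /orP[]/eqP ->.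
  - by move: h1; rewrite /f !tree_m0 !mulr1.
  - by move: h2; rewrite /f !tree_m0 !mulr1 mul1r.
  - by move: h3; rewrite /f !tree_m0 !mulr1 !mul1r.
  - by move: h4; rewrite /f !tree_m0 !mul1r.
apply: le_trans (ler_wpM2l (ltW (ell_gt0 d m)) h).
rewrite [leRHS]mulrA; apply: ler_wpM2r; first exact: tree_ge0.
rewrite /allin mulrAC ler_pdivrMr ?exprn_gt0// [leRHS](_ : _ = repulsion m * (4 ^+ m * ell d m)).
  by rewrite ler_wpM2l ?expR_ge0// ell_le.
by ring.
Qed.

Lemma tree_step_le g d m x y (B1 B2 B3 B4 : nat -> R) :
  (forall a b, 0 <= g a b) ->
  (forall i, tree g d i x.*2 y.*2 <= ell d i * expR (B1 i)) ->
  (forall i, tree g d i x.*2 y.*2.+1 <= ell d i * expR (B2 i)) ->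
  (forall i, tree g d i x.*2.+1 y.*2 <= ell d i * expR (B3 i)) ->
  (forall i, tree g d i x.*2.+1 y.*2.+1 <= ell d i * expR (B4 i)) ->
  tree g d.+1 m x y <= repulsion m *
    wquad (ell d) m (fun i j k l => expR (B1 i + B2 j + B3 k + B4 l)).
Proof.
move=> g0 h1 h2 h3 h4; rewrite /= ler_wpM2l ?expR_ge0//.
apply: quad_le => i j k l _; rewrite !expRD.
rewrite [leRHS](_ : _ = (ell d i * expR (B1 i)) * (ell d j * expR (B2 j)) *
  ((ell d k * expR (B3 k)) * (ell d l * expR (B4 l)))); last by ring.
by rewrite !ler_pM// ?mulr_ge0 ?tree_ge0.
Qed.

Lemma tree_step_ge g d m x y (B1 B2 B3 B4 : nat -> R) :
  (forall i, ell d i * expR (B1 i) <= tree g d i x.*2 y.*2) ->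
  (forall i, ell d i * expR (B2 i) <= tree g d i x.*2 y.*2.+1) ->
  (forall i, ell d i * expR (B3 i) <= tree g d i x.*2.+1 y.*2) ->
  (forall i, ell d i * expR (B4 i) <= tree g d i x.*2.+1 y.*2.+1) ->
  repulsion m * wquad (ell d) m (fun i j k l => expR (B1 i + B2 j + B3 k + B4 l)) <=
  tree g d.+1 m x y.
Proof.
move=> h1 h2 h3 h4; rewrite /= ler_wpM2l ?expR_ge0//.
have e0 c i : 0 <= ell d i * expR c by rewrite mulr_ge0 ?expR_ge0// ltW ?ell_gt0.
apply: quad_le => i j k l _; rewrite !expRD.
rewrite [leLHS](_ : _ = (ell d i * expR (B1 i)) * (ell d j * expR (B2 j)) *
  ((ell d k * expR (B3 k)) * (ell d l * expR (B4 l)))); last by ring.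
by apply: ler_pM; [exact: mulr_ge0|exact: mulr_ge0|exact: ler_pM|exact: ler_pM].
Qed.

(** The martingale property along the quadtree; the area fractions of a fixed set are the case in
    view. *)
Definition child_mean W := forall k x y, W k x y =
  (W k.+1 x.*2 y.*2 + W k.+1 x.*2 y.*2.+1 + W k.+1 x.*2.+1 y.*2 +
   W k.+1 x.*2.+1 y.*2.+1) / 4.

Lemma wquad_combo d m (w1 w2 w3 w4 : R) :
  wquad (ell d) m (fun i j k l => w1 * i%:R + w2 * j%:R + w3 * k%:R + w4 * l%:R) =
  m%:R * ((w1 + w2 + w3 + w4) / 4) * wquad (ell d) m (fun _ _ _ _ => 1).
Proof.
have [e1 e2 e3 e4] := wquad_mean (ell d) m.
by rewrite !wquadD !wquadZ e1 e2 e3 e4; field.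
Qed.

(** * Jensen and Hoeffding bounds for the tilted tree *)

Section leaf_bounds.
Variables (K : nat) (W : nat -> nat -> nat -> R) (th : R).
Hypotheses (Wmean : child_mean W) (W01 : forall k x y, 0 <= W k x y <= 1).

(** Mean of exp(th 1_D) over a uniform point of a leaf cell covered by D in proportion W. *)
Definition mgf_leaf (a b : nat) : R := 1 + (expR th - 1) * W K a b.

Lemma mgf_leaf_ge a b : expR (th * W K a b) <= mgf_leaf a b.
Proof.
have := @expR_le_chord R th 1 (W K a b) (W01 _ _ _) ltr01.
by rewrite /mgf_leaf divr1 mulr1; lra.
Qed.

Lemma mgf_leaf_gt0 a b : 0 < mgf_leaf a b.
Proof. exact: lt_le_trans (expR_gt0 _) (mgf_leaf_ge _ _). Qed.

(** The child counts have mean m/4 and W averages over children, so the linear exponent survives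
    Jensen at every split unchanged. *)
Lemma jensen_tree d k m x y : (k + d = K)%N ->
  ell d m * expR (th * (m%:R * W k x y)) <= tree mgf_leaf d m x y.
Proof.
elim: d k m x y => [|d IH] k m x y kd.
  have -> : k = K by lia.
  rewrite ell0 /= mulrC ler_wpM2r ?invr_ge0//.
  have -> : th * (m%:R * W K x y) = th * W K x y * m%:R by ring.
  rewrite expRM_natr lerXn2r// ?nnegrE ?expR_ge0 ?mgf_leaf_ge//.
  exact/ltW/mgf_leaf_gt0.
have {}IH i a b : ell d i * expR (th * W k.+1 a b * i%:R) <= tree mgf_leaf d i a b.
  by rewrite -mulrA [W _ _ _ * _]mulrC; apply: IH; lia.
apply: le_trans (tree_step_ge _ (fun i => IH i _ _) (fun i => IH i _ _)
  (fun i => IH i _ _) (fun i => IH i _ _)).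
rewrite ellS -mulrA ler_wpM2l ?expR_ge0// mulrC.
apply: (wquad_jensen (ell_log_concave0 d)).
by rewrite wquad_combo (Wmean k) le_eqVlt; apply/orP; left; apply/eqP; field.
Qed.

(** The extreme case is the one where all points are together inside or outside the set. Each child
    factor is a Bernoulli mean over having none or all of its points inside; exp(th s) is bounded by
    its chord [chi] on [0, m], and an affine function commutes with all these averages. *)
Lemma hoeffding_tree d k m x y : (k + d = K)%N ->
  tree mgf_leaf d m x y <= ell d m * (1 - W k x y + W k x y * expR (th * m%:R)).
Proof.
elim: d k m x y => [|d IH] k m x y kd.
  have -> : k = K by lia.
  rewrite ell0 /= mulrC ler_wpM2l ?invr_ge0// expRM_natr.
  set w := W K x y; set e := expR th.
  have /andP[w0 w1] : 0 <= w <= 1 by exact: W01.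
  have e0 : 0 <= e by exact: expR_ge0.
  rewrite /mgf_leaf -/w -/e; elim: m => [|m IHm]; first by rewrite !expr0; lra.
  have p0 : 0 <= 1 + (e - 1) * w by nra.
  rewrite exprS (le_trans (ler_wpM2l p0 IHm))// exprS.
  rewrite -subr_ge0.
  (* Both factors e - 1 and e^m - 1 have the sign of th. *)
  have -> : 1 - w + w * (e * e ^+ m) - (1 + (e - 1) * w) * (1 - w + w * e ^+ m) =
    w * (1 - w) * ((e - 1) * (e ^+ m - 1)) by ring.
  apply: mulr_ge0; first by rewrite mulr_ge0 ?subr_ge0.
  have [e1|e1] := leP 1 e.
    by apply: mulr_ge0; rewrite subr_ge0// exprn_ege1.
  by apply: mulr_le0; rewrite subr_le0 ?exprn_ile1// ltW.
have [->|m0] := posnP m.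
  by rewrite tree_m0 /ell tree_m0 mulr0 expR0; lra.
have mR : 0 < m%:R :> R by rewrite ltr0n.
set E := expR (th * m%:R).
pose chi (s : R) := 1 - s / m%:R + s / m%:R * E.
have chiP (s : nat) : (s <= m)%N -> expR (th * s%:R) <= chi s%:R.
  by move=> sm; apply: expR_le_chord => //; rewrite ler0n ler_nat.
pose b (w : R) (i : nat) := 1 - w + w * expR (th * i%:R).
rewrite /= ellS -mulrA ler_wpM2l ?expR_ge0//.
pose B i j k' l := b (W k.+1 x.*2 y.*2) i * b (W k.+1 x.*2 y.*2.+1) j *
  (b (W k.+1 x.*2.+1 y.*2) k' * b (W k.+1 x.*2.+1 y.*2.+1) l).
have b0 w i : 0 <= w <= 1 -> 0 <= b w i.
  by move=> /andP[w0 w1]; rewrite /b addr_ge0 ?subr_ge0// mulr_ge0 ?expR_ge0.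
apply: (@le_trans _ _ (wquad (ell d) m B)).
  apply: quad_le => i j k' l _; rewrite /B.
  rewrite [leRHS](_ : _ = (ell d i * b (W k.+1 x.*2 y.*2) i) * (ell d j * b (W k.+1 x.*2 y.*2.+1) j) *
    ((ell d k' * b (W k.+1 x.*2.+1 y.*2) k') * (ell d l * b (W k.+1 x.*2.+1 y.*2.+1) l))); last by ring.
  have g0 : forall a b, 0 <= mgf_leaf a b by move=> *; exact/ltW/mgf_leaf_gt0.
  have t0 n u v : 0 <= tree mgf_leaf d n u v by exact: tree_ge0.
  have tl n u v : tree mgf_leaf d n u v <= ell d n * b (W k.+1 u v) n.
    by apply: IH; lia.
  by apply: ler_pM; [exact: mulr_ge0|exact: mulr_ge0|exact: ler_pM|exact: ler_pM].
apply: (@le_trans _ _ (wquad (ell d) m (fun i j k' l =>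
  chi (W k.+1 x.*2 y.*2 * i%:R + W k.+1 x.*2 y.*2.+1 * j%:R +
    W k.+1 x.*2.+1 y.*2 * k'%:R + W k.+1 x.*2.+1 y.*2.+1 * l%:R)))).
  apply: (wquad_le (ell_log_concave0 d)) => i j k' l ijkl; rewrite /B.
  move: (W01 k.+1 x.*2 y.*2) (W01 k.+1 x.*2 y.*2.+1) (W01 k.+1 x.*2.+1 y.*2)
    (W01 k.+1 x.*2.+1 y.*2.+1).
  move: (W _ _ _) (W _ _ _) (W _ _ _) (W _ _ _) => w4 w3 w2 w1 h1 h2 h3 h4.
                                                                                    
  (* Treats one child: s points are already known to be inside, the factor [b w a] averages over
     adding 0 or a of them, and [chi] being affine takes the average into its argument. *)
  have one w a (X : R) (s : nat) v : 0 <= w <= 1 ->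
      (forall s' : nat, s' \in [:: s; (s + a)%N] -> expR (th * s'%:R) * X <= chi (s'%:R + v)) ->
      expR (th * s%:R) * (b w a * X) <= chi (s%:R + (w * a%:R + v)).
    move=> /andP[w0 w1'] H.
    have H1 := H s ltac:(by rewrite !inE eqxx).
    have H2 := H (s + a)%N ltac:(by rewrite !inE eqxx orbT).
    have -> : chi (s%:R + (w * a%:R + v)) =
       (1 - w) * chi (s%:R + v) + w * chi ((s + a)%:R + v).
      by rewrite /chi natrD; field; rewrite gt_eqF.
    have -> : expR (th * s%:R) * (b w a * X) =
       (1 - w) * (expR (th * s%:R) * X) + w * (expR (th * (s + a)%:R) * X).
      by rewrite /b natrD mulrDr expRD; ring.
    by apply: lerD; rewrite ler_wpM2l// subr_ge0.
  have := one w1 i (b w2 j * (b w3 k' * b w4 l)) 0%N (w2 * j%:R + (w3 * k'%:R + (w4 * l%:R + 0))) h1.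
  rewrite mulr0 expR0 mul1r add0r addr0 !addrA [_ * (b w2 j * _)]mulrA; apply => s1 hs1.
  rewrite -!addrA; have := one w2 j (b w3 k' * b w4 l) s1 (w3 * k'%:R + w4 * l%:R) h2.
  apply => s2 hs2.
  have := one w3 k' (b w4 l) s2 (w4 * l%:R) h3; apply => s3 hs3.
  have := one w4 l 1 s3 0 h4; rewrite mulr1 addr0; apply => s4 hs4.
  rewrite mulr1 addr0; apply: chiP.
  have le2 (a s s' : nat) : s' \in [:: s; (s + a)%N] -> (s' <= s + a)%N.
    by rewrite !inE => /orP[]/eqP ->; rewrite ?leq_addr.
  rewrite -ijkl (leq_trans (le2 _ _ _ hs4))// leq_add2r (leq_trans (le2 _ _ _ hs3))//.
  by rewrite leq_add2r (leq_trans (le2 _ _ _ hs2))// leq_add2r (le2 _ _ _ hs1).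
rewrite /chi.
have -> : wquad (ell d) m (fun i j k' l =>
  1 - (W k.+1 x.*2 y.*2 * i%:R + W k.+1 x.*2 y.*2.+1 * j%:R +
    W k.+1 x.*2.+1 y.*2 * k'%:R + W k.+1 x.*2.+1 y.*2.+1 * l%:R) / m%:R +
  (W k.+1 x.*2 y.*2 * i%:R + W k.+1 x.*2 y.*2.+1 * j%:R +
    W k.+1 x.*2.+1 y.*2 * k'%:R + W k.+1 x.*2.+1 y.*2.+1 * l%:R) / m%:R * E) =
  wquad (ell d) m (fun _ _ _ _ => 1) + (E - 1) / m%:R * wquad (ell d) m (fun i j k' l =>
   W k.+1 x.*2 y.*2 * i%:R + W k.+1 x.*2 y.*2.+1 * j%:R +
    W k.+1 x.*2.+1 y.*2 * k'%:R + W k.+1 x.*2.+1 y.*2.+1 * l%:R).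
  rewrite -wquadZ -wquadD; apply: eq_wquad => *.
  by field; rewrite gt_eqF.
rewrite wquad_combo -(Wmean k x y) le_eqVlt; apply/orP; left; apply/eqP.
by field; rewrite gt_eqF.
Qed.

End leaf_bounds.

(** * Sums over the descendants of a cell *)

Section descendants.
Implicit Types f : nat -> nat -> R.

Fixpoint desc (t : nat) f (x y : nat) : R :=
  if t is t'.+1 then desc t' f x.*2 y.*2 + desc t' f x.*2 y.*2.+1 +
    desc t' f x.*2.+1 y.*2 + desc t' f x.*2.+1 y.*2.+1
  else f x y.

Lemma big_double n (F : nat -> R) :
  \sum_(i < n.*2) F i = \sum_(i < n) (F i.*2 + F i.*2.+1).
Proof.
elim: n => [|n IH]; first by rewrite !big_ord0.
by rewrite doubleS !big_ord_recr /= IH addrA.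
Qed.

Lemma descSr t f x y : desc t.+1 f x y = desc t (fun a b =>
  f a.*2 b.*2 + f a.*2 b.*2.+1 + f a.*2.+1 b.*2 + f a.*2.+1 b.*2.+1) x y.
Proof. by elim: t x y => [//|t IH] x y; rewrite [in RHS]/= -!IH. Qed.

Lemma desc_root t f : desc t f 0 0 = \sum_(a < 2 ^ t) \sum_(b < 2 ^ t) f a b.
Proof.
elim: t f => [|t IH] f; first by rewrite !big_ord1.
rewrite descSr IH expnS mul2n.
rewrite (big_double _ (fun a => \sum_(b < (2 ^ t).*2) f a b)); apply: eq_bigr => a _.
rewrite (big_double _ (f a.*2)) (big_double _ (f a.*2.+1)) -big_split.
by apply: eq_bigr => b _ /=; rewrite !addrA.
Qed.

Lemma desc_ge0 t f x y : (forall a b, 0 <= f a b) -> 0 <= desc t f x y.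
Proof. by move=> f0; elim: t x y => [//|t IH] x y /=; rewrite !addr_ge0. Qed.

Lemma descD t f f' x y : desc t (fun a b => f a b + f' a b) x y = desc t f x y + desc t f' x y.
Proof. by elim: t x y => [//|t IH] x y /=; rewrite !IH; ring. Qed.

Lemma descZ t c f x y : desc t (fun a b => c * f a b) x y = c * desc t f x y.
Proof. by elim: t x y => [//|t IH] x y /=; rewrite !IH; ring. Qed.

Lemma desc_le t f f' x y : (forall a b, f a b <= f' a b) -> desc t f x y <= desc t f' x y.
Proof. by move=> ff; elim: t x y => [//|t IH] x y /=; rewrite !lerD. Qed.

Lemma desc_mean W k t x y : child_mean W ->
  desc t (W (k + t)%N) x y = 4 ^+ t * W k x y.
Proof.
move=> Wm; elim: t k x y => [|t IH] k x y; first by rewrite addn0 expr0 mul1r.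
by rewrite /= addnS -addSn !IH (Wm k) exprS; field.
Qed.

(** The error accumulated in [tree_upper]: every marked cell among the descendants, at levels k to k
    + t, is charged the cost of its level. *)
Fixpoint acc (c : nat -> R) (bd : nat -> nat -> nat -> bool) (t k x y : nat) : R :=
  c k * (bd k x y)%:R + (if t is t'.+1 then
    acc c bd t' k.+1 x.*2 y.*2 + acc c bd t' k.+1 x.*2 y.*2.+1 +
    acc c bd t' k.+1 x.*2.+1 y.*2 + acc c bd t' k.+1 x.*2.+1 y.*2.+1 else 0).

Lemma accE c bd t k x y : acc c bd t k x y =
  \sum_(s < t.+1) c (k + s)%N * desc s (fun a b => (bd (k + s)%N a b)%:R) x y.
Proof.
elim: t k x y => [|t IH] k x y; first by rewrite big_ord1 /= addr0 addn0.
rewrite [LHS]/= big_ord_recl /= !addn0; congr (_ + _).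
rewrite !IH -!big_split; apply: eq_bigr => s _ /=.
by rewrite /bump /= add1n addnS addSn; ring.
Qed.

Lemma acc_ge0 c bd t k x y : (forall k, 0 <= c k) -> 0 <= acc c bd t k x y.
Proof.
move=> c0; rewrite accE; apply: sumr_ge0 => s _.
by rewrite mulr_ge0// desc_ge0// => a b.
Qed.

End descendants.

(** * Upper recursion from the stopping level to the root *)

Section upper_recursion.
Variables (g : nat -> nat -> R) (M N : nat) (V : nat -> nat -> nat -> R).
Variables (bd : nat -> nat -> nat -> bool) (th : R) (mu w c b : nat -> R).
Hypothesis g0 : forall x y, 0 <= g x y.
Hypothesis Vmean : forall k x y, (k < M)%N -> V k x y =
  (V k.+1 x.*2 y.*2 + V k.+1 x.*2 y.*2.+1 + V k.+1 x.*2.+1 y.*2 +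
   V k.+1 x.*2.+1 y.*2.+1) / 4.
Hypothesis (Vw : forall k x y, (k < M)%N -> 0 <= V k.+1 x y <= w k).
Hypothesis (mu4 : forall k, mu k = 4 * mu k.+1).
Hypothesis (b4 : forall k, b k = b k.+1 / 4).
Hypothesis (b0 : forall k, 0 <= b k) (b1 : forall k, (k < M)%N -> b k.+1 <= beta / 16 / 3).
Hypothesis (c0 : forall k, 0 <= c k).
Hypothesis (cge : forall k, (k < M)%N ->
  quad_gauss_const beta * ((th * w k) ^+ 2 + b k.+1) <= c k).
Hypothesis leaf : forall m x y, bd M x y ->
  tree g N.+1 m x y <=
  ell N.+1 m * expR (th * (m%:R * V M x y) + c M + b M * (m%:R - mu M) ^+ 2).
Hypothesis inner : forall t k m x y, (k + t = M)%N -> ~~ bd k x y ->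
  tree g (N.+1 + t) m x y <= ell (N.+1 + t) m * expR (th * (m%:R * V k x y)).

(** A cell off the boundary is settled at once by [inner]. At a boundary cell the four child
    exponents are combined by [wquad_gauss], whose cost c k pays. The quadratic coefficient is
    divided by 4 at each level since the four (i - nu)^2 sum to the four (i - m/4)^2 plus (m - 4
    nu)^2 / 4. *)
Lemma tree_upper t k m x y : (k + t = M)%N ->
  tree g (N.+1 + t) m x y <= ell (N.+1 + t) m *
    expR (th * (m%:R * V k x y) + acc c bd t k x y + b k * (m%:R - mu k) ^+ 2).
Proof.
elim: t k m x y => [|t IH] k m x y kt.
  have kM : k = M by lia.
  rewrite addn0; case: (boolP (bd k x y)) => kxy.
    by rewrite /= kxy addr0 mulr1 kM; apply: leaf; rewrite -kM.
  have := @inner 0 k m x y kt kxy; rewrite addn0 => /le_trans; apply.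
  rewrite ler_pM2l ?ell_gt0// ler_expR -addrA lerDl.
  by rewrite addr_ge0// ?acc_ge0// mulr_ge0// sqr_ge0.
case: (boolP (bd k x y)) => kxy; last first.
  apply: (le_trans (@inner _ _ _ _ _ kt kxy)).
  rewrite ler_pM2l ?ell_gt0// ler_expR -addrA lerDl.
  by rewrite addr_ge0// ?acc_ge0// mulr_ge0// sqr_ge0.
have kM : (k < M)%N by lia.
have {}IH i u v := IH k.+1 i u v ltac:(lia).
have lc := ell_log_concave (N + t).
rewrite addnS.
apply: (le_trans (tree_step_le m g0 (fun i => IH i _ _) (fun i => IH i _ _)
  (fun i => IH i _ _) (fun i => IH i _ _))).
rewrite ellS -mulrA ler_wpM2l ?expR_ge0// [leRHS]mulrC.
rewrite /= kxy mulr1 (mu4 k).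
set A1 := acc _ _ _ _ x.*2 y.*2; set A2 := acc _ _ _ _ _ y.*2.+1.
set A3 := acc _ _ _ _ x.*2.+1 y.*2; set A4 := acc _ _ _ _ x.*2.+1 y.*2.+1.
move: (Vmean x y kM) (Vw x.*2 y.*2 kM) (Vw x.*2 y.*2.+1 kM)
  (Vw x.*2.+1 y.*2 kM) (Vw x.*2.+1 y.*2.+1 kM).
move: (V k x y) (V k.+1 _ _) (V k.+1 _ _) (V k.+1 _ _) (V k.+1 _ _).
move=> v v4 v3 v2 v1 vE h1 h2 h3 h4.
set nu := mu k.+1; set bb := b k.+1.
(* The part of the exponent that depends on m alone; what remains is centred at m/4. *)
pose D := th * (m%:R * v) + (A1 + A2 + A3 + A4) + b k * (m%:R - 4 * nu) ^+ 2.
have sq (r s : R) : 0 <= r <= w k -> 0 <= s <= w k -> (th * r - th * s) ^+ 2 <= (th * w k) ^+ 2.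
  move=> /andP[r0 rw] /andP[s0 sw]; rewrite -mulrBr !exprMn ler_wpM2l ?sqr_ge0//.
  by rewrite -[leLHS]real_normK ?num_real// lerXn2r ?nnegrE// ?(le_trans r0 rw)// ler_norml; lra.
have H := @wquad_gauss R beta (ell (N + t).+1) beta_gt0 lc m (th * v1) (th * v2) (th * v3) (th * v4)
  bb ((th * w k) ^+ 2) (b0 _) (b1 kM).
have {}H := H (sq _ _ h1 h2) (sq _ _ h1 h3) (sq _ _ h1 h4) (sq _ _ h2 h3)
  (sq _ _ h2 h4) (sq _ _ h3 h4).
apply: (@le_trans _ _ (expR D * (expR (c k) * wquad (ell (N.+1 + t)) m (fun _ _ _ _ => 1)))).
  rewrite [in leRHS]addSn; apply: le_trans (ler_wpM2l (expR_ge0 D) (le_trans H _)); last first.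
    rewrite ler_wpM2r ?ler_expR ?cge//.
    exact/ltW/(wquad1_gt0 lc).
  rewrite -wquadZ addSn le_eqVlt; apply/orP; left; apply/eqP.
  apply: eq_wquad => i j k' l ijkl; rewrite -expRD; congr expR.
  by rewrite /D (b4 k) -/bb vE -ijkl !natrD; field.
rewrite mulrA -expRD ler_wpM2r//; last by rewrite ler_expR /D; lra.
exact/ltW/(wquad1_gt0 lc).
Qed.

End upper_recursion.

(** * Lower recursion from the stopping level to the root *)

Section lower_recursion.
Variables (g : nat -> nat -> R) (M N : nat) (W : nat -> nat -> nat -> R).
Variables (ind : nat -> nat -> R) (th g0 g1 g2 : R) (mu : nat -> R).
Hypotheses (Wmean : child_mean W) (ind0 : forall x y, 0 <= ind x y).
Hypothesis (mu4 : forall k, mu k = 4 * mu k.+1).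
Hypothesis (g2ge0 : 0 <= g2).
Hypothesis leaf : forall m x y,
  ell N.+1 m * expR (th * (m%:R * W M x y) +
    ind x y * (g0 + g1 * (m%:R - mu M) - g2 * (m%:R - mu M) ^+ 2)) <=
  tree g N.+1 m x y.

Let var := quad_var_const beta.
Let q16 : R := 16^-1.

Lemma wquad_concave d m (al ka nu : R) (h : nat -> R) : 0 <= nu ->
  (forall i, h i = al + ka * (i%:R - m%:R / 4) - nu * (i%:R - m%:R / 4) ^+ 2) ->
  let q1 := wquad (ell d.+1) m (fun _ _ _ _ => 1) in
  [/\ (al - nu * var) * q1 <= wquad (ell d.+1) m (fun i _ _ _ => h i),
      (al - nu * var) * q1 <= wquad (ell d.+1) m (fun _ i _ _ => h i),
      (al - nu * var) * q1 <= wquad (ell d.+1) m (fun _ _ i _ => h i) &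
      (al - nu * var) * q1 <= wquad (ell d.+1) m (fun _ _ _ i => h i)].
Proof.
move=> nu0 hE q1; have lc := ell_log_concave d.
have [e1 e2 e3 e4] := wquad_mean (ell d.+1) m.
have [v1 v2 v3 v4] := wquad_var beta_gt0 lc m.
rewrite -/q1 -/var in e1 e2 e3 e4 v1 v2 v3 v4.
have lin (f : nat -> nat -> nat -> nat -> nat) :
    wquad (ell d.+1) m (fun i j k l => h (f i j k l)) =
    (al - ka * (m%:R / 4)) * q1 + ka * wquad (ell d.+1) m (fun i j k l => (f i j k l)%:R)
    + (- nu) * wquad (ell d.+1) m (fun i j k l => ((f i j k l)%:R - m%:R / 4) ^+ 2).
  rewrite -wquad_cst -!wquadZ -!wquadD; apply: eq_wquad => *.
  by rewrite hE; ring.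
by split; rewrite lin ?e1 ?e2 ?e3 ?e4; [move: v1|move: v2|move: v3|move: v4];
  move=> /(ler_wpM2l nu0); lra.
Qed.

(** Gains at the level M that are concave quadratics of the count are averaged upwards by Jensen.
    Averaging around m/4 divides the linear coefficient by 4 and the quadratic one by 16, and loses
    g2 16^(-t) [var]; the geometric series of losses stays below 2 g2 [var]. *)
Lemma tree_lower t k m x y : (k + t = M)%N ->
  ell (N.+1 + t) m * expR (th * (m%:R * W k x y) + desc t ind x y *
    (g0 - 2 * g2 * var * (1 - q16 ^+ t) + g1 * 4^-1 ^+ t * (m%:R - mu k)
     - g2 * q16 ^+ t * (m%:R - mu k) ^+ 2)) <= tree g (N.+1 + t) m x y.
Proof.
elim: t k m x y => [|t IH] k m x y kt.
  have kM : k = M by lia.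
  rewrite addn0 kM !expr0 subrr mulr0 subr0 !mulr1; exact: leaf.
have {}IH i u v := IH k.+1 i u v ltac:(lia).
rewrite [(_ + t.+1)%N]addnS.
apply: le_trans (tree_step_ge m (fun i => IH i _ _) (fun i => IH i _ _)
  (fun i => IH i _ _) (fun i => IH i _ _)).
rewrite ellS -mulrA ler_wpM2l ?expR_ge0// [leLHS]mulrC.
apply: (wquad_jensen (ell_log_concave0 _)).
rewrite /= (mu4 k) (Wmean k).
set d1 := desc _ _ x.*2 y.*2; set d2 := desc _ _ _ y.*2.+1.
set d3 := desc _ _ x.*2.+1 y.*2; set d4 := desc _ _ x.*2.+1 y.*2.+1.
have d10 : 0 <= d1 by exact: desc_ge0.
have d20 : 0 <= d2 by exact: desc_ge0.
have d30 : 0 <= d3 by exact: desc_ge0.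
have d40 : 0 <= d4 by exact: desc_ge0.
move: (W k.+1 _ _) (W k.+1 _ _) (W k.+1 _ _) (W k.+1 _ _) => w4 w3 w2 w1.
move: d1 d2 d3 d4 d10 d20 d30 d40 => d1 d2 d3 d4 d10 d20 d30 d40.
have q0 : 0 <= q16 ^+ t by rewrite exprn_ge0// /q16 invr_ge0.
set Q := q16 ^+ t in q0 *; set G := 4^-1 ^+ t; set nu := mu k.+1.
rewrite !(exprS q16) (exprS 4^-1) -/Q -/G.
pose A := g0 - 2 * g2 * var * (1 - Q).
pose h (w d : R) (i : nat) := th * (i%:R * w) + d * (A + g1 * G * (i%:R - nu) - g2 * Q * (i%:R - nu) ^+ 2).
pose s := m%:R / 4 - nu.
have key w d : 0 <= d -> forall i, h w d i =
   (th * (m%:R / 4 * w) + d * (A + g1 * G * s - g2 * Q * s ^+ 2)) +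
   (th * w + d * (g1 * G - 2 * g2 * Q * s)) * (i%:R - m%:R / 4) -
   d * g2 * Q * (i%:R - m%:R / 4) ^+ 2.
  by move=> _ i; rewrite /h /s; ring.
have nn d : 0 <= d -> 0 <= d * g2 * Q by move=> ?; rewrite !mulr_ge0.
rewrite addSn.
have [H1 _ _ _] := wquad_concave (N + t) (nn _ d10) (key w1 d1 d10).
have [_ H2 _ _] := wquad_concave (N + t) (nn _ d20) (key w2 d2 d20).
have [_ _ H3 _] := wquad_concave (N + t) (nn _ d30) (key w3 d3 d30).
have [_ _ _ H4] := wquad_concave (N + t) (nn _ d40) (key w4 d4 d40).
have -> : wquad (ell (N + t).+1) m (fun i j k' l => h w1 d1 i + h w2 d2 j + h w3 d3 k' + h w4 d4 l) =
   wquad (ell (N + t).+1) m (fun i _ _ _ => h w1 d1 i) +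
   wquad (ell (N + t).+1) m (fun _ i _ _ => h w2 d2 i) +
   wquad (ell (N + t).+1) m (fun _ _ i _ => h w3 d3 i) +
   wquad (ell (N + t).+1) m (fun _ _ _ i => h w4 d4 i) by rewrite -!wquadD.
apply: le_trans (lerD (lerD (lerD H1 H2) H3) H4).
rewrite -!mulrDl ler_wpM2r ?(ltW (wquad1_gt0 (ell_log_concave _) _))//.
have dg : 0 <= (d1 + d2 + d3 + d4) * (g2 * var * Q).
  have v0 : 0 <= var by exact/ltW/quad_var_const_gt0.
  apply: mulr_ge0; first by rewrite !addr_ge0.
  by apply: mulr_ge0 => //; exact: mulr_ge0.
(* The statement budgets 15/8 of the variance term for this level, and one such term is spent. *)
rewrite -subr_ge0 (_ : _ - _ = 7 / 8 * ((d1 + d2 + d3 + d4) * (g2 * var * Q))).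
  by rewrite mulr_ge0.
by rewrite /A /s /q16; field.
Qed.

End lower_recursion.

(** * Gains from crowding all points into one child *)

Section gain.
Variables (K : nat) (W : nat -> nat -> nat -> R) (th : R).
Hypotheses (Wmean : child_mean W) (W01 : forall k x y, 0 <= W k x y <= 1).
Hypothesis th0 : 0 <= th.

Lemma mem_child (x x' : nat) : (x' \in [:: x.*2; x.*2.+1]) = (x'./2 == x).
Proof. by rewrite !inE -{1 2}(odd_double_half x'); case: (odd x') => /=; lia. Qed.

Lemma ell_m0 d : ell d 0 = 1. Proof. by rewrite /ell tree_m0. Qed.

                                                                     
                                                      
(** A second-order improvement of Jensen: with probability at least [allin m] all points go to the
    richer child, where the exponent exceeds its mean by some u >= th m / 16, and e^u >= 1 + u +
    u^2/4. *)
Lemma tree_gain d k m x y x' y' : (k + d.+1 = K)%N ->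
  x' \in [:: x.*2; x.*2.+1] -> y' \in [:: y.*2; y.*2.+1] ->
  W k x y + 16^-1 <= W k.+1 x' y' ->
  ell d.+1 m * (expR (th * (m%:R * W k x y)) *
    (1 + allin m * ((th * m%:R / 16) ^+ 2 / 4))) <= tree (mgf_leaf K W th) d.+1 m x y.
Proof.
move=> kd xx yy gain.
have step i a b : ell d i * expR (th * W k.+1 a b * i%:R) <= tree (mgf_leaf K W th) d i a b.
  by rewrite -mulrA [W _ _ _ * _]mulrC; apply: (jensen_tree _ Wmean W01); lia.
apply: le_trans (tree_step_ge m (fun i => step i _ _) (fun i => step i _ _)
  (fun i => step i _ _) (fun i => step i _ _)).
rewrite ellS -mulrA ler_wpM2l ?expR_ge0//.
set q1 := wquad _ _ _.
have lc := ell_log_concave0 d.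
set F := fun i j k' l : nat => th * W k.+1 x.*2 y.*2 * i%:R + th * W k.+1 x.*2 y.*2.+1 * j%:R +
  th * W k.+1 x.*2.+1 y.*2 * k'%:R + th * W k.+1 x.*2.+1 y.*2.+1 * l%:R.
have FE : wquad (ell d) m F = th * (m%:R * W k x y) * q1.
  by rewrite wquad_combo (Wmean k x y) -/q1; field.
set a := th * (m%:R * W k x y) in FE *; set G := (th * m%:R / 16) ^+ 2 / 4.
have G0 : 0 <= G by rewrite divr_ge0 ?sqr_ge0.
(* I will be the event that all m points go to the child (x', y'); the argument is the same for the
   four positions of that child. *)
have key (I : nat -> nat -> nat -> nat -> bool) :
    ell d m <= wquad (ell d) m (fun i j k l => (I i j k l)%:R) ->
    (forall i j k' l, (i + j + k' + l = m)%N -> I i j k' l ->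
       F i j k' l = th * W k.+1 x' y' * m%:R) ->
    q1 * (expR a * (1 + allin m * G)) <= wquad (ell d) m (fun i j k l => expR (F i j k l)).
  move=> Iell FI.
  apply: (@le_trans _ _ (wquad (ell d) m (fun i j k l =>
    expR a * (1 + (F i j k l - a) + G * (I i j k l)%:R)))).
    rewrite wquadZ mulrCA ler_wpM2l ?expR_ge0// wquadD wquadZ.
    have -> : wquad (ell d) m (fun i j k l => 1 + (F i j k l - a)) = q1.
      by rewrite wquadD (wquadD _ _ F) FE (wquad_cst _ _ (- a)) -/q1; ring.
    rewrite mulrDr mulr1 lerD2l mulrA [_ * G]mulrC ler_wpM2l//.
    by rewrite [q1 * _]mulrC (le_trans _ Iell)// allin_wquad.
  apply: (wquad_le lc) => i j k' l ijkl.
  have -> : expR (F i j k' l) = expR a * expR (F i j k' l - a).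
    by rewrite -expRD; congr expR; ring.
  rewrite ler_wpM2l ?expR_ge0//.
  case: (boolP (I i j k' l)) => [Ii|_]; last by rewrite mulr0 addr0 expR_ge1Dx.
  rewrite mulr1 (FI _ _ _ _ ijkl Ii); set u := _ - a.
  have um : th * m%:R / 16 <= u.
    have : 0 <= th * m%:R by rewrite mulr_ge0.
    move=> tm0; have := ler_wpM2l tm0 gain; rewrite /u /a; lra.
  have t0 : 0 <= th * m%:R / 16 by rewrite divr_ge0// mulr_ge0.
  apply: le_trans (expR_ge_quadratic (le_trans t0 um)).
  by rewrite lerD2l /G ler_pM2r// lerXn2r ?nnegrE// (le_trans t0).
have w0 i j k' l : 0 <= ell d i * ell d j * (ell d k' * ell d l).
  have e0 n : 0 <= ell d n by exact/ltW/ell_gt0.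
  by apply: mulr_ge0; exact: mulr_ge0.
have single (I : nat -> nat -> nat -> nat -> bool) :
    let q := wquad (ell d) m (fun i j k l => (I i j k l)%:R) in
    I m 0%N 0%N 0%N || I 0%N m 0%N 0%N || I 0%N 0%N m 0%N || I 0%N 0%N 0%N m -> ell d m <= q.
  move=> q; have := @quad_single (fun i j k l =>
    ell d i * ell d j * (ell d k * ell d l) * (I i j k l)%:R) m.
  case=> [i j k' l _|]; first by rewrite mulr_ge0.
  rewrite !ell_m0 !mulr1 !mul1r -/(wquad _ _ _) -/q => h1 h2 h3 h4.
  by move=> /orP[/orP[/orP[]|]|] I1; [move: h1|move: h2|move: h3|move: h4];
    rewrite I1 ?mulr1.
move: xx yy; rewrite !inE => /orP[]/eqP xE /orP[]/eqP yE; rewrite xE yE in key gain *.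
- apply: (key (fun i _ _ _ => i == m)); first by apply: single; rewrite eqxx.
  move=> i j k' l e /eqP im; have [-> -> ->] : [/\ j = 0%N, k' = 0%N & l = 0%N] by split; lia.
  by rewrite im /F !mulr0 !addr0.
- apply: (key (fun _ i _ _ => i == m)); first by apply: single; rewrite eqxx orbT.
  move=> i j k' l e /eqP im; have [-> -> ->] : [/\ i = 0%N, k' = 0%N & l = 0%N] by split; lia.
  by rewrite im /F !mulr0 !addr0 add0r.
- apply: (key (fun _ _ i _ => i == m)); first by apply: single; rewrite eqxx orbT.
  move=> i j k' l e /eqP im; have [-> -> ->] : [/\ i = 0%N, j = 0%N & l = 0%N] by split; lia.
  by rewrite im /F !mulr0 !addr0 !add0r.
- apply: (key (fun _ _ _ i => i == m)); first by apply: single; rewrite eqxx orbT.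
  move=> i j k' l e /eqP im; have [-> -> ->] : [/\ i = 0%N, j = 0%N & k' = 0%N] by split; lia.
  by rewrite im /F !mulr0 !add0r.
Qed.

(** j forced descents, each paid by [allin m], lead from the ancestor to a cell contained in the set
    up to measure zero, where every point earns the full th. *)
Lemma tree_chain d k j m x y : (k + d = K)%N -> W k x y = 1 ->
  ell (j + d) m * (allin m ^+ j * expR (th * m%:R)) <=
  tree (mgf_leaf K W th) (j + d) m (x %/ 2 ^ j) (y %/ 2 ^ j).
Proof.
move=> kd W1; elim: j => [|j IH].
  rewrite expn0 !divn1 expr0 mul1r.
  by have := jensen_tree th Wmean W01 m x y kd; rewrite W1 mulr1.
have g0 a b : 0 <= mgf_leaf K W th a b by exact/ltW/(mgf_leaf_gt0 _ _ W01).
have half (z : nat) : (z %/ 2 ^ j)%N \in [:: (z %/ 2 ^ j.+1)%N.*2; (z %/ 2 ^ j.+1)%N.*2.+1].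
  by rewrite mem_child expnSr divnMA divn2.
have h := tree_child_ge (j + d) m g0 (half x) (half y).
rewrite addSn -(ler_pM2l (ell_gt0 (j + d) m)) (le_trans _ h)// exprS.
have -> : ell (j + d) m * (ell (j + d).+1 m * (allin m * allin m ^+ j * expR (th * m%:R))) =
  allin m * ell (j + d).+1 m * (ell (j + d) m * (allin m ^+ j * expR (th * m%:R))) by ring.
by apply: ler_wpM2l IH; rewrite mulr_ge0// ltW ?allin_gt0 ?ell_gt0.
Qed.

End gain.

End tree.

                                                  

(** * From labelled points to occupation numbers *)

Section occupation.
Context {R : realType} (beta : R) (G : nat -> nat -> R).
Implicit Types (F : (nat -> nat -> nat) -> R) (nu : nat -> nat -> nat).

Definition unit_occ (a b : nat) : nat -> nat -> nat :=
  fun u v => ((u == a) && (v == b))%N.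
Definition add_occ nu nu' : nat -> nat -> nat := fun u v => (nu u v + nu' u v)%N.
Definition zero_occ : nat -> nat -> nat := fun _ _ => 0%N.

Lemma add_occAC : right_commutative add_occ.
Proof. by move=> f g h; apply/funext => u; apply/funext => v; rewrite /add_occ addnAC. Qed.

Lemma add_occA : associative add_occ.
Proof. by move=> f g h; apply/funext => u; apply/funext => v; rewrite /add_occ addnA. Qed.

                                                                              
                                                               
(** Sum of F over the occupation functions nu with n points below (x, y), weighted by the product of
    G^nu / nu!. It follows the recursion of [tree], with the occupation function built up and handed
    to F in continuation style. *)
Fixpoint occ_sum (d n x y : nat) F : R :=
  if d is d'.+1 then quad n (fun i j k l =>
    occ_sum d' i x.*2 y.*2 (fun nu1 =>
    occ_sum d' j x.*2 y.*2.+1 (fun nu2 =>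
    occ_sum d' k x.*2.+1 y.*2 (fun nu3 =>
    occ_sum d' l x.*2.+1 y.*2.+1 (fun nu4 =>
      F (add_occ (add_occ (add_occ nu1 nu2) nu3) nu4))))))
  else G x y ^+ n / n`!%:R * F (fun u v => n * unit_occ x y u v)%N.

Lemma occ_sumD d n x y F F' :
  occ_sum d n x y (fun nu => F nu + F' nu) = occ_sum d n x y F + occ_sum d n x y F'.
Proof.
elim: d n x y F F' => [|d IH] n x y F F' /=; first by rewrite mulrDr.
rewrite -quadD; apply: eq_quad => i j k l _; rewrite -IH; congr occ_sum.
apply/funext => nu1; rewrite -IH; congr occ_sum.
apply/funext => nu2; rewrite -IH; congr occ_sum.
by apply/funext => nu3; rewrite -IH.
Qed.

Lemma occ_sumZ d n x y c F :
  occ_sum d n x y (fun nu => c * F nu) = c * occ_sum d n x y F.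
Proof.
elim: d n x y F => [|d IH] n x y F /=; first by rewrite mulrCA.
rewrite -quadZ; apply: eq_quad => i j k l _; rewrite -IH; congr occ_sum.
apply/funext => nu1; rewrite -IH; congr occ_sum.
apply/funext => nu2; rewrite -IH; congr occ_sum.
by apply/funext => nu3; rewrite -IH.
Qed.

Lemma occ_sum_desc d n x y t (c : nat -> nat -> R) (H : nat -> nat -> _ -> R) u v :
  occ_sum d n x y (fun nu => desc t (fun a b => c a b * H a b nu) u v) =
  desc t (fun a b => c a b * occ_sum d n x y (H a b)) u v.
Proof.
elim: t u v => [|t IH] u v /=; first by rewrite occ_sumZ.
by rewrite !occ_sumD !IH.
Qed.

Lemma quad_desc n t (c : nat -> nat -> R) (H : nat -> nat -> nat -> nat -> nat -> nat -> R) u v :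
  quad n (fun i j k l => desc t (fun a b => c a b * H a b i j k l) u v) =
  desc t (fun a b => c a b * quad n (H a b)) u v.
Proof.
elim: t u v => [|t IH] u v /=; first by rewrite quadZ.
by rewrite !quadD !IH.
Qed.

Lemma quad_shift n (P : nat -> nat -> nat -> nat -> R) :
  quad n.+1 (fun i j k l => i%:R * P i j k l) =
  quad n (fun i j k l => i.+1%:R * P i.+1 j k l).
Proof.
rewrite /quad big_ord_recl /= big1 ?add0r; last first.
  by move=> j _; rewrite big1// => k _; rewrite big1// => l _; rewrite mul0r mul0rn.
apply: eq_bigr => i _; rewrite [LHS]big_ord_recr /= [X in _ + X]big1 ?addr0; last first.
  move=> k _; rewrite big1// => l _; rewrite /bump /=.
  by have -> : (1 + i + n.+1 + k + l == n.+1)%N = false by lia.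
apply: eq_bigr => j _; rewrite [LHS]big_ord_recr /= [X in _ + X]big1 ?addr0; last first.
  move=> l _; rewrite /bump /=.
  by have -> : (1 + i + j + n.+1 + l == n.+1)%N = false by lia.
apply: eq_bigr => k _; rewrite [LHS]big_ord_recr /= /bump /=.
have -> : (1 + i + j + k + n.+1 == n.+1)%N = false by lia.
rewrite addr0; apply: eq_bigr => l _; rewrite add1n.
by congr (_ *+ nat_of_bool _); lia.
Qed.

(** Removal of one point: the Leibniz rule for exponential generating functions. At a split, n+1 = i
    + j + k + l is distributed over the children and the induction hypothesis used in each.
    Iterating it yields the n! labellings of [label_sumE]. *)
Lemma occ_sum_deriv d n x y F :
  n.+1%:R * occ_sum d n.+1 x y F =
  desc d (fun a b => G a b * occ_sum d n x y (fun nu => F (add_occ nu (unit_occ a b)))) x y.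
Proof.
elim: d n x y F => [|d IH] n x y F /=.
  have -> : (fun u v => n.+1 * unit_occ x y u v)%N =
      add_occ (fun u v => n * unit_occ x y u v)%N (unit_occ x y).
    by apply/funext => u; apply/funext => v; rewrite /add_occ mulSn addnC.
  rewrite exprS factS natrM; have f0 : n`!%:R != 0 :> R by rewrite pnatr_eq0 -lt0n fact_gt0.
  have n0 : n.+1%:R != 0 :> R by rewrite pnatr_eq0.
  by field; rewrite f0 addrC natr1 n0.
set P := fun i j k l : nat => _.
have -> : n.+1%:R * quad n.+1 P =
    quad n.+1 (fun i j k l => i%:R * P i j k l) +
    quad n.+1 (fun j i k l => i%:R * P j i k l) +
    quad n.+1 (fun j k i l => i%:R * P j k i l) +
    quad n.+1 (fun j k l i => i%:R * P j k l i).
  rewrite -quadZ -!quadD; apply: eq_quad => i j k l <-.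
  by rewrite !natrD; ring.
do !congr (_ + _).
- rewrite quad_shift -quad_desc; apply: eq_quad => i j k l _.
  rewrite /P IH; congr desc; apply/funext => a; apply/funext => b; congr (_ * _).
  congr occ_sum; apply/funext => nu1; congr occ_sum; apply/funext => nu2.
  congr occ_sum; apply/funext => nu3; congr occ_sum; apply/funext => nu4.
  by congr F; rewrite 3!(add_occAC _ (unit_occ a b)).
- rewrite quad_swap12 quad_shift [in LHS]quad_swap12 -quad_desc; apply: eq_quad => i j k l _.
  rewrite /P -occ_sumZ; under eq_fun do rewrite IH.
  rewrite occ_sum_desc; congr desc; apply/funext => a; apply/funext => b; congr (_ * _).
  congr occ_sum; apply/funext => nu1; congr occ_sum; apply/funext => nu2.
  congr occ_sum; apply/funext => nu3; congr occ_sum; apply/funext => nu4.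
  by congr F; rewrite add_occA 2!(add_occAC _ (unit_occ a b)).
- rewrite quad_swap23 quad_swap12 quad_shift [in LHS]quad_swap12 [in LHS]quad_swap23 -quad_desc.
  apply: eq_quad => i j k l _.
  rewrite /P -occ_sumZ; under eq_fun do rewrite -occ_sumZ.
  under eq_fun do under eq_fun do rewrite IH.
  under eq_fun do rewrite occ_sum_desc.
  rewrite occ_sum_desc; congr desc; apply/funext => a; apply/funext => b; congr (_ * _).
  congr occ_sum; apply/funext => nu1; congr occ_sum; apply/funext => nu2.
  congr occ_sum; apply/funext => nu3; congr occ_sum; apply/funext => nu4.
  by congr F; rewrite add_occA (add_occAC _ (unit_occ a b)).
- rewrite quad_swap34 quad_swap23 quad_swap12 quad_shift [in LHS]quad_swap12 [in LHS]quad_swap23.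
  rewrite [in LHS]quad_swap34 -quad_desc.
  apply: eq_quad => i j k l _.
  rewrite /P -occ_sumZ; under eq_fun do rewrite -occ_sumZ.
  under eq_fun do under eq_fun do rewrite -occ_sumZ.
  under eq_fun do under eq_fun do under eq_fun do rewrite IH.
  under eq_fun do under eq_fun do rewrite occ_sum_desc.
  under eq_fun do rewrite occ_sum_desc.
  rewrite occ_sum_desc; congr desc; apply/funext => a; apply/funext => b; congr (_ * _).
  congr occ_sum; apply/funext => nu1; congr occ_sum; apply/funext => nu2.
  congr occ_sum; apply/funext => nu3; congr occ_sum; apply/funext => nu4.
  by congr F; rewrite add_occA.
Qed.

Lemma occ_sum0 d x y F : occ_sum d 0 x y F = F zero_occ.
Proof.
elim: d x y F => [|d IH] x y F /=.
  by rewrite expr0 fact0 divr1 mul1r; congr F.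
by rewrite quad0 !IH; congr F.
Qed.

Fixpoint label_sum (K n : nat) F : R :=
  if n is n'.+1 then \sum_(a < 2 ^ K) \sum_(b < 2 ^ K)
    G a b * label_sum K n' (fun nu => F (add_occ nu (unit_occ a b)))
  else F zero_occ.

Lemma label_sumE K n F : label_sum K n F = n`!%:R * occ_sum K n 0 0 F.
Proof.
elim: n F => [|n IH] F; first by rewrite occ_sum0 fact0 mul1r.
rewrite factS natrM mulrAC occ_sum_deriv mulrC -descZ desc_root /=.
apply: eq_bigr => a _; apply: eq_bigr => b _.
by rewrite IH mulrCA.
Qed.

Fixpoint cell_count (d : nat) nu (x y : nat) : nat :=
  if d is d'.+1 then
    (cell_count d' nu x.*2 y.*2 + cell_count d' nu x.*2 y.*2.+1 +
     cell_count d' nu x.*2.+1 y.*2 + cell_count d' nu x.*2.+1 y.*2.+1)%N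
  else nu x y.

Fixpoint cell_energy (d : nat) nu (x y : nat) : R :=
  if d is d'.+1 then beta * 'C(cell_count d nu x y, 2)%:R +
    (cell_energy d' nu x.*2 y.*2 + cell_energy d' nu x.*2 y.*2.+1 +
     cell_energy d' nu x.*2.+1 y.*2 + cell_energy d' nu x.*2.+1 y.*2.+1)
  else 0.

Definition below d (x y a b : nat) := (a %/ 2 ^ d == x)%N && (b %/ 2 ^ d == y)%N.

Lemma below_child d x y x' y' a b : x'./2 = x -> y'./2 = y ->
  below d x' y' a b -> below d.+1 x y a b.
Proof.
by move=> <- <- /andP[/eqP <- /eqP <-]; rewrite /below expnSr !divnMA !divn2 !eqxx.
Qed.

Lemma eq_cell_count d nu nu' x y :
  (forall a b, below d x y a b -> nu a b = nu' a b) ->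
  cell_count d nu x y = cell_count d nu' x y.
Proof.
elim: d x y => [|d IH] x y h /=.
  by apply: h; rewrite /below expn0 !divn1 !eqxx.
by do !congr addn; apply: IH => a b ab; apply: h; apply: below_child ab;
  rewrite ?doubleK// -[_.*2.+1]/(true + _.*2)%N half_bit_double.
Qed.

Lemma eq_cell_energy d nu nu' x y :
  (forall a b, below d x y a b -> nu a b = nu' a b) ->
  cell_energy d nu x y = cell_energy d nu' x y.
Proof.
elim: d x y => [//|d IH] x y h.
rewrite /= -/(cell_count d.+1 nu x y) -/(cell_count d.+1 nu' x y) (eq_cell_count h).
by do !congr (_ + _); apply: IH => a b ab; apply: h; apply: below_child ab;
  rewrite ?doubleK// -[_.*2.+1]/(true + _.*2)%N half_bit_double.
Qed.

(** The confinement needed in [occ_sum_energy]: occupation functions of the four children have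
    disjoint supports, so counts and energies add and the Boltzmann factor can be peeled off child
    by child. *)
Definition supp_below d x y nu := forall a b, ~~ below d x y a b -> nu a b = 0%N.

Lemma occ_sum_energy d n x y c F :
  (forall nu, supp_below d x y nu -> cell_count d nu x y = n ->
     F nu = c * expR (- cell_energy d nu x y)) ->
  occ_sum d n x y F = c * tree beta G d n x y.
Proof.
elim: d n x y c F => [|d IH] n x y c F h /=.
  rewrite h ?oppr0 ?expR0 ?mulr1 1?mulrC//.
    by move=> a b; rewrite /below expn0 !divn1 /unit_occ => /negbTE ->; rewrite muln0.
  by rewrite /= /unit_occ !eqxx muln1.
rewrite mulrA -quadZ; apply: eq_quad => i j k l ijkl.
transitivity (c * repulsion beta n * tree beta G d j x.*2 y.*2.+1 *
   tree beta G d k x.*2.+1 y.*2 * tree beta G d l x.*2.+1 y.*2.+1 *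
   tree beta G d i x.*2 y.*2); last by ring.
apply: (IH) => nu1 s1 n1.
transitivity (c * repulsion beta n * expR (- cell_energy d nu1 x.*2 y.*2) *
   tree beta G d k x.*2.+1 y.*2 * tree beta G d l x.*2.+1 y.*2.+1 *
   tree beta G d j x.*2 y.*2.+1); last by ring.
apply: (IH) => nu2 s2 n2.
transitivity (c * repulsion beta n * expR (- cell_energy d nu1 x.*2 y.*2) *
   expR (- cell_energy d nu2 x.*2 y.*2.+1) * tree beta G d l x.*2.+1 y.*2.+1 *
   tree beta G d k x.*2.+1 y.*2); last by ring.
apply: (IH) => nu3 s3 n3.
transitivity (c * repulsion beta n * expR (- cell_energy d nu1 x.*2 y.*2) *
   expR (- cell_energy d nu2 x.*2 y.*2.+1) * expR (- cell_energy d nu3 x.*2.+1 y.*2) *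
   tree beta G d l x.*2.+1 y.*2.+1); last by ring.
apply: (IH) => nu4 s4 n4.
set nu := add_occ _ nu4.
have dis x1 y1 x2 y2 a b : (x1 != x2) || (y1 != y2) -> below d x1 y1 a b -> below d x2 y2 a b = false.
  move=> ne /andP[/eqP xE /eqP yE]; apply/negbTE/negP => /andP[/eqP xE' /eqP yE'].
  by move: ne; rewrite -xE -yE -xE' -yE' !eqxx.
have ex (z z' : nat) : (z.*2 != z'.*2.+1) by lia.
have ex' (z z' : nat) : (z.*2.+1 != z'.*2) by lia.
have c1 a b : below d x.*2 y.*2 a b -> nu a b = nu1 a b.
  by move=> h1; rewrite /nu /add_occ s2 ?s3 ?s4 ?addn0// (dis _ _ _ _ _ _ _ h1)// ?ex ?ex' ?orbT.
have c2 a b : below d x.*2 y.*2.+1 a b -> nu a b = nu2 a b.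
  by move=> h1; rewrite /nu /add_occ s1 ?s3 ?s4 ?addn0// (dis _ _ _ _ _ _ _ h1)// ?ex ?ex' ?orbT.
have c3 a b : below d x.*2.+1 y.*2 a b -> nu a b = nu3 a b.
  by move=> h1; rewrite /nu /add_occ s1 ?s2 ?s4 ?addn0// (dis _ _ _ _ _ _ _ h1)// ?ex ?ex' ?orbT.
have c4 a b : below d x.*2.+1 y.*2.+1 a b -> nu a b = nu4 a b.
  by move=> h1; rewrite /nu /add_occ s1 ?s2 ?s3 ?addn0// (dis _ _ _ _ _ _ _ h1)// ?ex ?ex' ?orbT.
have cnt : cell_count d.+1 nu x y = n.
  by rewrite /= (eq_cell_count c1) (eq_cell_count c2) (eq_cell_count c3) (eq_cell_count c4)
    n1 n2 n3 n4.
rewrite h//; last first.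
  move=> a b ab; have nb x' y' : x'./2 = x -> y'./2 = y -> ~~ below d x' y' a b.
    by move=> hx hy; apply: contra ab; exact: below_child.
  have hd z : z.*2.+1./2 = z by rewrite -[_.*2.+1]/(true + _.*2)%N half_bit_double.
  by rewrite /nu /add_occ s1 ?s2 ?s3 ?s4 ?nb ?doubleK ?hd.
rewrite [cell_energy d.+1 _ _ _]/= -/(cell_count d.+1 nu x y) cnt.
rewrite (eq_cell_energy c1) (eq_cell_energy c2) (eq_cell_energy c3) (eq_cell_energy c4).
by rewrite /repulsion -!mulrA -!expRD; congr (_ * expR _); ring.
Qed.

Lemma label_sum_energy K n :
  label_sum K n (fun nu => expR (- cell_energy K nu 0 0)) = n`!%:R * tree beta G K n 0 0.
Proof.
rewrite label_sumE; congr (_ * _); rewrite -[RHS]mul1r; apply: occ_sum_energy => nu _ _.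
by rewrite mul1r.
Qed.

End occupation.

(** * Fubini over tuples of points *)

Section product_integral.
Context d1 d2 (T1 : measurableType d1) (T2 : measurableType d2) (R : realType).
Variables (mu : {sigma_finite_measure set T1 -> \bar R}).
Variables (nu : {sigma_finite_measure set T2 -> \bar R}).

Lemma integral_product_fun (f : T1 -> R) (g : T2 -> R) :
  measurable_fun setT f -> measurable_fun setT g ->
  (forall x, 0 <= f x) -> (forall y, 0 <= g y) ->
  (\int[product_measure mu nu]_z (f z.1 * g z.2)%:E =
   \int[mu]_x (f x)%:E * \int[nu]_y (g y)%:E)%E.
Proof.
move=> mf mg f0 g0.
pose fg (z : T1 * T2) : \bar R := (f z.1 * g z.2)%:E.
have mfg : measurable_fun setT fg.
  apply/measurable_EFinP/measurable_funM.
    exact: measurableT_comp.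
  exact: measurableT_comp.
rewrite /product_measure (fubini_tonelli1 _ mfg); last first.
  by move=> z; rewrite lee_fin mulr_ge0.
rewrite /fubini_F /=.
transitivity (\int[mu]_x ((f x)%:E * \int[nu]_y (g y)%:E))%E.
  apply: eq_integral => x _; rewrite -ge0_integralZl//.
  - exact/measurable_EFinP.
  - by move=> y _; rewrite lee_fin.
  - by rewrite lee_fin.
rewrite ge0_integralZr//.
- exact/measurable_EFinP.
- by move=> x _; rewrite lee_fin.
- by apply: integral_ge0 => y _; rewrite lee_fin.
Qed.

End product_integral.

Section tuple_integral.
Context d (T : measurableType d) (R : realType).
Variable mu : {sigma_finite_measure set T -> \bar R}.

Lemma integral_tuple0 (f : 0.-tuple T -> R) :
  measurable_fun setT f -> (forall p, 0 <= f p) ->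
  (\int[tuple_measure mu 0]_p (f p)%:E = (f [tuple])%:E)%E.
Proof.
move=> mf f0 /=; rewrite integral_dirac//.
  by rewrite diracT mul1e.
exact/measurable_EFinP.
Qed.

Lemma integral_tupleS n (f : n.+1.-tuple T -> R) :
  measurable_fun setT f -> (forall p, 0 <= f p) ->
  (\int[tuple_measure mu n.+1]_p (f p)%:E =
   \int[product_measure mu (tuple_measure mu n)]_z (f (tcons z))%:E)%E.
Proof.
move=> mf f0 /=; rewrite /product_tcons.
rewrite ge0_integral_pushforward//.
- exact: measurable_tcons.
- exact/measurable_EFinP.
- by move=> y _; rewrite lee_fin.
Qed.

End tuple_integral.

(** * Dyadic cells and truncated densities *)

Section cells.
Context {R : realType}.
Local Notation plane := (measurableTypeR R * measurableTypeR R)%type.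
Let leb2 : {sigma_finite_measure set plane -> \bar R} := @lebesgue2 R.

Definition cell (k a b : nat) : set plane :=
  `[a%:R / 2 ^+ k, a.+1%:R / 2 ^+ k[ `*` `[b%:R / 2 ^+ k, b.+1%:R / 2 ^+ k[.

Lemma measurable_cell k a b : measurable (cell k a b).
Proof. by apply: measurableX; exact: measurable_itv. Qed.

Lemma lebesgue2_cell k a b : leb2 (cell k a b) = (4^-1 ^+ k)%:E.
Proof.
transitivity ((@lebesgue_measure R \x @lebesgue_measure R)%E (cell k a b)); first by [].
rewrite /cell product_measure1E; [|exact: measurable_itv..].
have lt c : c%:R / 2 ^+ k < c.+1%:R / 2 ^+ k :> R.
  by rewrite ltr_pM2r ?invr_gt0 ?exprn_gt0// ltr_nat.
rewrite /= !lebesgue_measure_itv /= !lte_fin !lt -!EFinB -EFinM -!mulrBl.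
rewrite -!natrB// !subSnn !mul1r -!exprVn -exprMn; congr (_ ^+ _)%:E.
by field.
Qed.

Section gdens.
Variables (K : nat) (g : plane -> R).
Hypotheses (mg : measurable_fun setT g) (g0 : forall x, 0 <= g x).
Implicit Type F : (nat -> nat -> nat) -> R.

(** Product weight g times a function of the level-K occupation numbers, zero as soon as a point
    leaves the half-open square. Being a sum of indicators, it is measurable and integrates to
    [label_sum] term by term. *)
Fixpoint gdens (s : seq plane) F : R :=
  if s is x :: s' then \sum_(a < 2 ^ K) \sum_(b < 2 ^ K)
    \1_(cell K a b) x * g x * gdens s' (fun nu => F (add_occ nu (unit_occ a b)))
  else F zero_occ.

Definition cell_integral a b : R := fine (\int[leb2]_(x in cell K a b) (g x)%:E)%E.

Lemma gdens_ge0 s F : (forall nu, 0 <= F nu) -> 0 <= gdens s F.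
Proof.
elim: s F => [|x s IH] F F0 //=; apply: sumr_ge0 => a _; apply: sumr_ge0 => b _.
by apply: mulr_ge0; [rewrite mulr_ge0|exact: IH].
Qed.

Lemma measurable_gdens n F : measurable_fun setT (fun p : n.-tuple plane => gdens p F).
Proof.
elim: n F => [|n IH] F.
  rewrite (_ : (fun p => _) = cst (F zero_occ)); first exact: measurable_cst.
  by apply/funext => p; rewrite tuple0.
rewrite (_ : (fun p => _) = fun p : n.+1.-tuple plane => \sum_(a < 2 ^ K) \sum_(b < 2 ^ K)
    \1_(cell K a b) (tnth p ord0) * g (tnth p ord0) *
    gdens [tuple of behead p] (fun nu => F (add_occ nu (unit_occ a b)))); last first.
  by apply/funext => p; case/tupleP: p => x t; rewrite !tnth0.
apply: measurable_sum => a; apply: measurable_sum => b.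
have mt := @measurable_tnth _ plane n.+1 ord0.
apply: measurable_funM; first apply: measurable_funM.
- by apply: measurableT_comp mt; apply: measurable_indic; exact: measurable_cell.
- exact: measurableT_comp mt.
- by apply: (measurableT_comp (IH _)); exact: measurable_behead.
Qed.

Hypothesis (bg : exists M, forall x, g x <= M).

Lemma cell_integralE a b :
  ((cell_integral a b)%:E = \int[leb2]_x (\1_(cell K a b) x * g x)%:E)%E.
Proof.
have mc := measurable_cell K a b.
have E : (\int[leb2]_(x in cell K a b) (g x)%:E = \int[leb2]_x (\1_(cell K a b) x * g x)%:E)%E.
  rewrite integral_mkcond; apply: eq_integral => x _.
  by rewrite /patch indicE; case: ifPn; rewrite ?mul1r ?mul0r.
rewrite -E /cell_integral fineK// ge0_fin_numE; last first.
  by apply: integral_ge0 => x _; rewrite lee_fin.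
have [M hM] := bg.
apply: (@le_lt_trans _ _ (\int[leb2]_(x in cell K a b) M%:E)%E).
  apply: ge0_le_integral => //.
  - by move=> x _; rewrite lee_fin.
  - by apply/measurable_EFinP; exact: measurable_funTS.
  - by move=> x _; rewrite lee_fin.
by rewrite integral_cst// [X in (_ * X)%E](lebesgue2_cell K a b) -EFinM ltry.
Qed.

Lemma integral_gdens n F : (forall nu, 0 <= F nu) ->
  (\int[tuple_measure leb2 n]_p (gdens p F)%:E =
   (label_sum cell_integral K n F)%:E)%E.
Proof.
elim: n F => [|n IH] F F0.
  by rewrite (integral_tuple0 leb2 (@measurable_gdens 0 F))// => p; exact: gdens_ge0.
rewrite (integral_tupleS leb2 (@measurable_gdens n.+1 F)); last by move=> p; exact: gdens_ge0.
pose c a b (x : plane) := \1_(cell K a b) x * g x.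
have c0 a b x : 0 <= c a b x by rewrite /c mulr_ge0.
have mc a b : measurable_fun setT (c a b).
  by apply: measurable_funM => //; apply: measurable_indic; exact: measurable_cell.
pose h a b (t : n.-tuple plane) := gdens t (fun nu => F (add_occ nu (unit_occ a b))).
have h0 a b t : 0 <= h a b t by exact: gdens_ge0.
have mh a b : measurable_fun setT (h a b) by exact: measurable_gdens.
have mch a b : measurable_fun setT (fun z : plane * n.-tuple plane => c a b z.1 * h a b z.2).
  by apply: measurable_funM; exact: measurableT_comp.
transitivity (\sum_(a < 2 ^ K) \sum_(b < 2 ^ K)
   \int[product_measure leb2 (tuple_measure leb2 n)]_z (c a b z.1 * h a b z.2)%:E)%E.
  rewrite (eq_integral (fun z => \sum_(a < 2 ^ K) \sum_(b < 2 ^ K)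
     (c a b z.1 * h a b z.2)%:E)%E); last first.
    move=> z _ /=; rewrite -sumEFin; apply: eq_bigr => a _.
    by rewrite -sumEFin.
  rewrite ge0_integral_sum//.
  - apply: eq_bigr => a _; rewrite ge0_integral_sum//.
    + by move=> b; exact/measurable_EFinP.
    + by move=> b z _; rewrite lee_fin mulr_ge0.
  - by move=> a; apply: emeasurable_sum => b; exact/measurable_EFinP.
  - by move=> a z _; apply: sume_ge0 => b _; rewrite lee_fin mulr_ge0.
rewrite [label_sum _ _ _ _]/= -sumEFin; apply: eq_bigr => a _.
rewrite -sumEFin; apply: eq_bigr => b _.
rewrite integral_product_fun// EFinM cell_integralE; congr (_ * _)%E.
by rewrite IH.
Qed.

End gdens.
End cells.

(** * The hierarchical interaction through binary digits *)

Section digits.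
Context {R : realType}.
Local Notation plane := (measurableTypeR R * measurableTypeR R)%type.
Implicit Types (t : R) (x y : plane) (s : seq plane).

Definition digit (k : nat) t : nat := Num.truncn (t * 2 ^+ k).

Definition inside x : bool := (0 <= x.1 < 1) && (0 <= x.2 < 1).

Lemma digitP k t a : 0 <= t ->
  (a%:R / 2 ^+ k <= t < a.+1%:R / 2 ^+ k) = (digit k t == a).
Proof.
move=> t0; have p0 : 0 < 2 ^+ k :> R by rewrite exprn_gt0.
rewrite ler_pdivrMr// ltr_pdivlMr//; apply/idP/eqP => [|<-].
  exact: Num.Theory.truncn_def.
by apply: truncn_itv; rewrite mulr_ge0// ltW.
Qed.

Lemma digit_half k t : 0 <= t -> (digit k.+1 t)./2 = digit k t.
Proof.
move=> t0; apply/esym/eqP; rewrite -digitP//.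
have := digitP k.+1 (digit k.+1 t) t0; rewrite eqxx => /andP[].
have p0 : 0 < 2 ^+ k :> R by rewrite exprn_gt0.
rewrite !ler_pdivrMr ?ltr_pdivlMr ?exprn_gt0// exprS => h1 h2.
set a := digit _ _ in h1 h2 *.
have ha := odd_double_half a.
have H1 : (a./2.*2 <= a)%N by lia.
have H2 : (a.+1 <= (a./2.+1).*2)%N by case: (odd a) ha => /=; lia.
have G1 : a./2%:R * 2 <= a%:R :> R by rewrite -natrM ler_nat muln2.
have G2 : a.+1%:R <= a./2.+1%:R * 2 :> R by rewrite -natrM ler_nat muln2.
apply/andP; split; lra.
Qed.

Lemma digit_divn K k t : 0 <= t -> (k <= K)%N ->
  (digit K t %/ 2 ^ (K - k))%N = digit k t.
Proof.
move=> t0 /subnKC <-; elim: (K - k)%N => [|m IH].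
  by rewrite addn0 subnn divn1.
rewrite addKn in IH *; rewrite -{}IH addnS -(digit_half (k + m) t0).
by rewrite -divn2 -divnMA -expnS -addnS addKn.
Qed.

Lemma digit_lt k t : 0 <= t -> t < 1 -> (digit k t < 2 ^ k)%N.
Proof.
move=> t0 t1; have := digitP k (digit k t) t0; rewrite eqxx => /andP[+ _].
rewrite ler_pdivrMr ?exprn_gt0// -(ltr_nat R) natrX => /le_lt_trans; apply.
by rewrite gtr_pMl// exprn_gt0.
Qed.

Lemma cell_digit k a b x : 0 <= x.1 -> 0 <= x.2 ->
  cell k a b x <-> digit k x.1 = a /\ digit k x.2 = b.
Proof.
move=> x1 x2; rewrite /cell /= !in_itv /= !digitP//.
by split=> [[/eqP -> /eqP ->]|[-> ->]].
Qed.

Lemma cell_inside k a b x : (a < 2 ^ k)%N -> (b < 2 ^ k)%N -> cell k a b x -> inside x.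
Proof.
move=> ak bk; rewrite /cell /= !in_itv /= => -[/andP[x1 x1'] /andP[x2 x2']].
have p0 : 0 < 2 ^+ k :> R by rewrite exprn_gt0.
have le1 c : (c < 2 ^ k)%N -> c.+1%:R / 2 ^+ k <= 1 :> R.
  by move=> ck; rewrite ler_pdivrMr// mul1r -natrX ler_nat.
rewrite /inside (le_trans _ x1)/= ?divr_ge0 ?(ltW p0)//.
rewrite (le_trans _ x2)/= ?divr_ge0 ?(ltW p0)//.
by rewrite (lt_le_trans x1' (le1 _ ak)) (lt_le_trans x2' (le1 _ bk)).
Qed.

Fixpoint occ_of (K : nat) s : nat -> nat -> nat :=
  if s is x :: s' then add_occ (occ_of K s') (unit_occ (digit K x.1) (digit K x.2))
  else zero_occ.

Lemma gdens_inside K (g : plane -> R) s F : all inside s ->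
  gdens K g s F = \prod_(x <- s) g x * F (occ_of K s).
Proof.
elim: s F => [|x s IH] F /=; first by rewrite big_nil mul1r.
move=> /andP[/andP[/andP[x1 x1'] /andP[x2 x2']] alls].
rewrite (bigD1 (Ordinal (digit_lt K x1 x1')))//= (bigD1 (Ordinal (digit_lt K x2 x2')))//=.
rewrite big_cons !indicE; have [_ h] := @cell_digit K (digit K x.1) (digit K x.2) x x1 x2.
rewrite mem_set ?mul1r; last exact: h.
rewrite IH// [X in _ + X + _]big1 ?[X in _ + _ + X]big1 ?addr0 ?mulrA//.
  move=> a /negP aD; rewrite big1// => b _; rewrite indicE memNset ?mul0r//.
  by move=> /(cell_digit _ _ _ x1 x2)[e1 _]; apply: aD; apply/eqP/val_inj.
move=> b /negP bD; rewrite indicE memNset ?mul0r//.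
by move=> /(cell_digit _ _ _ x1 x2)[_ e1]; apply: bD; apply/eqP/val_inj.
Qed.

Lemma gdens_outside K (g : plane -> R) s F : ~~ all inside s -> gdens K g s F = 0.
Proof.
elim: s F => [|x s IH] F //=; rewrite negb_and => h.
rewrite big1// => a _; rewrite big1// => b _.
have [ix|ix] := boolP (inside x); last first.
  rewrite indicE memNset ?mul0r// => /cell_inside ci.
  by move: ix; rewrite ci.
by rewrite IH ?mulr0//; move: h; rewrite ix.
Qed.

Definition same_cell k x y := (digit k x.1 == digit k y.1) && (digit k x.2 == digit k y.2).

               
(** Level 0, which all points of the square share, is counted; so for separated points and large K
    this is exactly the first level of separation. *)
Definition trunc_w K x y : nat := \sum_(k < K) same_cell k x y.

Lemma cell_count_add d nu a b (x y : nat) :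
  cell_count d (add_occ nu (unit_occ a b)) x y = (cell_count d nu x y + below d x y a b)%N.
Proof.
elim: d x y => [|d IH] x y /=.
  by rewrite /add_occ /unit_occ /below expn0 !divn1 [x == a]eq_sym [y == b]eq_sym.
rewrite !IH; set A := below d x.*2 y.*2 a b; set B := below _ _ _ _ _.
set C := below _ _ _ _ _; set D := below _ _ _ _ _.
have -> : below d.+1 x y a b = (A + B + C + D)%N :> nat.
  rewrite /A /B /C /D /below expnSr !divnMA !divn2.
  have ha := odd_double_half (a %/ 2 ^ d); have hb := odd_double_half (b %/ 2 ^ d).
  move: (a %/ 2 ^ d)%N (b %/ 2 ^ d)%N ha hb => u v.
  have e1 p q : (p.*2 == q.*2) = (p == q) by lia.
  have e2 p q : (p.*2.+1 == q.*2.+1) = (p == q) by lia.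
  have e3 p q : (p.*2 == q.*2.+1) = false by lia.
  have e4 p q : (p.*2.+1 == q.*2) = false by lia.
  move: u./2 v./2 => p q; case: (odd u); case: (odd v) => /= <- <-;
  by rewrite ?add1n ?add0n ?e1 ?e2 ?e3 ?e4 ?andbF ?add0n ?addn0.
lia.
Qed.

(** A new point forms one new pair with each point of every ancestor cell of (a, b), from the parent
    of its leaf up to (x, y). *)
Lemma cell_energy_add (beta : R) d nu a b (x y : nat) : below d x y a b ->
  cell_energy beta d (add_occ nu (unit_occ a b)) x y = cell_energy beta d nu x y +
  beta * (\sum_(s < d) cell_count s.+1 nu (a %/ 2 ^ s.+1) (b %/ 2 ^ s.+1))%:R.
Proof.
elim: d x y => [|d IH] x y ab; first by rewrite big_ord0 mulr0 addr0.
have nb (x' y' : nat) : ~~ below d x' y' a b ->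
    cell_energy beta d (add_occ nu (unit_occ a b)) x' y' = cell_energy beta d nu x' y'.
  move=> h; apply: eq_cell_energy => u v uv; rewrite /add_occ /unit_occ.
  case: eqP => [e1|_]; case: eqP => [e2|_]; rewrite ?addn0//.
  by move: h; rewrite -e1 -e2 uv.
have cE : cell_count d.+1 (add_occ nu (unit_occ a b)) x y = (cell_count d.+1 nu x y).+1.
  by rewrite cell_count_add ab addn1.
have EE nu' : cell_energy beta d.+1 nu' x y = beta * 'C(cell_count d.+1 nu' x y, 2)%:R +
    (cell_energy beta d nu' x.*2 y.*2 + cell_energy beta d nu' x.*2 y.*2.+1 +
     cell_energy beta d nu' x.*2.+1 y.*2 + cell_energy beta d nu' x.*2.+1 y.*2.+1) by [].
rewrite !EE cE big_ord_recr /= -/(cell_count d.+1 nu _ _).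
move: (ab) => /andP[/eqP -> /eqP ->].
rewrite (binS _ 1) bin1 !natrD.
set E := \sum_(_ < _) _ in IH *.
have [x' [y' [xE yE b']]] : exists x' y' : nat, [/\ x' = (a %/ 2 ^ d)%N, y' = (b %/ 2 ^ d)%N & below d x' y' a b].
  by exists (a %/ 2 ^ d)%N, (b %/ 2 ^ d)%N; rewrite /below !eqxx.
have hx : x'./2 = x by move: ab => /andP[/eqP <- _]; rewrite xE expnSr divnMA divn2.
have hy : y'./2 = y by move: ab => /andP[_ /eqP <-]; rewrite yE expnSr divnMA divn2.
have nbl u v : (u != x') || (v != y') -> ~~ below d u v a b.
  by move=> h; apply/negP => /andP[/eqP e1 /eqP e2]; move: h; rewrite -e1 -e2 xE yE !eqxx.
have := IH _ _ b'; have := odd_double_half x'; have := odd_double_half y'; rewrite hx hy.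
case: (odd x'); case: (odd y') => /=; rewrite ?add1n ?add0n => yE' xE' IHb;
  rewrite -xE' -yE' in IHb nbl; rewrite IHb; do 3!(rewrite nb; last by apply: nbl; lia); ring.
Qed.

Lemma cell_count_occ K d s X Y : cell_count d (occ_of K s) X Y =
  count (fun x => below d X Y (digit K x.1) (digit K x.2)) s.
Proof.
elim: s => [|x s IH].
  elim: d X Y => [|d IH] X Y //=; first by rewrite !IH.
by rewrite [occ_of _ _]/= cell_count_add IH /= addnC.
Qed.

Lemma cell_energy0 (beta : R) d (u v : nat) : cell_energy beta d zero_occ u v = 0.
Proof.
have c0 k (a b : nat) : cell_count k zero_occ a b = 0%N.
  by elim: k a b => [//|k IH] a b /=; rewrite !IH.
elim: d u v => [//|d IH] u v /=.
by rewrite !IH !c0 bin0n mulr0 !addr0.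
Qed.

Fixpoint trunc_energy K s : nat :=
  if s is x :: s' then ((\sum_(y <- s') trunc_w K x y) + trunc_energy K s')%N else 0%N.

Lemma cell_energy_occ (beta : R) K s : all inside s ->
  cell_energy beta K (occ_of K s) 0 0 = beta * (trunc_energy K s)%:R.
Proof.
elim: s => [|x s IH].
  by move=> _; rewrite mulr0 cell_energy0.
move=> /andP[/andP[/andP[x1 x1'] /andP[x2 x2']] alls]; rewrite [occ_of _ _]/= cell_energy_add; last first.
  by rewrite /below !divn_small ?eqxx// digit_lt.
rewrite IH// -mulrDr -natrD; congr (_ * _%:R); rewrite [trunc_energy _ (_ :: _)]/= addnC; congr addn.
rewrite (eq_big_seq (fun y => \sum_(k < K) same_cell k x y)%N)// exchange_big.
rewrite (reindex_inj rev_ord_inj); apply: eq_bigr => k _.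
rewrite cell_count_occ -sum1_count big_mkcond; apply: eq_big_seq => y ys.
have /andP[/andP[y1 _] /andP[y2 _]] := allP alls _ ys.
have kK := ltn_ord k; rewrite /below /same_cell [rev_ord k : nat]/=.
have -> : ((K - k.+1).+1 = K - k)%N by lia.
rewrite !digit_divn//; try exact: ltnW.
by rewrite [digit k y.1 == _]eq_sym [digit k y.2 == _]eq_sym; case: ifP.
Qed.

Lemma dyadic_separatedP k x y :
  dyadic_separated k x y <-> [/\ inside x, inside y & ~~ same_cell k x y].
Proof.
split.
  move=> [_ [_ [[i [j ->]] [i' [j' ->]] QQ Qx Qy]]].
  rewrite -/(cell k i j) -/(cell k i' j') in QQ Qx Qy.
  have ix := cell_inside (ltn_ord i) (ltn_ord j) Qx.
  have iy := cell_inside (ltn_ord i') (ltn_ord j') Qy.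
  split=> //; apply/negP => /andP[/eqP e1 /eqP e2]; apply: QQ.
  move: (ix) (iy) => /andP[/andP[x1 _] /andP[x2 _]] /andP[/andP[y1 _] /andP[y2 _]].
  move: Qx Qy => /(cell_digit _ _ _ x1 x2)[<- <-] /(cell_digit _ _ _ y1 y2)[<- <-].
  by rewrite e1 e2.
move=> [/andP[/andP[x1 x1'] /andP[x2 x2']] /andP[/andP[y1 y1'] /andP[y2 y2']] nxy].
have cx : cell k (digit k x.1) (digit k x.2) x by apply/cell_digit.
have cy : cell k (digit k y.1) (digit k y.2) y by apply/cell_digit.
exists (cell k (digit k x.1) (digit k x.2)), (cell k (digit k y.1) (digit k y.2)); split => //.
- by exists (Ordinal (digit_lt k x1 x1')), (Ordinal (digit_lt k x2 x2')).
- by exists (Ordinal (digit_lt k y1 y1')), (Ordinal (digit_lt k y2 y2')).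
- move=> E; rewrite -E in cy; move: cy => /(cell_digit _ _ _ y1 y2)[e1 e2].
  by move: nxy; rewrite /same_cell e1 e2 !eqxx.
Qed.

Lemma hier_w_ge0 x y : (0 <= hier_w x y)%E.
Proof. by apply: le_ereal_inf_tmp => _ [k _ <-]; rewrite lee_fin. Qed.

Lemma hier_w_outside x y : ~~ (inside x && inside y) -> hier_w x y = +oo%E.
Proof.
move=> h; rewrite /hier_w (_ : [set _ | _] = set0) ?image_set0 ?ereal_inf0//.
apply/seteqP; split=> // k [_ /dyadic_separatedP[ix iy _]].
by move: h; rewrite ix iy.
Qed.

Lemma same_cell0 x y : inside x -> inside y -> same_cell 0 x y.
Proof.
move=> /andP[/andP[x1 x1'] /andP[x2 x2']] /andP[/andP[y1 y1'] /andP[y2 y2']].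
have z t : 0 <= t -> t < 1 -> digit 0 t = 0%N.
  by move=> t0 /(digit_lt 0 t0); rewrite expn0; case: (digit 0 t).
by rewrite /same_cell !z.
Qed.

Lemma same_cellW k k' x y : inside x -> inside y -> (k <= k')%N ->
  same_cell k' x y -> same_cell k x y.
Proof.
move=> /andP[/andP[x1 x1'] /andP[x2 x2']] /andP[/andP[y1 y1'] /andP[y2 y2']] kk.
move=> /andP[/eqP e1 /eqP e2]; rewrite /same_cell.
rewrite -(digit_divn x1 kk) -(digit_divn x2 kk) -(digit_divn y1 kk) -(digit_divn y2 kk).
by rewrite e1 e2 !eqxx.
Qed.

(** The only two behaviours of truncated energies: eventually constant, or growing at least like K
    with limit +oo. The dichotomy is stable under sums. *)
Definition settles (u : nat -> nat) (l : \bar R) : Prop :=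
  (exists h K0, l = h%:R%:E /\ forall K, (K0 <= K)%N -> u K = h) \/
  (l = +oo%E /\ forall K, (K <= u K)%N).

Lemma settlesD u v l l' : settles u l -> settles v l' ->
  settles (fun K => u K + v K)%N (l + l')%E.
Proof.
move=> [[h [K0 [-> hu]]]|[-> hu]] [[h' [K0' [-> hv]]]|[-> hv]].
- left; exists (h + h')%N, (maxn K0 K0'); split; first by rewrite natrD EFinD.
  by move=> K; rewrite geq_max => /andP[k k']; rewrite hu// hv.
- by right; split=> // K; rewrite (leq_trans (hv K))// leq_addl.
- by right; split=> // K; rewrite (leq_trans (hu K))// leq_addr.
- by right; split=> // K; rewrite (leq_trans (hu K))// leq_addr.
Qed.

Lemma trunc_w_settles x y : inside x -> inside y ->
  settles (fun K => trunc_w K x y) (hier_w x y).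
Proof.
move=> ix iy; have [[k nk]|all_same] := pselect (exists k, ~~ same_cell k x y).
  have ex : exists k, ~~ same_cell k x y by exists k.
  pose k0 := ex_minn ex; have k0P : ~~ same_cell k0 x y by rewrite /k0; case: ex_minnP.
  have k0min j : ~~ same_cell j x y -> (k0 <= j)%N.
    by rewrite /k0; case: ex_minnP => m _ hm /hm.
  left; exists k0, k0; split.
    apply/eqP; rewrite eq_le; apply/andP; split.
      apply: ge_ereal_inf; exists k0%:R%:E => //; exists k0 => //; split.
        by rewrite lt0n; apply: contraNneq k0P => ->; exact: same_cell0.
      by apply/dyadic_separatedP.
    apply: le_ereal_inf_tmp => _ [j [_ /dyadic_separatedP[_ _ /k0min h]] <-].
    by rewrite lee_fin ler_nat.
  move=> K k0K; rewrite /trunc_w.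
  have E (j : nat) : same_cell j x y = (j < k0)%N.
    apply/idP/idP => [sj|]; last by apply: contraLR; rewrite -leqNgt => /k0min.
    by rewrite ltnNge; apply: contra k0P => h; exact: same_cellW sj.
  under eq_bigr do rewrite E.
  rewrite -(big_mkord xpredT (fun j => nat_of_bool (j < k0)))%N.
  rewrite (big_cat_nat (n := k0))//= [X in (_ + X)%N]big1_seq ?addn0; last first.
    by move=> j; rewrite mem_index_iota => /andP[_ /andP[h _]]; rewrite ltnNge h.
  rewrite (eq_big_nat _ _ (F2 := fun=> 1%N)); last by move=> j /andP[_ ->].
  by rewrite sum_nat_const_nat subn0 muln1.
right; split.
  rewrite /hier_w (_ : [set _ | _] = set0) ?image_set0 ?ereal_inf0//.
  apply/seteqP; split=> // k [_ /dyadic_separatedP[_ _ h]].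
  by apply: all_same; exists k.
move=> K; rewrite /trunc_w (eq_bigr (fun=> 1%N)) ?sum1_card ?card_ord// => k _.
by apply/eqP; rewrite eqb1; apply: contrapT => /negP h; apply: all_same; exists k.
Qed.

Fixpoint pair_energy s : \bar R :=
  if s is x :: s' then (\sum_(y <- s') hier_w x y + pair_energy s')%E else 0%E.

Lemma pair_energy_ge0 s : (0 <= pair_energy s)%E.
Proof.
elim: s => [|x s IH] //=; rewrite adde_ge0// sume_ge0// => y _; exact: hier_w_ge0.
Qed.

Lemma trunc_energy_settles s : all inside s ->
  settles (fun K => trunc_energy K s) (pair_energy s).
Proof.
elim: s => [_|x s IH /= /andP[ix alls]]; first by left; exists 0%N, 0%N.
apply: settlesD; last exact: IH.
elim: s alls {IH} => [_|y s IH /= /andP[iy alls]].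
  by left; exists 0%N, 0%N; rewrite big_nil; split=> // K _; rewrite big_nil.
rewrite big_cons (_ : (fun K => _) = fun K => (trunc_w K x y + \sum_(y <- s) trunc_w K x y)%N).
  by apply: settlesD; [exact: trunc_w_settles|exact: IH].
by apply/funext => K; rewrite big_cons.
Qed.

(** A point outside the half-open square has infinite interaction with any partner, and two points
    guarantee a partner. This is what makes the Boltzmann factor confine the gas to the square. *)
Lemma pair_energy_outside s : (2 <= size s)%N -> ~~ all inside s -> pair_energy s = +oo%E.
Proof.
elim: s => [//|x s IH] /=; rewrite ltnS => s1; rewrite negb_and.
have sum0 : (0 <= \sum_(y <- s) hier_w x y)%E.
  by apply: sume_ge0 => y _; exact: hier_w_ge0.
have sumoo y : y \in s -> hier_w x y = +oo%E -> (\sum_(y <- s) hier_w x y = +oo)%E.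
  move=> ys hy; rewrite (big_rem y)//= hy addye//.
  by rewrite gt_eqF// (@lt_le_trans _ _ 0%E)// sume_ge0// => z _; exact: hier_w_ge0.
have addoo (a b : \bar R) : (0 <= a)%E -> (0 <= b)%E -> a = +oo%E \/ b = +oo%E -> (a + b = +oo)%E.
  by move=> a0 b0 [->|->]; rewrite ?addye ?addey// gt_eqF// (@lt_le_trans _ _ 0%E).
have [ix|ix _] := boolP (inside x); last first.
  apply: addoo => //; first exact: pair_energy_ge0.
  case: s s1 sumoo {IH sum0} => // y s _ sumoo; left; apply: (sumoo y); first exact: mem_head.
  by apply: hier_w_outside; rewrite (negbTE ix).
rewrite orFb => ns; apply: addoo => //; first exact: pair_energy_ge0.
move: (ns); rewrite -has_predC => /hasP[y ys /= iy].
left; apply: (sumoo y ys); apply: hier_w_outside.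
by rewrite (negbTE iy) andbF.
Qed.

Lemma hier_energyE n (p : n.-tuple plane) : hier_energy p = pair_energy p.
Proof.
elim: n p => [|n IH] p; first by rewrite tuple0 /hier_energy big_ord0.
case/tupleP: p => x t; rewrite /hier_energy big_ord_recl /= -IH /hier_energy; congr (_ + _)%E.
  rewrite big_mkcond big_ord_recl /= add0e big_tuple; apply: eq_bigr => j _.
  by rewrite tnth0 tnthS.
apply: eq_bigr => i _; rewrite big_mkcond big_ord_recl /= add0e [RHS]big_mkcond.
by apply: eq_bigr => j _; rewrite !tnthS /bump /= !add1n ltnS.
Qed.

End digits.

(** * Letting the truncation level tend to infinity *)

Section gas_limit.
Context {R : realType}.
Local Notation plane := (measurableTypeR R * measurableTypeR R)%type.
Let leb2 : {sigma_finite_measure set plane -> \bar R} := @lebesgue2 R.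
Variables (beta : R) (n : nat) (g : plane -> R) (Mg : R).
Hypotheses (beta_gt0 : 0 < beta) (n2 : (2 <= n)%N).
Hypotheses (mg : measurable_fun setT g) (g0 : forall x, 0 <= g x) (gM : forall x, g x <= Mg).

Let F K (nu : nat -> nat -> nat) : R := expR (- cell_energy beta K nu 0 0).

Definition gas_weight (p : n.-tuple plane) : \bar R :=
  ((\prod_(x <- p) g x)%:E * expeR (- (beta%:E * hier_energy p)))%E.

Lemma gdens_cvg (p : n.-tuple plane) :
  (gdens K g p (F K))%:E @[K --> \oo] --> gas_weight p.
Proof.
rewrite /gas_weight hier_energyE; have [ins|outs] := boolP (all inside p); last first.
  rewrite pair_energy_outside ?size_tuple// gt0_muley ?lte_fin//= mule0.
  rewrite (_ : (fun K => _) = cst 0%E); first exact: cvg_cst.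
  by apply/funext => K; rewrite gdens_outside.
have E K : gdens K g p (F K) = \prod_(x <- p) g x * expR (- (beta * (trunc_energy K p)%:R)).
  by rewrite gdens_inside// /F cell_energy_occ.
have [[h [K0 [-> hu]]]|[-> hu]] := trunc_energy_settles ins.
  rewrite /= -EFinM; apply: cvg_near_cst; exists K0 => // K /= K0K.
  by rewrite E hu.
rewrite gt0_muley ?lte_fin//= mule0.
set A := \prod_(x <- p) g x.
have A0 : 0 <= A by exact: prodr_ge0.
have q0 : 0 <= expR (- beta) by exact: expR_ge0.
(* Infinite energy: the truncated energy is at least K, so a geometric sequence dominates. *)
have u0 : A * expR (- (beta * (trunc_energy K p)%:R)) @[K --> \oo] --> 0.
  have h : geometric A (expR (- beta)) @ \oo --> 0.
    by apply: cvg_geometric; rewrite ger0_norm// expR_lt1 oppr_lt0.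
  apply: (@squeeze_cvgr _ _ _ _ (cst 0) (geometric A (expR (- beta)))); [near=> K|exact: cvg_cst|exact: h].
  rewrite mulr_ge0 ?expR_ge0//= ler_wpM2l// -expRM_natr ler_expR.
  by rewrite -mulNr ler_wnM2l ?oppr_le0 ?(ltW beta_gt0)// ler_nat.
rewrite (_ : (fun K => _) = (fun K => (A * expR (- (beta * (trunc_energy K p)%:R)))%:E)); last first.
  by apply/funext => K; rewrite E.
by apply: cvg_EFin; [near=> K|exact: u0].
Unshelve. all: by end_near. Qed.

Lemma measurable_gas_weight : measurable_fun setT gas_weight.
Proof.
apply: (emeasurable_fun_cvg (fun K (p : n.-tuple plane) => (gdens K g p (F K))%:E)).
  move=> K; apply/measurable_EFinP; exact: measurable_gdens.
by move=> p _; exact: gdens_cvg.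
Qed.

Lemma gas_weight_restrict :
  gas_weight = (gas_weight \_ (configurations n)).
Proof.
apply/funext => p; rewrite /patch; case: ifPn => // /negP np.
rewrite /gas_weight hier_energyE pair_energy_outside ?size_tuple//.
  by rewrite gt0_muley ?lte_fin//= mule0.
apply/negP => /allP ins; apply: np; rewrite inE => i.
have /andP[/andP[x1 x1'] /andP[x2 x2']] := ins _ (mem_tnth i p).
by split => /=; rewrite in_itv /=; apply/andP; split => //; exact: ltW.
Qed.

(** Dominated convergence. The dominating function is Mg^n on the half-open square, written as a
    [gdens] of level 0 so that its integrability comes from [integral_gdens]. *)
Lemma gas_limit :
  (n`!%:R * tree beta (cell_integral K g) K n 0 0)%:E @[K --> \oo] -->
  (\int[tuple_measure leb2 n]_(p in configurations n) gas_weight p)%E.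
Proof.
have F0 K nu : 0 <= F K nu by exact: expR_ge0.
have bg : exists M, forall x, g x <= M by exists Mg.
have intE K : (\int[tuple_measure leb2 n]_p (gdens K g p (F K))%:E)%E =
    (n`!%:R * tree beta (cell_integral K g) K n 0 0)%:E.
  by rewrite (integral_gdens K mg g0 bg n (F0 K)) label_sum_energy.
have Mg0 : 0 <= Mg by exact: le_trans (g0 (0, 0)) (gM _).
pose G (p : n.-tuple plane) : \bar R := (gdens 0 (cst Mg) p (fun=> 1))%:E.
have mG : measurable_fun setT G by apply/measurable_EFinP; exact: measurable_gdens.
have G0 p : (0 <= G p)%E by rewrite lee_fin gdens_ge0.
have iG : (tuple_measure leb2 n).-integrable setT G.
  apply/integrableP; split=> //.
  under eq_integral do rewrite gee0_abs//.
  rewrite /G (integral_gdens 0 (@measurable_cst _ _ _ _ _ Mg))//; first by rewrite ltry.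
  by exists Mg.
have dom (p : n.-tuple plane) K : (`|(gdens K g p (F K))%:E| <= G p)%E.
  rewrite gee0_abs ?lee_fin ?gdens_ge0// /G.
  have [ins|outs] := boolP (all inside p); last by rewrite !gdens_outside.
  rewrite !gdens_inside// mulr1 -[leRHS]mulr1.
  apply: ler_pM; [exact: prodr_ge0|exact: F0| |].
    by apply: ler_prod => x _; rewrite g0/= gM.
  by rewrite /F cell_energy_occ// -expR0 ler_expR oppr_le0 mulr_ge0// ltW.
have [| | |_ _] := @dominated_convergence _ _ _ (tuple_measure leb2 n) setT measurableT
  (fun K p => (gdens K g p (F K))%:E) gas_weight G _ measurable_gas_weight _ iG.
- by move=> K; apply/measurable_EFinP; exact: measurable_gdens.
- by apply: aeW => p _; exact: gdens_cvg.
- by apply: aeW => p K _; exact: dom.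
move=> H; rewrite integral_mkcond -gas_weight_restrict.
by under eq_fun do rewrite -intE; exact: H.
Qed.

End gas_limit.

                                        

(** * The area of a disc *)

Section disc_area.
Context {R : realType}.
Local Notation plane := (measurableTypeR R * measurableTypeR R)%type.
Let mu := @lebesgue_measure R.

(** Substitute x = c + rho sin t on [-pi/2, pi/2]; a primitive of (rho cos t)^2 is rho^2/2 (t + sin
    t cos t). *)
Lemma integral_half_chord (c rho : R) : 0 < rho ->
  (\int[mu]_(x in `[(c - rho)%R, (c + rho)%R]) (Num.sqrt (rho ^+ 2 - (x - c) ^+ 2))%:E =
   (pi * rho ^+ 2 / 2)%:E)%E.
Proof.
move=> rho0.
pose F (t : R) := c + rho * sin t.
pose G (x : R) := Num.sqrt (rho ^+ 2 - (x - c) ^+ 2).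
have dF (t : R) : is_derive t 1 F (rho * cos t).
  rewrite /F; apply: is_derive_eq.
  by rewrite add0r mul1r.
have F'E : (derive1 F) = fun t => rho * cos t.
  by apply/funext => t; rewrite derive1E derive_val.
have pi2 : - (pi / 2) <= pi / 2 :> R.
  by have := pi_ge0 R; lra.
have pi2' : - (pi / 2) < pi / 2 :> R.
  by have := pi_gt0 R; lra.
have Fa : F (- (pi / 2)) = c - rho by rewrite /F sinN sin_pihalf mulrN1.
have Fb : F (pi / 2) = c + rho by rewrite /F sin_pihalf mulr1.
have cF : continuous F.
  by move=> t; apply: differentiable_continuous; apply/derivable1_diffP; case: (dF t).
have cF' : continuous (derive1 F).
  move=> t; rewrite F'E; apply: continuousM; first exact: cst_continuous.
  exact: continuous_cos.
have cG : continuous G.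
  move=> x; rewrite /G; apply: continuous_comp; last exact: sqrt_continuous.
  apply: continuousB; first exact: cst_continuous.
  apply: (@continuous_comp _ _ _ (fun u : R => u - c) (fun u : R => u ^+ 2)); last exact: exprn_continuous.
  by apply: continuousB; [exact: cvg_id|exact: cst_continuous].
rewrite -Fa -Fb (integration_by_substitution_increasing pi2 (G := G)); first last.
- exact: continuous_subspaceT.
- split; [by move=> t _; case: (dF t)|apply: cvg_at_right_filter; exact: cF|apply: cvg_at_left_filter; exact: cF].
- apply: cvgP; apply: cvg_at_left_filter; exact: cF'.
- apply: cvgP; apply: cvg_at_right_filter; exact: cF'.
- by move=> t _; exact: cF'.
- move=> x y xi yi xy; rewrite /F ltrD2l ltr_pM2l// ltr_sin//.
pose H (t : R) := rho ^+ 2 / 2 * (t + sin t * cos t).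
have dH (t : R) : is_derive t 1 H ((rho * cos t) ^+ 2).
  rewrite /H; apply: is_derive_eq.
  have := cos2Dsin2 t; rewrite /GRing.scale /= => h.
  have -> : sin t * - sin t = cos t ^+ 2 - 1 by rewrite -h; ring.
  by field.
transitivity (\int[mu]_(x in `[(- (pi / 2))%R, (pi / 2)%R]) ((rho * cos x) ^+ 2)%:E)%E.
  apply: eq_integral => t; rewrite inE /= in_itv /= => ti; congr EFin.
  rewrite F'E /G /F /= !fctE.
  have cos0 : 0 <= cos t by exact: cos_ge0_pihalf.
  have -> : rho ^+ 2 - (c + rho * sin t - c) ^+ 2 = (rho * cos t) ^+ 2.
    have := cos2Dsin2 t; rewrite !exprMn => h.
    by have -> : cos t ^+ 2 = 1 - sin t ^+ 2; [rewrite -h|]; ring.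
  by rewrite sqrtr_sqr ger0_norm ?mulr_ge0 ?(ltW rho0)// expr2.
rewrite (@continuous_FTC2 _ _ H)//.
- rewrite -EFinB /H sinN cosN cos_pihalf; congr EFin; by field.
- apply: continuous_subspaceT => t.
  apply: (@continuous_comp _ _ _ (fun u : R => rho * cos u) (fun u : R => u ^+ 2)); last exact: exprn_continuous.
  apply: continuousM; first exact: cst_continuous.
  exact: continuous_cos.
- have cH : continuous H.
    by move=> t; apply: differentiable_continuous; apply/derivable1_diffP; case: (dH t).
  split; [by move=> t _; case: (dH t)|apply: cvg_at_right_filter; exact: cH|apply: cvg_at_left_filter; exact: cH].
- by move=> t _; rewrite derive1E derive_val.
Qed.

Definition eball (z : R * R) (rho : R) : set plane :=
  [set x | euclidean_dist x z <= rho].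

Lemma eballE z rho : 0 <= rho ->
  eball z rho = [set x | (x.1 - z.1) ^+ 2 + (x.2 - z.2) ^+ 2 <= rho ^+ 2].
Proof.
move=> rho0; apply/seteqP; split=> x /=; rewrite /eball /euclidean_dist /=;
  have q0 : 0 <= (x.1 - z.1) ^+ 2 + (x.2 - z.2) ^+ 2 by rewrite addr_ge0 ?sqr_ge0.
  move=> h; rewrite -(sqr_sqrtr q0) lerXn2r// nnegrE ?sqrtr_ge0//.
by move=> h; rewrite -(ger0_norm rho0) -sqrtr_sqr ler_wsqrtr.
Qed.

Lemma eball_neg z rho : rho < 0 -> eball z rho = set0.
Proof.
move=> rho0; apply/seteqP; split=> // x; rewrite /eball /= => h.
by have := le_lt_trans h rho0; rewrite ltNge sqrtr_ge0.
Qed.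

Lemma measurable_eball z rho : measurable (eball z rho).
Proof.
have [rho0|rho0] := ltP rho 0; first by rewrite eball_neg.
rewrite eballE//.
pose q (x : plane) := (x.1 - z.1) ^+ 2 + (x.2 - z.2) ^+ 2.
have mq : measurable_fun setT q.
  apply: measurable_funD; apply: measurable_funX; apply: measurable_funB => //.
have := mq measurableT `]-oo, rho ^+ 2]%classic (measurable_itv _).
by rewrite setTI; congr (measurable _); apply/seteqP; split=> x /=; rewrite in_itv.
Qed.

Lemma lebesgue2_eball z rho : 0 < rho ->
  (lebesgue2 R (eball z rho) = (pi * rho ^+ 2)%:E)%E.
Proof.
move=> rho0; rewrite eballE; last exact: ltW.
set A := [set x | _].
transitivity ((mu \x mu)%E A); first by [].
rewrite /product_measure1 /=.
pose h x := Num.sqrt (rho ^+ 2 - (x - z.1) ^+ 2).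
have -> : (fun x => mu (xsection A x)) =
    ((fun x => (2 * h x)%:E) \_ `[(z.1 - rho)%R, (z.1 + rho)%R]%classic).
  apply/funext => x; rewrite /patch; case: ifPn => xI.
    have h2 : 0 <= rho ^+ 2 - (x - z.1) ^+ 2.
      move: xI; rewrite inE /= in_itv /= => /andP[x1 x2].
      rewrite subr_ge0 -[leLHS]real_normK ?num_real// lerXn2r ?nnegrE ?(ltW rho0)//.
      by rewrite ler_norml; lra.
    have -> : xsection A x = `[(z.2 - h x)%R, (z.2 + h x)%R]%classic.
      apply/seteqP; split=> y; rewrite /xsection /= inE /A /= in_itv /=.
        move=> hy; have : (y - z.2) ^+ 2 <= h x ^+ 2 by rewrite sqr_sqrtr//; lra.
        rewrite -[in leLHS]real_normK ?num_real// ler_pXn2r ?nnegrE ?sqrtr_ge0//.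
        by rewrite ler_norml; lra.
      move=> hy; have : (y - z.2) ^+ 2 <= h x ^+ 2.
        rewrite -[in leLHS]real_normK ?num_real// ler_pXn2r ?nnegrE ?sqrtr_ge0//.
        by rewrite ler_norml; lra.
      by rewrite sqr_sqrtr//; lra.
    rewrite /mu lebesgue_measure_itv /= lte_fin.
    have := sqrtr_ge0 (rho ^+ 2 - (x - z.1) ^+ 2); rewrite -/(h x) => hx0.
    case: ltP => [_|hle]; first by rewrite -EFinB; congr EFin; ring.
    have -> : h x = 0 by lra.
    by rewrite mulr0.
  rewrite (_ : xsection A x = set0); first exact: measure0.
  apply/seteqP; split=> // y; rewrite /xsection /= inE /A /= => hy.
  move/negP: xI; apply; rewrite inE /= in_itv /=.
  have : (x - z.1) ^+ 2 <= rho ^+ 2 by have := sqr_ge0 (y - z.2); lra.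
  rewrite -[in leLHS]real_normK ?num_real// ler_pXn2r ?nnegrE ?(ltW rho0)//.
  by rewrite ler_norml; lra.
rewrite -integral_mkcond.
under eq_integral do rewrite EFinM.
rewrite ge0_integralZl//.
- by rewrite integral_half_chord// -EFinM; congr EFin; field.
- apply/measurable_EFinP; apply: measurable_funTS; apply: continuous_measurable_fun => x.
  apply: continuous_comp; last exact: sqrt_continuous.
  apply: continuousB; first exact: cst_continuous.
  apply: (@continuous_comp _ _ _ (fun u : R => u - z.1) (fun u : R => u ^+ 2)); last exact: exprn_continuous.
  by apply: continuousB; [exact: cvg_id|exact: cst_continuous].
- by move=> x _; rewrite lee_fin sqrtr_ge0.
Qed.

Lemma euclidean_dist_triangle (x y z : R * R) :
  euclidean_dist x z <= euclidean_dist x y + euclidean_dist y z.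
Proof.
rewrite /euclidean_dist.
set a := x.1 - y.1; set b := x.2 - y.2; set c := y.1 - z.1; set e := y.2 - z.2.
have -> : x.1 - z.1 = a + c by rewrite /a /c; ring.
have -> : x.2 - z.2 = b + e by rewrite /b /e; ring.
have p0 : 0 <= a ^+ 2 + b ^+ 2 by rewrite addr_ge0 ?sqr_ge0.
have q0 : 0 <= c ^+ 2 + e ^+ 2 by rewrite addr_ge0 ?sqr_ge0.
set p := Num.sqrt (a ^+ 2 + b ^+ 2); set q := Num.sqrt (c ^+ 2 + e ^+ 2).
have pp : 0 <= p by exact: sqrtr_ge0. 
have qq : 0 <= q by exact: sqrtr_ge0.
have pE : p ^+ 2 = a ^+ 2 + b ^+ 2 by rewrite sqr_sqrtr.
have qE : q ^+ 2 = c ^+ 2 + e ^+ 2 by rewrite sqr_sqrtr.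
rewrite -[leRHS]ger0_norm ?addr_ge0// -sqrtr_sqr ler_wsqrtr//.
have cs : a * c + b * e <= p * q.
  have : (a * c + b * e) ^+ 2 <= (p * q) ^+ 2.
    rewrite exprMn pE qE -subr_ge0.
    have -> : (a ^+ 2 + b ^+ 2) * (c ^+ 2 + e ^+ 2) - (a * c + b * e) ^+ 2 = (a * e - b * c) ^+ 2 by ring.
    exact: sqr_ge0.
  have [neg|pos] := leP (a * c + b * e) 0; first by move=> _; rewrite (le_trans neg)// mulr_ge0.
  by rewrite ler_pXn2r ?nnegrE ?mulr_ge0// ltW.
have -> : (p + q) ^+ 2 = p ^+ 2 + q ^+ 2 + 2 * (p * q) by ring.
by rewrite pE qE; have := cs; rewrite !sqrrD; lra.
Qed.

End disc_area.

(** * Area fractions of a set in dyadic cells *)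

Section cell_fraction.
Context {R : realType}.
Local Notation plane := (measurableTypeR R * measurableTypeR R)%type.
Let leb2 : {sigma_finite_measure set plane -> \bar R} := @lebesgue2 R.
Implicit Types D : set plane.

Definition cfrac D (k x y : nat) : R := 4 ^+ k * fine (leb2 (D `&` cell k x y)).

Lemma leb2_cell_fin D k x y : measurable D -> leb2 (D `&` cell k x y) \is a fin_num.
Proof.
move=> mD; have mc := measurable_cell (R := R) k x y.
rewrite ge0_fin_numE//; apply: (@le_lt_trans _ _ (leb2 (cell k x y))).
  by apply: le_measure; rewrite ?inE//; exact: measurableI.
by rewrite [leb2 _]lebesgue2_cell ltry.
Qed.

Lemma frac_ge0 D k x y : 0 <= cfrac D k x y.
Proof. by rewrite mulr_ge0 ?exprn_ge0// fine_ge0. Qed.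

Lemma frac_le1 D k x y : measurable D -> cfrac D k x y <= 1.
Proof.
move=> mD; have mc := measurable_cell (R := R) k x y.
have : (leb2 (D `&` cell k x y) <= leb2 (cell k x y))%E.
  by apply: le_measure; rewrite ?inE//; exact: measurableI.
rewrite [leb2 (cell _ _ _)]lebesgue2_cell -(fineK (leb2_cell_fin k x y mD)) lee_fin.
rewrite /cfrac => h; apply: le_trans (ler_wpM2l _ h) _; first by rewrite exprn_ge0.
by rewrite -exprMn divff ?expr1n.
Qed.

Lemma frac01 D k x y : measurable D -> 0 <= cfrac D k x y <= 1.
Proof. by move=> mD; rewrite frac_ge0 frac_le1. Qed.

Lemma frac_mono D D' k x y : measurable D -> measurable D' -> D `<=` D' ->
  cfrac D k x y <= cfrac D' k x y.
Proof.
move=> mD mD' DD; have mc := measurable_cell (R := R) k x y.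
rewrite ler_wpM2l ?exprn_ge0// fine_le ?leb2_cell_fin//.
by apply: le_measure; rewrite ?inE; [exact: measurableI|exact: measurableI|exact: setSI].
Qed.

Lemma frac_full D k x y : cell k x y `<=` D -> cfrac D k x y = 1.
Proof.
by move=> /setIidr; rewrite /cfrac => ->; rewrite [leb2 _]lebesgue2_cell /= -exprMn divff ?expr1n.
Qed.

Lemma frac_empty D k x y : D `&` cell k x y = set0 -> cfrac D k x y = 0.
Proof. by rewrite /cfrac => ->; rewrite measure0 mulr0. Qed.

Lemma frac_le_area D k x y : measurable D -> leb2 D \is a fin_num ->
  cfrac D k x y <= 4 ^+ k * fine (leb2 D).
Proof.
move=> mD fD; have mc := measurable_cell (R := R) k x y.
rewrite /cfrac; apply: ler_wpM2l; first exact: exprn_ge0.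
apply: fine_le; [exact: leb2_cell_fin|exact: fD|].
by apply: le_measure; [rewrite inE; exact: measurableI|rewrite inE|exact: subIsetl].
Qed.

Lemma frac_root D : D `<=` cell 0 0 0 -> cfrac D 0 0 0 = fine (leb2 D).
Proof. by move=> /setIidl; rewrite /cfrac expr0 mul1r => ->. Qed.

Lemma cell_itv_split k a :
  `[a%:R / 2 ^+ k, a.+1%:R / 2 ^+ k[%classic =
  `[a.*2%:R / 2 ^+ k.+1, a.*2.+1%:R / 2 ^+ k.+1[ `|`
  `[a.*2.+1%:R / 2 ^+ k.+1, a.*2.+2%:R / 2 ^+ k.+1[ :> set R.
Proof.
have p0 : 0 < 2 ^+ k :> R by rewrite exprn_gt0.
have E c : c.*2%:R / 2 ^+ k.+1 = c%:R / 2 ^+ k :> R.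
  by rewrite -muln2 natrM exprS; field; rewrite gt_eqF.
rewrite -[a.*2.+2]/(a.+1.*2) !E.
apply/seteqP; split=> t /=; rewrite !in_itv /=.
  move=> /andP[t1 t2]; have [h|h] := ltP t (a.*2.+1%:R / 2 ^+ k.+1); [left|right].
    by rewrite t1.
  by rewrite t2.
have l1 : a%:R / 2 ^+ k <= a.*2.+1%:R / 2 ^+ k.+1 :> R.
  by rewrite -E ler_pM2r ?invr_gt0 ?exprn_gt0// ler_nat.
have l2 : a.*2.+1%:R / 2 ^+ k.+1 <= a.+1%:R / 2 ^+ k :> R.
  by rewrite -E ler_pM2r ?invr_gt0 ?exprn_gt0// ler_nat doubleS.
move=> [/andP[t1 t2]|/andP[t1 t2]]; apply/andP; split => //.
- exact: lt_le_trans l2.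
- exact: le_trans t1.
Qed.

Lemma frac_child_mean D : measurable D -> child_mean (cfrac D).
Proof.
move=> mD k x y.
have mI (l r l' r' : R) : measurable (D `&` (`[l, r[ `*` `[l', r'[) : set plane).
  by apply: measurableI => //; apply: measurableX; exact: measurable_itv.
have dis a : `[a.*2%:R / 2 ^+ k.+1, a.*2.+1%:R / 2 ^+ k.+1[ `&`
  `[a.*2.+1%:R / 2 ^+ k.+1, a.*2.+2%:R / 2 ^+ k.+1[ = set0 :> set R.
  apply/seteqP; split=> // t [] /=; rewrite !in_itv /= => /andP[_ t1] /andP[t2 _].
  by have := lt_le_trans t1 t2; rewrite ltxx.
have E : D `&` cell k x y = (D `&` cell k.+1 x.*2 y.*2 `|` D `&` cell k.+1 x.*2 y.*2.+1) `|`
   (D `&` cell k.+1 x.*2.+1 y.*2 `|` D `&` cell k.+1 x.*2.+1 y.*2.+1).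
  rewrite /cell (cell_itv_split k x) (cell_itv_split k y).
  by apply/seteqP; split=> -[p q]; rewrite /setI /setU /setX /mkset /=; tauto.
have d1 a b : D `&` cell k.+1 a y.*2 `&` (D `&` cell k.+1 b y.*2.+1) = set0.
  apply/seteqP; split=> // -[p q] [[_ [_ h1]] [_ [_ h2]]].
  by have : set0 q by rewrite -(dis y).
have d2 b b' : D `&` cell k.+1 x.*2 b `&` (D `&` cell k.+1 x.*2.+1 b') = set0.
  apply/seteqP; split=> // -[p q] [[_ [h1 _]] [_ [h2 _]]].
  by have : set0 p by rewrite -(dis x).
have m (a b : nat) : measurable (D `&` cell k.+1 a b) by exact: mI.
rewrite /cfrac E measureU; [|exact: measurableU|exact: measurableU|]; last first.
  by rewrite setIUl !setIUr !d2 !setU0.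
rewrite (measureU leb2 (m _ _) (m _ _) (d1 _ _)) (measureU leb2 (m _ _) (m _ _) (d1 _ _)).
have key (p1 p2 p3 p4 : \bar R) : p1 \is a fin_num -> p2 \is a fin_num ->
    p3 \is a fin_num -> p4 \is a fin_num ->
    4 ^+ k * fine (p1 + p2 + (p3 + p4))%E = (4 ^+ k.+1 * fine p1 + 4 ^+ k.+1 * fine p2 +
      4 ^+ k.+1 * fine p3 + 4 ^+ k.+1 * fine p4) / 4.
  by case: p1 => // p1; case: p2 => // p2; case: p3 => // p3; case: p4 => // p4 _ _ _ _ /=;
    rewrite exprS; field.
by apply: key; exact: leb2_cell_fin.
Qed.

End cell_fraction.

(** * Cells cut by the circle *)

Section disc_cells.
Context {R : realType}.
Local Notation plane := (measurableTypeR R * measurableTypeR R)%type.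
Variables (z : R * R) (rho : R).
Hypotheses (rho0 : 0 < rho) (ball_in : eball z rho `<=` cell 0 0 0).

Definition dfrac := cfrac (eball z rho).
Local Notation W := dfrac.

Lemma dfrac_mean : child_mean W.
Proof. apply: frac_child_mean; exact: measurable_eball. Qed.

Lemma dfrac01 k x y : 0 <= W k x y <= 1.
Proof. apply: frac01; exact: measurable_eball. Qed.

Lemma dfrac_root : W 0 0 0 = pi * rho ^+ 2.
Proof. by rewrite /dfrac frac_root// [X in fine X]lebesgue2_eball. Qed.

Lemma frac_eball_le (r : R) k x y : 0 < r -> cfrac (eball z r) k x y <= 4 ^+ k * (pi * r ^+ 2).
Proof.
move=> r0; have E := lebesgue2_eball z r0.
have := @frac_le_area _ (eball z r) k x y (measurable_eball _ _).
by rewrite [X in _ * fine X]E /=; apply; rewrite [X in X \is a _]E.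
Qed.

Lemma cell_diam k x y (p q : plane) : cell k x y p -> cell k x y q ->
  euclidean_dist p q <= 2 / 2 ^+ k.
Proof.
rewrite /cell /= !in_itv /= => -[/andP[a1 a2] /andP[b1 b2]] [/andP[c1 c2] /andP[d1 d2]].
have s0 : 0 < 1 / 2 ^+ k :> R by rewrite divr_gt0// exprn_gt0.
have E c : c.+1%:R / 2 ^+ k = c%:R / 2 ^+ k + 1 / 2 ^+ k :> R by rewrite -natr1 mulrDl.
rewrite !E in a2 b2 c2 d2.
have -> : 2 / 2 ^+ k = 2 * (1 / 2 ^+ k) :> R by rewrite mulrA mulr1.
set s := 1 / 2 ^+ k in s0 a2 b2 c2 d2 *.
rewrite /euclidean_dist -[leRHS]ger0_norm; last by rewrite mulr_ge0// ltW.
rewrite -sqrtr_sqr ler_wsqrtr//.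
have sq (t : R) : - s <= t <= s -> t ^+ 2 <= s ^+ 2.
  move=> h; rewrite -[in leLHS]real_normK ?num_real// lerXn2r ?nnegrE ?(ltW s0)//.
  by rewrite ler_norml.
have := sq (p.1 - q.1) ltac:(lra); have := sq (p.2 - q.2) ltac:(lra).
have := sqr_ge0 s; have -> : (2 * s) ^+ 2 = 4 * s ^+ 2 by ring.
lra.
Qed.

Lemma dfrac_meets k x y : 0 < W k x y -> exists2 p, cell k x y p & eball z rho p.
Proof.
move=> W0; apply: contrapT => h; move: W0; rewrite /dfrac frac_empty ?ltxx//.
by apply/seteqP; split=> // p [bp cp]; apply: h; exists p.
Qed.

Lemma dfrac_misses k x y : W k x y < 1 -> exists2 p, cell k x y p & ~ eball z rho p.
Proof.
move=> W1; apply: contrapT => h; move: W1; rewrite /dfrac frac_full ?ltxx// => p cp.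
by apply: contrapT => np; apply: h; exists p.
Qed.

Lemma frac_plus k x y : 0 < W k x y -> cfrac (eball z (rho + 2 / 2 ^+ k)) k x y = 1.
Proof.
move=> /dfrac_meets[p cp bp]; apply: frac_full => q cq; rewrite /eball /=.
rewrite (le_trans (euclidean_dist_triangle q p z))// addrC lerD//.
exact: cell_diam cq cp.
Qed.

Lemma frac_minus k x y : W k x y < 1 -> cfrac (eball z (rho - 2 / 2 ^+ k)) k x y = 0.
Proof.
move=> /dfrac_misses[p cp bp]; apply: frac_empty; apply/seteqP; split=> // q [bq cq].
apply: bp; rewrite /eball /= in bq *.
have := euclidean_dist_triangle p q z; have := cell_diam cp cq; lra.
Qed.

(** Boundary in the sense of measure: a cell that is almost entirely inside or outside is not
    counted, even if it meets the circle. *)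
Definition bd k x y := (0 < W k x y) && (W k x y < 1).

Lemma dfrac_not_bd k x y : ~~ bd k x y -> W k x y = 0 \/ W k x y = 1.
Proof.
have /andP[w0 w1] := dfrac01 k x y; rewrite negb_and -!leNgt => /orP[h|h]; [left|right];
by apply/eqP; rewrite eq_le ?h ?w0 ?w1.
Qed.

                                                                         
(** With s = 2 / 2^k bounding the diameter of a cell, a boundary cell is filled by the disc of
    radius rho + s and missed by that of radius rho - s. The count is therefore at most 4^k times
    the area of the annulus; when rho <= s the inner disc is simply dropped. *)
Lemma bd_count k : desc k (fun a b => (bd k a b)%:R) 0 0 <= 16 * pi * (1 + rho * 2 ^+ k).
Proof.
set s : R := 2 / 2 ^+ k; have p0 : 0 < 2 ^+ k :> R by rewrite exprn_gt0.
have s0 : 0 < s by rewrite divr_gt0.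
have pi0 := pi_gt0 R.
pose P := cfrac (eball z (rho + s)); pose N := cfrac (eball z (rho - s)).
apply: (@le_trans _ _ (desc k (fun a b => P k a b + (-1) * N k a b) 0 0)).
  apply: desc_le => a b; rewrite mulN1r /bd.
  have [w0|w0] := ltP 0 (W k a b); last first.
    rewrite /= subr_ge0 frac_mono//; try exact: measurable_eball.
    by move=> q; rewrite /eball /=; lra.
  rewrite /P frac_plus//=; have [w1|w1] := ltP (W k a b) 1.
    by rewrite /N frac_minus// subr0.
  by rewrite subr_ge0 frac_le1//; exact: measurable_eball.
rewrite descD (descZ k (-1) (N k)).
have mP : child_mean P by apply: frac_child_mean; exact: measurable_eball.
have mN : child_mean N by apply: frac_child_mean; exact: measurable_eball.
have DP := @desc_mean R P 0 k 0 0 mP; have DN := @desc_mean R N 0 k 0 0 mN.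
rewrite add0n in DP DN; rewrite DP DN.
have PE : P 0 0 0 <= pi * (rho + s) ^+ 2.
  by have := @frac_eball_le (rho + s) 0 0 0; rewrite expr0 mul1r; apply; rewrite addr_gt0.
have k4 : 4 ^+ k = 2 ^+ k * 2 ^+ k :> R.
  by rewrite -exprMn; congr (_ ^+ _); rewrite -natrM.
have ks : 4 ^+ k * s ^+ 2 = 4 :> R by rewrite k4 /s; field; rewrite gt_eqF.
have ks1 : 4 ^+ k * s = 2 * 2 ^+ k :> R by rewrite k4 /s; field; rewrite gt_eqF.
have k0 : 0 < 4 ^+ k :> R by rewrite exprn_gt0.
have [rs|rs] := ltP s rho.
  have NE : N 0 0 0 = pi * (rho - s) ^+ 2.
    rewrite /N frac_root; last first.
      by apply: subset_trans ball_in => q; rewrite /eball /=; lra.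
    by rewrite [X in fine X]lebesgue2_eball// subr_gt0.
  apply: (@le_trans _ _ (4 ^+ k * (pi * (4 * rho * s)))).
    rewrite mulN1r -mulrBr ler_pM2l// NE.
    have -> : pi * (4 * rho * s) = pi * (rho + s) ^+ 2 - pi * (rho - s) ^+ 2 by ring.
    by rewrite lerB.
  have -> : 4 ^+ k * (pi * (4 * rho * s)) = 8 * pi * (rho * 2 ^+ k).
    by transitivity (4 * pi * rho * (4 ^+ k * s)); [ring|rewrite ks1; ring].
  have : 0 <= rho * 2 ^+ k by rewrite mulr_ge0// ltW.
  nra.
have N0 : 0 <= N 0 0 0 by exact: frac_ge0.
apply: (@le_trans _ _ (4 ^+ k * (pi * (4 * s ^+ 2)))).
  have a1 : 0 <= rho + s by rewrite addr_ge0// ltW.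
  have a2 : 0 <= 2 * s by rewrite mulr_ge0// ltW.
  have a3 : rho + s <= 2 * s by rewrite mulr_natl mulr2n lerD2r.
  have h : (rho + s) ^+ 2 <= (2 * s) ^+ 2 by rewrite lerXn2r.
  have -> : pi * (4 * s ^+ 2) = pi * (2 * s) ^+ 2 by ring.
  rewrite mulN1r lerBlDr ler_wpDr//; first exact: (mulr_ge0 (ltW k0) N0).
  by rewrite ler_pM2l// (le_trans PE)// ler_pM2l.
have -> : 4 ^+ k * (pi * (4 * s ^+ 2)) = 4 * pi * (4 ^+ k * s ^+ 2) by ring.
rewrite ks; have : 0 <= rho * 2 ^+ k by rewrite mulr_ge0// ltW.
nra.
Qed.

Lemma mean_extremal (w a b c d : R) : w = (a + b + c + d) / 4 ->
  0 <= a <= 1 -> 0 <= b <= 1 -> 0 <= c <= 1 -> 0 <= d <= 1 -> w = 0 \/ w = 1 ->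
  [/\ a = w, b = w, c = w & d = w].
Proof. by move=> mw a01 b01 c01 d01 [w0|w1]; split; lra. Qed.

Lemma dfrac_prop (f : R -> R) k t x y : (W k x y = 0 \/ W k x y = 1) ->
  desc t (fun a b => f (W (k + t)%N a b)) x y = 4 ^+ t * f (W k x y).
Proof.
elim: t k x y => [|t IH] k x y; first by rewrite addn0 expr0 mul1r.
move=> w; rewrite /= addnS -addSn.
have [e1 e2 e3 e4] := mean_extremal (dfrac_mean k x y) (dfrac01 _ _ _) (dfrac01 _ _ _)
  (dfrac01 _ _ _) (dfrac01 _ _ _) w.
have E a b : W k.+1 a b = W k x y ->
    desc t (fun a b => f (W (k.+1 + t)%N a b)) a b = 4 ^+ t * f (W k x y).
  by move=> e; rewrite IH e.
rewrite (E _ _ e1) (E _ _ e2) (E _ _ e3) (E _ _ e4) exprS.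
by move: (f (W k x y)) (4 ^+ t) => u v; ring.
Qed.

(** * Total cost of the boundary cells *)

Section root_upper.
Variables (beta : R) (g : nat -> nat -> R) (n M N : nat) (V : nat -> nat -> nat -> R).
Variables (th bM cM : R).
Hypotheses (beta0 : 0 < beta) (g0 : forall a b, 0 <= g a b).
Hypotheses (bM0 : 0 <= bM) (bM1 : bM <= beta / 16 / 3) (cM0 : 0 <= cM).
Hypothesis Vmean : forall k x y, (k < M)%N -> V k x y =
  (V k.+1 x.*2 y.*2 + V k.+1 x.*2 y.*2.+1 + V k.+1 x.*2.+1 y.*2 +
   V k.+1 x.*2.+1 y.*2.+1) / 4.
Hypothesis V01 : forall k x y, (k <= M)%N -> 0 <= V k x y <= 1.
Hypothesis Vx : forall k x y, (k < M)%N -> V k.+1 x y <= 36 * pi * (rho * 2 ^+ k) ^+ 2.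
Hypothesis leaf : forall m x y, bd M x y ->
  tree beta g N.+1 m x y <= ell beta N.+1 m *
    expR (th * (m%:R * V M x y) + cM + bM * (m%:R - n%:R / 4 ^+ M) ^+ 2).
Hypothesis inner : forall t k m x y, (k + t = M)%N -> ~~ bd k x y ->
  tree beta g (N.+1 + t) m x y <= ell beta (N.+1 + t) m * expR (th * (m%:R * V k x y)).
Hypothesis xM : 1 <= rho * 2 ^+ M.

Definition upper_const : R :=
  quad_gauss_const beta * (16 * pi) * (144 * pi + 12) + 32 * pi.

Lemma quad_gauss_const_ge0 : 0 <= quad_gauss_const beta.
Proof. by rewrite mulr_ge0// sub_gauss_const_ge0. Qed.

Lemma sum_pow_le (q : R) : 2 <= q -> \sum_(s < M.+1) q ^+ s <= 2 * q ^+ M.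
Proof.
move=> q2; elim: M => [|j IH]; first by rewrite big_ord1 expr0; lra.
rewrite big_ord_recr /=; apply: (le_trans (lerD IH (lexx _))).
have : 0 <= q ^+ j by rewrite exprn_ge0//; lra.
by rewrite exprS; nra.
Qed.

(** Sums the costs of [tree_upper]. Level s has O(1 + x) boundary cells with x = rho 2^s, and each
    pays at most th^2 w^2 with w = O(min(1, x^2)); since (1 + x) w = O(x), the series is geometric
    and dominated by s = M. At the root the quadratic term vanishes because its centre is n. *)
Lemma tree_root_upper : tree beta g (N.+1 + M) n 0 0 <= ell beta (N.+1 + M) n *
  expR (th * (n%:R * V 0 0 0) + upper_const * (th ^+ 2 + bM + cM) * (rho * 2 ^+ M)).
Proof.
have pi0 := pi_gt0 R.
pose xx k := rho * 2 ^+ k.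
have x0 k : 0 <= xx k by rewrite mulr_ge0 ?exprn_ge0// ltW.
(* The second bound matters for cells larger than the disc, which are covered only in proportion to
   x^2. *)
pose w k := Num.min 1 (36 * pi * xx k ^+ 2).
have w0 k : 0 <= w k by rewrite /w le_min ler01 !mulr_ge0 ?sqr_ge0// ltW.
have w1 k : w k <= 1 by rewrite /w ge_min lexx.
have wx k : (1 + xx k) * w k <= 72 * pi * xx k.
  have wk : w k <= 36 * pi * xx k ^+ 2 by rewrite /w ge_min lexx orbT.
  have p2 : 2 <= pi :> R by exact: pi_ge2.
  have := x0 k; have := w0 k; have := w1 k; move: (w k) (xx k) wk => v x wk w1' w0' x0'.
  have [x1|x1] := leP x 1.
    apply: (@le_trans _ _ (2 * v)); first by nra.
    apply: (@le_trans _ _ (72 * pi * x ^+ 2)); first by lra.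
    by rewrite ler_pM2l ?mulr_gt0// expr2 ler_piMl.
  apply: (@le_trans _ _ (2 * x)); first by nra.
  by rewrite ler_wpM2r//; lra.
pose mu k : R := n%:R / 4 ^+ k.
pose b k : R := bM * 4 ^+ k / 4 ^+ M.
have q0 k : 0 < 4 ^+ k :> R by rewrite exprn_gt0.
have b0 k : 0 <= b k by rewrite /b divr_ge0 ?mulr_ge0 ?(ltW (q0 _)).
pose C2 := quad_gauss_const beta.
have C20 : 0 <= C2 by exact: quad_gauss_const_ge0.
(* The constant of the leaf estimate is charged at level M only. *)
pose c k : R := C2 * ((th * w k) ^+ 2 + b k.+1) + (k == M)%:R * cM.
have c0 k : 0 <= c k.
  by apply: addr_ge0; apply: mulr_ge0 => //; apply: addr_ge0 => //; exact: sqr_ge0.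
have mu4 k : mu k = 4 * mu k.+1 by rewrite /mu exprS; field; rewrite gt_eqF.
have b4 k : b k = b k.+1 / 4 by rewrite /b exprS; field; rewrite gt_eqF.
have bMM : b M = bM by rewrite /b mulfK// gt_eqF.
have bM' k : (k <= M)%N -> b k <= bM.
  move=> kM; rewrite -[leRHS]mulr1 /b -mulrA ler_wpM2l// ler_pdivrMr// mul1r.
  by rewrite ler_weXn2l// ler1n.
have Vw k x y : (k < M)%N -> 0 <= V k.+1 x y <= w k.
  move=> kM; have /andP[v0 v1] := V01 x y kM.
  by rewrite v0 /w le_min v1 Vx.
have leaf' m x y : bd M x y -> tree beta g N.+1 m x y <= ell beta N.+1 m *
    expR (th * (m%:R * V M x y) + c M + b M * (m%:R - mu M) ^+ 2).
  move=> /leaf h; apply: (le_trans (h m)); rewrite ler_pM2l ?ell_gt0// ler_expR.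
  rewrite bMM /mu lerD2r lerD2l /c eqxx mul1r lerDr.
  by apply: mulr_ge0 => //; apply: addr_ge0 => //; exact: sqr_ge0.
have cge k : (k < M)%N -> C2 * ((th * w k) ^+ 2 + b k.+1) <= c k.
  by move=> kM; rewrite /c lerDl mulr_ge0.
have H := @tree_upper R beta beta0 g M N V bd th mu w c b g0 Vmean Vw mu4 b4 b0
  (fun k kM => le_trans (bM' _ kM) bM1) c0 cge leaf' inner M 0 n 0 0 (add0n M).
apply: (le_trans H); rewrite ler_pM2l ?ell_gt0// ler_expR.
rewrite /mu expr0 divr1 subrr expr0n mulr0 addr0 lerD2l accE.
pose SS : R := 16 * pi.
have SS0 : 0 <= SS by rewrite mulr_ge0// ltW.
have T0 : 0 <= C2 * th ^+ 2 * SS.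
  by apply: mulr_ge0 => //; apply: mulr_ge0 => //; exact: sqr_ge0.
apply: (@le_trans _ _ (\sum_(s < M.+1) (C2 * th ^+ 2 * SS * (72 * pi) * rho * 2 ^+ s +
   C2 * SS * (2 * xx M) * (bM * 4 / 4 ^+ M) * 4 ^+ s + (nat_of_ord s == M)%:R * (cM * (SS * (2 * xx M)))))).
  apply: ler_sum => s _; rewrite add0n.
  have sM : (s <= M)%N by have := ltn_ord s.
  apply: (le_trans (ler_wpM2l (c0 s) (bd_count s))).
  rewrite -/SS -/(xx s) /c.
  have xs : 1 + xx s <= 2 * xx M.
    have h1 : 1 <= xx M by exact: xM.
    have h2 : xx s <= xx M by rewrite /xx ler_pM2l// ler_weXn2l// ler1n.
    lra.
  have e0 : 0 <= 1 + xx s by rewrite addr_ge0.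
  rewrite mulrDl; apply: lerD.
    rewrite mulrDr mulrDl; apply: lerD.
      have -> : C2 * (th * w s) ^+ 2 * (SS * (1 + xx s)) =
        C2 * th ^+ 2 * SS * ((1 + xx s) * w s * w s) by ring.
      have -> : C2 * th ^+ 2 * SS * (72 * pi) * rho * 2 ^+ s = C2 * th ^+ 2 * SS * (72 * pi * xx s).
        by rewrite /xx; ring.
      apply: ler_wpM2l => //.
      by apply: le_trans (wx s); rewrite ler_piMr// mulr_ge0.
    have -> : C2 * SS * (2 * xx M) * (bM * 4 / 4 ^+ M) * 4 ^+ s = C2 * b s.+1 * (SS * (2 * xx M)).
      by rewrite /b exprS; field; rewrite gt_eqF.
    by apply: ler_wpM2l; [exact: mulr_ge0|exact: ler_wpM2l].
  by rewrite -mulrA; do 3!(apply: ler_wpM2l => //).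
rewrite !big_split /= -!mulr_sumr -mulr_suml.
have s2 := @sum_pow_le 2 (lexx _); have s4 := @sum_pow_le 4 ltac:(lra).
have -> : \sum_(i < M.+1) (nat_of_ord i == M)%:R = 1 :> R.
  rewrite (bigD1 ord_max)//= eqxx big1 ?addr0// => i; rewrite -val_eqE /= => /negbTE ->.
  by [].
rewrite mul1r.
have xM0 := x0 M.
have A1 : C2 * th ^+ 2 * SS * (72 * pi) * rho * (\sum_(i < M.+1) 2 ^+ i) <=
    C2 * th ^+ 2 * SS * (144 * pi) * xx M.
  apply: (le_trans (ler_wpM2l _ s2)).
    apply: mulr_ge0 => //; last exact: ltW.
    by apply: mulr_ge0 => //; rewrite mulr_ge0// ltW.
  by rewrite le_eqVlt; apply/orP; left; apply/eqP; rewrite /xx; ring.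
have A2 : C2 * SS * (2 * xx M) * (bM * 4 / 4 ^+ M) * (\sum_(i < M.+1) 4 ^+ i) <=
    C2 * SS * 16 * bM * xx M.
  apply: (le_trans (ler_wpM2l _ s4)).
    apply: mulr_ge0; last by apply: divr_ge0; [exact: mulr_ge0|exact: ltW].
    by apply: mulr_ge0; [exact: mulr_ge0|apply: mulr_ge0 => //; exact: x0].
  by rewrite le_eqVlt; apply/orP; left; apply/eqP; field; rewrite gt_eqF.
apply: (le_trans (lerD (lerD A1 A2) (lexx _))).
rewrite /upper_const -/C2 -/SS -/(xx M).
have t2 := sqr_ge0 th.
have p2 : 2 <= pi :> R by exact: pi_ge2.
have CS0 : 0 <= C2 * SS by rewrite mulr_ge0.
have -> : 32 * pi = 2 * SS by rewrite /SS; ring.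
rewrite -subr_ge0.
have -> : (C2 * SS * (144 * pi + 12) + 2 * SS) * (th ^+ 2 + bM + cM) * xx M -
  (C2 * th ^+ 2 * SS * (144 * pi) * xx M + C2 * SS * 16 * bM * xx M + cM * (SS * (2 * xx M))) =
  xx M * (C2 * SS * (12 * th ^+ 2 + (144 * pi - 4) * bM + (144 * pi + 12) * cM) +
   2 * SS * (th ^+ 2 + bM)) by ring.
apply: mulr_ge0 => //; apply: addr_ge0.
  apply: mulr_ge0 => //; apply: addr_ge0; last by apply: mulr_ge0 => //; lra.
  by apply: addr_ge0; apply: mulr_ge0 => //; lra.
by apply: mulr_ge0; [exact: mulr_ge0|exact: addr_ge0].
Qed.

End root_upper.

End disc_cells.

(** Hoeffding's lemma for a Bernoulli variable, with a crude constant: after centring, the linear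
    terms of [expR_le_Dx_gauss] cancel. *)
Lemma bernoulli_gauss {R : realType} (w t : R) : 0 <= w <= 1 ->
  1 - w + w * expR t <= expR (t * w + 2 * t ^+ 2).
Proof.
move=> /andP[w0 w1].
have -> : 1 - w + w * expR t =
    expR (t * w) * ((1 - w) * expR (- (t * w)) + w * expR (t * (1 - w))).
  have e1 : expR (t * w) * expR (- (t * w)) = 1 by rewrite -expRD subrr expR0.
  have e2 : expR t = expR (t * w) * expR (t * (1 - w)) by rewrite -expRD; congr expR; ring.
  rewrite e2; move: (expR (t * w)) (expR (- (t * w))) (expR (t * (1 - w))) e1 => a b c e1.
  have -> : a * ((1 - w) * b + w * c) = (1 - w) * (a * b) + w * (a * c) by ring.
  by rewrite e1 mulr1.
rewrite expRD ler_pM2l ?expR_gt0//.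
have h1 := expR_le_Dx_gauss (- (t * w)); have h2 := expR_le_Dx_gauss (t * (1 - w)).
have m1 : expR (2 * (- (t * w)) ^+ 2) <= expR (2 * t ^+ 2).
  by rewrite ler_expR ler_pM2l// sqrrN exprMn ler_piMr ?sqr_ge0// exprn_ile1.
have m2 : expR (2 * (t * (1 - w)) ^+ 2) <= expR (2 * t ^+ 2).
  by rewrite ler_expR ler_pM2l// exprMn ler_piMr ?sqr_ge0// exprn_ile1//; lra.
have w1' : 0 <= 1 - w by lra.
have := ler_wpM2l w1' (le_trans h1 (lerD (lexx _) m1)).
have := ler_wpM2l w0 (le_trans h2 (lerD (lexx _) m2)).
move: (expR _) (expR _) (expR _) => a b c; lra.
Qed.

                                              

(** * Upper bounds for the exponential moment *)

Section mgf_upper.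
Context {R : realType}.
Variables (beta : R) (z : R * R) (rho : R) (n M N : nat) (th : R).
Hypotheses (beta0 : 0 < beta) (rho0 : 0 < rho) (ball_in : eball z rho `<=` cell 0 0 0).
Hypothesis xM : 1 <= rho * 2 ^+ M.
Local Notation W := (dfrac z rho).
Local Notation g := (mgf_leaf (N.+1 + M) W th).

Let W01 : forall k x y, 0 <= W k x y <= 1.
Proof. exact: dfrac01. Qed.

Let Wmean : child_mean W.
Proof. exact: dfrac_mean. Qed.

Let g0 a b : 0 <= g a b.
Proof. exact/ltW/mgf_leaf_gt0. Qed.

Let hoeffding d k m x y : (k + d = N.+1 + M)%N ->
  tree beta g d m x y <= ell beta d m * (1 - W k x y + W k x y * expR (th * m%:R)).
Proof. exact: hoeffding_tree. Qed.

Let const_cell d k m x y (v : R) : (k + d = N.+1 + M)%N -> ~~ bd z rho k x y ->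
  W k x y = v ->
  tree beta g d m x y <= ell beta d m * expR (th * (m%:R * v)).
Proof.
move=> kd /(dfrac_not_bd) w Wv; have := hoeffding m x y kd; rewrite Wv.
move=> /le_trans; apply; rewrite ler_pM2l ?ell_gt0//.
have [v0|v1] : v = 0 \/ v = 1 by rewrite -Wv.
  by rewrite v0 subr0 mul0r addr0 !mulr0 expR0.
by rewrite v1 subrr add0r mul1r mulr1.
Qed.

Lemma dfrac_scale k x y : W k.+1 x y <= 4 * pi * (rho * 2 ^+ k) ^+ 2.
Proof.
have := @frac_eball_le R z rho k.+1 x y rho0; rewrite -/(W _ _ _) => /le_trans; apply.
have -> : 4 ^+ k.+1 = 4 * (2 ^+ k * 2 ^+ k) :> R.
  by rewrite exprS -exprMn -natrM.
by rewrite le_eqVlt; apply/orP; left; apply/eqP; ring.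
Qed.

(** Stop at cells of mean population at most 4. There the Hoeffding and Bernoulli bounds cost 2 th^2
    m^2, which is at most 64 th^2 + 4 th^2 (m - mu)^2, the shape accepted by the recursion; 69 is 1
    + 4 + 64. *)
Lemma mgf_upper_small (mu4 : n%:R / 4 ^+ M <= 4 :> R) (th_small : 4 * th ^+ 2 <= beta / 16 / 3) :
  tree beta g (N.+1 + M) n 0 0 <= ell beta (N.+1 + M) n *
  expR (th * (n%:R * W 0 0 0) + upper_const beta * (69 * th ^+ 2) * (rho * 2 ^+ M)).
Proof.
have t2 := sqr_ge0 th.
have b0 : 0 <= 4 * th ^+ 2 by rewrite mulr_ge0.
have c0 : 0 <= 64 * th ^+ 2 by rewrite mulr_ge0.
have Wx k x y : (k < M)%N -> W k.+1 x y <= 36 * pi * (rho * 2 ^+ k) ^+ 2.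
  move=> _; apply: (le_trans (dfrac_scale k x y)).
  have := sqr_ge0 (rho * 2 ^+ k); have := pi_gt0 R.
  move: (_ ^+ 2) => v p0 v0; rewrite ler_wpM2r// ler_pM2r//; lra.
have leaf m x y : bd z rho M x y -> tree beta g N.+1 m x y <= ell beta N.+1 m *
    expR (th * (m%:R * W M x y) + 64 * th ^+ 2 + 4 * th ^+ 2 * (m%:R - n%:R / 4 ^+ M) ^+ 2).
  move=> _; have := hoeffding m x y (addnC M N.+1) => /le_trans; apply.
  rewrite ler_pM2l ?ell_gt0//; apply: (le_trans (bernoulli_gauss _ (W01 _ _ _))).
  rewrite ler_expR -addrA lerD//; first by rewrite -mulrA.
  have mu0 : 0 <= n%:R / 4 ^+ M :> R by rewrite divr_ge0 ?exprn_ge0.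
  move: (_ / _) mu4 mu0 => mu mu4 mu0.
  rewrite exprMn -subr_ge0.
  have -> : 64 * th ^+ 2 + 4 * th ^+ 2 * (m%:R - mu) ^+ 2 - 2 * (th ^+ 2 * m%:R ^+ 2) =
    th ^+ 2 * (2 * (m%:R - 2 * mu) ^+ 2 + 4 * (16 - mu ^+ 2)) by ring.
  apply: mulr_ge0 => //; apply: addr_ge0; first by rewrite mulr_ge0// sqr_ge0.
  by apply: mulr_ge0 => //; rewrite subr_ge0; nra.
have inner t k m x y : (k + t = M)%N -> ~~ bd z rho k x y ->
    tree beta g (N.+1 + t) m x y <= ell beta (N.+1 + t) m * expR (th * (m%:R * W k x y)).
  by move=> kt kxy; apply: const_cell kxy erefl; lia.
have := @tree_root_upper R z rho rho0 ball_in beta g n M N W th _ _ beta0 g0 b0 th_small c0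
  (fun k x y _ => Wmean k x y) (fun k x y _ => W01 k x y) Wx leaf inner xM.
move=> /le_trans; apply; rewrite ler_pM2l ?ell_gt0// ler_expR lerD2l.
rewrite ler_wpM2r//; first by rewrite (le_trans ler01).
rewrite (_ : th ^+ 2 + 4 * th ^+ 2 + 64 * th ^+ 2 = 69 * th ^+ 2)//.
by ring.
Qed.

(** Coverage of a leaf rounded in the unfavourable direction: a boundary cell counts as full when th
    >= 0 and as empty when th < 0. V is the martingale with these terminal values. *)
Let chi (w : R) : R := if 0 <= th then (0 < w)%R%:R else (w == 1)%R%:R.
Let V k x y := desc (M - k) (fun a b => chi (W M a b)) x y / 4 ^+ (M - k).

Let chi01 w : 0 <= chi w <= 1.
Proof. by rewrite /chi; case: (0 <= th); [case: (0 < w)|case: (w == 1)]; rewrite /= ?ler01 ?lexx. Qed.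

Let V_le_desc f k x y (c : R) : (forall a b, chi (W M a b) <= f a b) ->
  desc (M - k) f x y <= 4 ^+ (M - k) * c -> V k x y <= c.
Proof.
move=> cf h; rewrite /V ler_pdivrMr ?exprn_gt0// [leRHS]mulrC; apply: le_trans h.
exact: desc_le.
Qed.

Lemma desc_cst t (c : R) x y : desc t (fun _ _ => c) x y = 4 ^+ t * c.
Proof. by elim: t x y => [|t IH] x y /=; rewrite ?expr0 ?mul1r// !IH exprS; ring. Qed.

(** With rounded terminal values the leaf estimate has no error term, whatever the size of th. The
    price is the shift of the root value, since V and W differ on the boundary cells only: O(rho
    2^M) cells out of 4^M, holding n / 4^M points each on average. *)
Lemma mgf_upper_large : tree beta g (N.+1 + M) n 0 0 <= ell beta (N.+1 + M) n *
  expR (th * (n%:R * W 0 0 0) + upper_const beta * th ^+ 2 * (rho * 2 ^+ M) +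
    `|th| * (n%:R / 4 ^+ M) * (32 * pi) * (rho * 2 ^+ M)).
Proof.
have q0 t : 0 < 4 ^+ t :> R by rewrite exprn_gt0.
have pi0 := pi_gt0 R.
have VM a b : V M a b = chi (W M a b) by rewrite /V subnn /= expr0 divr1.
have Vmean k x y : (k < M)%N -> V k x y =
  (V k.+1 x.*2 y.*2 + V k.+1 x.*2 y.*2.+1 + V k.+1 x.*2.+1 y.*2 +
   V k.+1 x.*2.+1 y.*2.+1) / 4.
  move=> kM; rewrite /V -(subnSK kM) /= exprS; field.
  by rewrite gt_eqF.
have V01 k x y : (k <= M)%N -> 0 <= V k x y <= 1.
  move=> kM; apply/andP; split.
    by rewrite /V divr_ge0 ?(ltW (q0 _))// desc_ge0// => a b; case/andP: (chi01 (W M a b)).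
  apply: (@V_le_desc (fun _ _ => 1)); last by rewrite desc_cst.
  by move=> a b; case/andP: (chi01 (W M a b)).
(* Every level-M cell counted as full lies in the disc of this radius, at most 3 rho; hence the
   constant 36 = 4 * 3^2. *)
pose r := rho + 2 / 2 ^+ M.
have r0 : 0 < r by rewrite addr_gt0// divr_gt0// exprn_gt0.
have r3 : r <= 3 * rho.
  suff : 2 / 2 ^+ M <= 2 * rho by rewrite /r; lra.
  by rewrite ler_pM2l// -[X in X <= _]mul1r ler_pdivrMr// exprn_gt0.
have Vx k x y : (k < M)%N -> V k.+1 x y <= 36 * pi * (rho * 2 ^+ k) ^+ 2.
  move=> kM; pose P := cfrac (eball z r).
  have Pm : child_mean P by apply: frac_child_mean; exact: measurable_eball.
  have Pr k' a b : P k' a b <= 4 ^+ k' * (pi * r ^+ 2) by exact: frac_eball_le.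
  apply: (@le_trans _ _ (P k.+1 x y)).
    apply: (@V_le_desc (P M)); last first.
      by have := desc_mean k.+1 (M - k.+1) x y Pm; rewrite subnKC// => ->.
    move=> a b; rewrite /chi.
    have P0 : 0 <= P M a b by exact: frac_ge0.
    have [_|_] := leP 0 th.
      have [w0|//] := ltP 0 (W M a b).
      by rewrite /P frac_plus.
    case: eqP => // w1; rewrite /P frac_plus// -/(W M a b) w1 //.
  apply: (le_trans (Pr _ _ _)).
  have -> : 4 ^+ k.+1 * (pi * r ^+ 2) = 4 * (4 ^+ k * pi) * r ^+ 2 by rewrite exprS; ring.
  have -> : 36 * pi * (rho * 2 ^+ k) ^+ 2 = 4 * (4 ^+ k * pi) * (3 * rho) ^+ 2.
    have -> : 4 ^+ k = 2 ^+ k * 2 ^+ k :> R by rewrite -exprMn -natrM.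
    by ring.
  apply: ler_wpM2l; first by apply: mulr_ge0 => //; apply: mulr_ge0; exact: ltW.
  by rewrite lerXn2r ?nnegrE ?(ltW r0)// mulr_ge0// ltW.
have leaf m x y : bd z rho M x y -> tree beta g N.+1 m x y <= ell beta N.+1 m *
    expR (th * (m%:R * V M x y) + 0 + 0 * (m%:R - n%:R / 4 ^+ M) ^+ 2).
  move=> /andP[w0 w1]; have := hoeffding m x y (addnC M N.+1) => /le_trans; apply.
  rewrite ler_pM2l ?ell_gt0// mul0r !addr0 VM /chi w0 (lt_eqF w1).
  have [t0|t0] := leP 0 th; rewrite /= ?mulr1 ?mulr0 ?expR0.
    have : 1 <= expR (th * m%:R) by rewrite -expR0 ler_expR mulr_ge0.
    move: (expR _) (W M x y) w0 w1 => e w w0 w1 e1; nra.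
  have : expR (th * m%:R) <= 1 by rewrite -expR0 ler_expR nmulr_rle0.
  move: (expR _) (W M x y) w0 w1 => e w w0 w1 e1; nra.
have inner t k m x y : (k + t = M)%N -> ~~ bd z rho k x y ->
    tree beta g (N.+1 + t) m x y <= ell beta (N.+1 + t) m * expR (th * (m%:R * V k x y)).
  move=> kt kxy; have -> : V k x y = W k x y; last by apply: const_cell kxy erefl; lia.
  have w := dfrac_not_bd kxy.
  have -> : V k x y = chi (W k x y).
    rewrite /V -kt addKn (@dfrac_prop _ z rho chi k t x y w) mulrC mulKf//.
  case: w => ->; rewrite /chi; case: (0 <= th) => /=; rewrite ?ltxx ?ltr01 ?eqxx//.
  by rewrite eq_sym oner_eq0.
have bM1 : 0 <= beta / 16 / 3 by rewrite !divr_ge0// ltW.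
have := @tree_root_upper R z rho rho0 ball_in beta g n M N V th 0 0 beta0 g0 (lexx _)
  bM1 (lexx _) Vmean V01 Vx leaf inner xM.
move=> /le_trans; apply; rewrite ler_pM2l ?ell_gt0// ler_expR !addr0.
rewrite [leRHS]addrAC lerD2r.
suff h : `|V 0 0 0 - W 0 0 0| <= 32 * pi * (rho * 2 ^+ M) / 4 ^+ M.
  rewrite -lerBlDl -!mulrBr; apply: (le_trans (ler_norm _)).
  rewrite !normrM [`|n%:R|]ger0_norm//.
  apply: (le_trans (ler_wpM2l (normr_ge0 _) (ler_wpM2l (ler0n R n) h))).
  by rewrite le_eqVlt; apply/orP; left; apply/eqP; ring.
have W0 : W 0 0 0 = desc M (W M) 0 0 / 4 ^+ M.
  by have := desc_mean 0 M 0 0 Wmean; rewrite add0n => ->; rewrite mulrC mulKf// gt_eqF.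
rewrite W0 /V subn0 -mulrBl normrM [`|_^-1|]gtr0_norm ?invr_gt0//.
rewrite ler_wpM2r ?invr_ge0 ?(ltW (q0 _))//.
have cW a b : `|chi (W M a b) - W M a b| <= (bd z rho M a b)%:R.
  have /andP[w0 w1] := W01 M a b; have [h|/dfrac_not_bd] := boolP (bd z rho M a b).
    have /andP[c0 c1] := chi01 (W M a b).
    move: (W M a b) (chi _) c0 c1 w0 w1 => w c c0 c1 w0 w1.
    by rewrite /= ler_norml; apply/andP; split; lra.
  rewrite /chi => -[->|->]; case: (0 <= th); rewrite ?ltxx ?ltr01 ?eqxx /= ?subrr ?normr0//.
  by rewrite eq_sym oner_eq0 /= subrr normr0.
have D f f' : desc M f 0 0 - desc M f' 0 0 = desc M (fun a b => f a b + (-1) * f' a b) 0 0.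
  by rewrite descD descZ mulN1r.
apply: (@le_trans _ _ (desc M (fun a b => (bd z rho M a b)%:R) 0 0)).
  rewrite ler_norml; apply/andP; split.
    rewrite lerNl opprB D; apply: desc_le => a b.
    by rewrite mulN1r; apply: le_trans (cW a b); rewrite distrC ler_norm.
  rewrite D; apply: desc_le => a b.
  by rewrite mulN1r; apply: le_trans (ler_norm _) (cW a b).
apply: (le_trans (bd_count rho0 ball_in M)).
rewrite mulrDr mulr1.
have -> : 32 * pi * (rho * 2 ^+ M) = 16 * pi * (rho * 2 ^+ M) + 16 * pi * (rho * 2 ^+ M) by ring.
by rewrite lerD2r ler_peMr// mulr_ge0// ltW.
Qed.

End mgf_upper.

(** * Cells that the circle cuts unevenly *)

Section good_cells.
Context {R : realType}.
Variables (z : R * R) (rho : R).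
Hypotheses (rho0 : 0 < rho) (ball_in : eball z rho `<=` cell 0 0 0).
Local Notation W := (dfrac z rho).
Local Notation plane := (measurableTypeR R * measurableTypeR R)%type.

Lemma corner_in k x y : 0 <= x%:R / 2 ^+ k - z.1 -> 0 <= y%:R / 2 ^+ k - z.2 ->
  (x.+1%:R / 2 ^+ k - z.1) ^+ 2 + (y.+1%:R / 2 ^+ k - z.2) ^+ 2 <= rho ^+ 2 ->
  W k x y = 1.
Proof.
move=> x0 y0 h; apply: frac_full => p; rewrite (eballE _ (ltW rho0)) /cell /= !in_itv /=.
move=> [/andP[p1 p1'] /andP[p2 p2']]; apply: le_trans h.
by apply: lerD; rewrite lerXn2r ?nnegrE//; lra.
Qed.

Lemma corner_out k x y : 0 <= x%:R / 2 ^+ k - z.1 -> 0 <= y%:R / 2 ^+ k - z.2 ->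
  rho ^+ 2 < (x%:R / 2 ^+ k - z.1) ^+ 2 + (y%:R / 2 ^+ k - z.2) ^+ 2 ->
  W k x y = 0.
Proof.
move=> x0 y0 h; apply: frac_empty; apply/seteqP; split=> // p [].
rewrite (eballE _ (ltW rho0)) /cell /= !in_itv /=.
move=> hp [/andP[p1 p1'] /andP[p2 p2']]; move: h; rewrite ltNge => /negP; apply.
apply: le_trans hp; by apply: lerD; rewrite lerXn2r ?nnegrE//; lra.
Qed.

Definition good M x y := [|| W M x y + 16^-1 <= W M.+1 x.*2 y.*2,
  W M x y + 16^-1 <= W M.+1 x.*2 y.*2.+1, W M x y + 16^-1 <= W M.+1 x.*2.+1 y.*2 |
  W M x y + 16^-1 <= W M.+1 x.*2.+1 y.*2.+1].

(** If no entry reached w + 1/16, then d would be below w - 3/16 and the mean below w. *)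
Lemma good_spread (w a b c d : R) : w = (a + b + c + d) / 4 -> d + 4^-1 <= a ->
  [|| w + 16^-1 <= a, w + 16^-1 <= b, w + 16^-1 <= c | w + 16^-1 <= d].
Proof.
move=> mw ad; apply/negP => /negP; rewrite !negb_or -!ltNge => /and4P[h1 h2 h3 h4]; lra.
Qed.

Lemma mean_quarter (w a b c d : R) : w = (a + b + c + d) / 4 ->
  0 <= b <= 1 -> 0 <= c <= 1 -> (a = 1 -> 0 <= d <= 1 -> 4^-1 <= w) /\
  (d = 0 -> 0 <= a <= 1 -> w <= 3 / 4).
Proof. by move=> -> b01 c01; split=> [->|->] d01; lra. Qed.

Lemma quarter_gap (a d : R) : 4^-1 <= a -> d <= 3 / 4 -> a = 1 \/ d = 0 -> d + 4^-1 <= a.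
Proof. by move=> a4 d4 [ad|ad]; lra. Qed.

(** The cell lies to the upper right of the centre and the circle crosses its diagonal between the
    points at 1/4 and 3/4. The lower left child then contains a full grandchild and the upper right
    one an empty grandchild; according to the side of the circle on which the midpoint lies, the
    former is full or the latter empty. Their coverages differ by at least 1/4, and [good_spread]
    applies. *)
Lemma good_cell M i j (s := (2 ^+ M)^-1) (a := i%:R * s - z.1) (b := j%:R * s - z.2) :
  0 <= a -> 0 <= b -> (a + s / 4) ^+ 2 + (b + s / 4) ^+ 2 <= rho ^+ 2 ->
  rho ^+ 2 < (a + 3 / 4 * s) ^+ 2 + (b + 3 / 4 * s) ^+ 2 -> good M i j.
Proof.
move=> a0 b0 inA outB.
have p0 : 0 < 2 ^+ M :> R by rewrite exprn_gt0.
have s0 : 0 < s by rewrite invr_gt0.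
have mean : child_mean W by exact: dfrac_mean.
have W01 k x y : 0 <= W k x y <= 1 by exact: dfrac01.
apply: (good_spread (mean M i j)).
have E1 c v : c%:R / 2 ^+ M.+1 - v = c%:R / 2 * s - v by rewrite exprS /s invfM mulrA.
have E2 c v : c%:R / 2 ^+ M.+2 - v = c%:R / 4 * s - v.
  by rewrite !exprS /s mulrA invfM mulrA -natrM.
have D2 c : c.*2%:R = 2 * c%:R :> R by rewrite -muln2 natrM mulrC.
have D21 c : c.*2.+1%:R = 2 * c%:R + 1 :> R by rewrite -natr1 D2.
have D22 c : c.*2.+2%:R = 2 * c%:R + 2 :> R by rewrite -natr1 D21; ring.
have LL4 : W M.+2 i.*2.*2 j.*2.*2 = 1.
  apply: corner_in; rewrite !E2 ?D21 ?D2.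
  - by rewrite (_ : _ - _ = a)// /a; field.
  - by rewrite (_ : _ - _ = b)// /b; field.
  apply: le_trans inA; rewrite le_eqVlt; apply/orP; left; apply/eqP.
  by rewrite /a /b; field.
have UR4 : W M.+2 i.*2.+1.*2.+1 j.*2.+1.*2.+1 = 0.
  apply: corner_out; rewrite !E2 !D21.
  - rewrite (_ : _ - _ = a + 3 / 4 * s); last by rewrite /a; field.
    by rewrite addr_ge0// mulr_ge0// ltW.
  - rewrite (_ : _ - _ = b + 3 / 4 * s); last by rewrite /b; field.
    by rewrite addr_ge0// mulr_ge0// ltW.
  apply: (lt_le_trans outB); rewrite le_eqVlt; apply/orP; left; apply/eqP.
  by rewrite /a /b; field.
have [LLge _] := mean_quarter (mean M.+1 i.*2 j.*2) (W01 _ _ _) (W01 _ _ _).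
have [_ URle] := mean_quarter (mean M.+1 i.*2.+1 j.*2.+1) (W01 _ _ _) (W01 _ _ _).
apply: quarter_gap; [exact: LLge|exact: URle|].
have a2 : 0 <= a + s / 2 by rewrite addr_ge0// divr_ge0// ltW.
have b2 : 0 <= b + s / 2 by rewrite addr_ge0// divr_ge0// ltW.
have [inC|outC] := leP ((a + s / 2) ^+ 2 + (b + s / 2) ^+ 2) (rho ^+ 2).
  left; apply: corner_in; rewrite !E1 ?D21 ?D2.
  - by rewrite (_ : _ - _ = a)// /a; field.
  - by rewrite (_ : _ - _ = b)// /b; field.
  apply: le_trans inC; rewrite le_eqVlt; apply/orP; left; apply/eqP.
  by rewrite /a /b; field.
right; apply: corner_out; rewrite !E1 !D21.
- by rewrite (_ : _ - _ = a + s / 2)// /a; field.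
- by rewrite (_ : _ - _ = b + s / 2)// /b; field.
apply: (lt_le_trans outC); rewrite le_eqVlt; apply/orP; left; apply/eqP.
by rewrite /a /b; field.
Qed.

Lemma eball_center : [/\ 0 <= z.1, z.1 < 1, 0 <= z.2 & z.2 < 1].
Proof.
have : cell (R := R) 0 0 0 z.
  by apply: ball_in; rewrite (eballE _ (ltW rho0)) /= !subrr expr0n addr0 sqr_ge0.
by rewrite /cell /= !in_itv /= !expr0 !divr1 => -[/andP[? ?] /andP[? ?]].
Qed.

                                                                           
                                                          
(** Over abscissas between 3/4 rho and 17/20 rho the arc has height h <= A, so moving by s/2 to the
    right and s/2 down leaves the disc. The cell whose point at 1/4 of the diagonal is the last one
    under the arc therefore has its 3/4 point outside. *)
Lemma good_column M i (a := i%:R / 2 ^+ M - z.1) : 20 <= rho * 2 ^+ M ->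
  3 / 4 * rho <= a -> a <= 17 / 20 * rho ->
  (i < 2 ^ M)%N /\ exists2 j, (j < 2 ^ M)%N & good M i j.
Proof.
move=> xM a1 a2; have p0 : 0 < 2 ^+ M :> R by rewrite exprn_gt0.
pose s : R := (2 ^+ M)^-1; have s0 : 0 < s by rewrite invr_gt0.
have s20 : 20 * s <= rho by rewrite /s ler_pdivrMr.
have [z1 _ z2 _] := eball_center.
pose A := a + s / 4.
have A0 : 0 <= A by rewrite /A; lra.
have AR : A <= 9 / 10 * rho by rewrite /A; lra.
have A3 : 3 / 4 * rho <= A by rewrite /A; lra.
pose h := Num.sqrt (rho ^+ 2 - A ^+ 2).
have rA : 0 <= rho ^+ 2 - A ^+ 2 by nra.
have h0 : 0 <= h by exact: sqrtr_ge0.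
have hE : h ^+ 2 = rho ^+ 2 - A ^+ 2 by rewrite sqr_sqrtr.
have h3 : 2 / 5 * rho <= h by have : 9 / 50 * rho ^+ 2 <= h ^+ 2; [rewrite hE; nra|nra].
have hA : h <= A by have : h ^+ 2 <= A ^+ 2; [rewrite hE; nra|nra].
(* Its integer part is the row of the last quarter point below the circle at abscissa A. *)
pose v := (z.2 + h - s / 4) / s; have v0 : 0 <= v by rewrite divr_ge0 ?(ltW s0)//; lra.
pose j := Num.trunc v.
have /andP[j1 j2] : j%:R <= v < j.+1%:R by exact: truncn_itv.
pose b := j%:R * s - z.2.
have b1 : b + s / 4 <= h.
  by have := j1; rewrite /v ler_pdivlMr// /b; lra.
have b2 : h < b + s + s / 4.
  have e : j.+1%:R = j%:R + 1 :> R by rewrite natr1.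
  by have := j2; rewrite /v ltr_pdivrMr// e mulrDl mul1r /b; lra.
have b0 : 0 <= b by lra.
have inA : (a + s / 4) ^+ 2 + (b + s / 4) ^+ 2 <= rho ^+ 2.
  by rewrite -/A; have : (b + s / 4) ^+ 2 <= h ^+ 2; [nra|rewrite hE; lra].
have inB : rho ^+ 2 < (a + 3 / 4 * s) ^+ 2 + (b + 3 / 4 * s) ^+ 2.
  have -> : a + 3 / 4 * s = A + s / 2 by rewrite /A; field.
  have : (h - s / 2) ^+ 2 < (b + 3 / 4 * s) ^+ 2 by nra.
  have -> : (h - s / 2) ^+ 2 = rho ^+ 2 - A ^+ 2 - s * h + s ^+ 2 / 4 by rewrite -hE; field.
  have : s * h <= s * A by rewrite ler_pM2l.
  have := sqr_ge0 s; nra.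
have C : cell (R := R) 0 0 0 (z.1 + A, z.2 + (b + s / 4)).
  apply: ball_in; rewrite (eballE _ (ltW rho0)) /= [z.1 + _]addrC addrK.
  by rewrite [z.2 + _]addrC addrK.
move: C; rewrite /cell /= !in_itv /= expr0 !divr1 => -[/andP[_ c1] /andP[_ c2]].
have lt2 c : c%:R * s < 1 -> (c < 2 ^ M)%N.
  by rewrite /s ltr_pdivrMr// mul1r -natrX ltr_nat.
split; first by apply: lt2; move: c1; rewrite /A /a -/s; lra.
exists j; first by apply: lt2; move: c2; rewrite /b; lra.
have a0 : 0 <= a by lra.
exact: good_cell.
Qed.

(** One good cell per column in a range of width rho / 10; half of that count absorbs the
    rounding. *)
Lemma good_count M : 20 <= rho * 2 ^+ M ->
  rho * 2 ^+ M / 20 <= desc M (fun a b => (good M a b)%:R) 0 0.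
Proof.
move=> xM; rewrite desc_root; set x := rho * 2 ^+ M in xM *.
have p0 : 0 < 2 ^+ M :> R by rewrite exprn_gt0.
have [z1 _ z2 _] := eball_center.
pose lo := (z.1 + 3 / 4 * rho) * 2 ^+ M.
have lo0 : 0 <= lo by rewrite mulr_ge0 ?(ltW p0)// addr_ge0// mulr_ge0// ltW.
pose a0 := (Num.trunc lo).+1; pose c := Num.trunc (x / 10).
have /andP[l1 l2] : (Num.trunc lo)%:R <= lo < a0%:R by exact: truncn_itv.
have /andP[c1 c2] : c%:R <= x / 10 < c.+1%:R by apply: truncn_itv; lra.
have colE l : (l < c)%N -> (a0 + l < 2 ^ M)%N /\ exists2 j, (j < 2 ^ M)%N & good M (a0 + l) j.
  move=> lc; have lc' : l%:R + 1 <= c%:R :> R by rewrite natr1 ler_nat.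
  apply: good_column => //.
    rewrite lerBrDr ler_pdivlMr// [_ + z.1]addrC -/lo natrD.
    by rewrite (le_trans (ltW l2))// lerDl.
  rewrite lerBlDr ler_pdivrMr// natrD.
  have -> : (17 / 20 * rho + z.1) * 2 ^+ M = lo + x / 10 by rewrite /lo /x; field.
  by have : a0%:R <= lo + 1; [rewrite /a0 -natr1; lra|lra].
pose F a : R := \sum_(b < 2 ^ M) (good M a b)%:R.
have F0 a : 0 <= F a by apply: sumr_ge0.
have F1 a : (exists2 j, (j < 2 ^ M)%N & good M a j) -> 1 <= F a.
  move=> [j jM gj]; rewrite /F (bigD1 (Ordinal jM))//= gj lerDl.
  by apply: sumr_ge0.
have cge1 : (0 < c)%N by rewrite lt0n; apply/eqP => c0; move: c2; rewrite c0; lra.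
apply: (@le_trans _ _ c%:R).
  have : 1 <= c%:R :> R by rewrite ler1n.
  have e : c.+1%:R = c%:R + 1 :> R by rewrite natr1.
  by rewrite e in c2; lra.
have c0 : (a0 + c <= 2 ^ M)%N.
  have : (c.-1 < c)%N by rewrite prednK.
  by move=> /colE[h _]; rewrite -[X in (_ + X <= _)%N](prednK cge1) addnS.
rewrite -/(F _) -(big_mkord xpredT F) (big_cat_nat _ (n := a0))//=; last exact: leq_trans (leq_addr _ _) c0.
rewrite [X in _ + X](big_cat_nat _ (n := (a0 + c)%N))//=; last exact: leq_addr.
rewrite addrCA -[leLHS]addr0; apply: lerD; last by rewrite addr_ge0// sumr_ge0.
rewrite -{1}[a0]add0n big_addn addKn big_mkord.
have -> : c%:R = \sum_(l < c) 1 :> R by rewrite sumr_const card_ord.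
by apply: ler_sum => l _; rewrite addnC; apply: F1; have [] := colE l (ltn_ord l).
Qed.

End good_cells.

Lemma expR_half_le {R : realType} (t : R) : 0 <= t -> t <= 1 -> expR (t / 2) <= 1 + t.
Proof.
by move=> t0 t1; have h := @expR_le_quadratic R (t / 2) ltac:(lra); nra.
Qed.

(** * Lower bounds for the exponential moment *)

Section mgf_lower.
Context {R : realType}.
Variables (beta : R) (z : R * R) (rho : R) (n M N : nat) (th : R).
Hypotheses (beta0 : 0 < beta) (rho0 : 0 < rho) (ball_in : eball z rho `<=` cell 0 0 0).
Hypothesis th0 : 0 <= th.
Local Notation W := (dfrac z rho).
Local Notation g := (mgf_leaf (N.+1 + M) W th).
Local Notation var := (quad_var_const beta).

Let W01 : forall k x y, 0 <= W k x y <= 1.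
Proof. exact: dfrac01. Qed.

Let Wmean : child_mean W.
Proof. exact: dfrac_mean. Qed.

Let g0 a b : 0 <= g a b.
Proof. exact/ltW/mgf_leaf_gt0. Qed.

(** [tree_lower] at the root, where the count is n itself and the linear and quadratic terms
    vanish. *)
Lemma mgf_lower_leaf (ind : nat -> nat -> bool) (h0 h1 h2 : R) : 0 <= h2 ->
  (forall m x y, ind x y -> ell beta N.+1 m * expR (th * (m%:R * W M x y) +
    (h0 + h1 * (m%:R - n%:R / 4 ^+ M) - h2 * (m%:R - n%:R / 4 ^+ M) ^+ 2)) <=
    tree beta g N.+1 m x y) ->
  ell beta (N.+1 + M) n * expR (th * (n%:R * W 0 0 0) +
    desc M (fun a b => (ind a b)%:R) 0 0 * (h0 - 2 * h2 * var)) <=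
  tree beta g (N.+1 + M) n 0 0.
Proof.
move=> h20 leaf; pose mu k : R := n%:R / 4 ^+ k.
have mu4 k : mu k = 4 * mu k.+1 by rewrite /mu exprS; field; rewrite gt_eqF// exprn_gt0.
have leaf' m x y : ell beta N.+1 m * expR (th * (m%:R * W M x y) + (ind x y)%:R *
    (h0 + h1 * (m%:R - mu M) - h2 * (m%:R - mu M) ^+ 2)) <= tree beta g N.+1 m x y.
  case: (boolP (ind x y)) => i; first by rewrite mul1r; exact: leaf.
  by rewrite mul0r addr0; apply: jensen_tree => //; rewrite addnC.
have i0 x y : 0 <= (ind x y)%:R :> R by [].
have := @tree_lower R beta beta0 g M N W (fun x y => (ind x y)%:R) th h0 h1 h2 mu
  Wmean i0 mu4 h20 leaf' M 0 n 0 0 (add0n M).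
apply: le_trans; rewrite ler_pM2l ?ell_gt0// ler_expR lerD2l ler_wpM2l//.
  by rewrite desc_ge0.
rewrite /mu expr0 divr1 subrr expr0n /= !mulr0 subr0 addr0 lerD2l lerN2.
apply: ler_piMr; last by rewrite lerBlDr lerDl exprn_ge0// invr_ge0.
by apply: mulr_ge0; [exact: mulr_ge0|exact/ltW/quad_var_const_gt0].
Qed.

Lemma goodP x y : good z rho M x y -> exists x' y' : nat,
  [/\ x' \in [:: x.*2; x.*2.+1], y' \in [:: y.*2; y.*2.+1] &
      W M x y + 16^-1 <= W M.+1 x' y'].
Proof.
by case/or4P => h; [exists x.*2, y.*2|exists x.*2, y.*2.+1|exists x.*2.+1, y.*2|
  exists x.*2.+1, y.*2.+1]; rewrite !inE !eqxx ?orbT.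
Qed.

(** In each good cell all m points are sent to a richer child: the gain th m / 16 minus the price J
    m^2 of [allin_ge] is expanded around mu. *)
Lemma mgf_lower_good (J := beta + ln 4) (mu := n%:R / 4 ^+ M) :
  ell beta (N.+1 + M) n * expR (th * (n%:R * W 0 0 0) +
    desc M (fun a b => (good z rho M a b)%:R) 0 0 *
    (th * mu / 16 - J * mu ^+ 2 - 2 * J * var)) <=
  tree beta g (N.+1 + M) n 0 0.
Proof.
have J0 : 0 <= J by rewrite addr_ge0 ?ln_ge0 ?ler1n// ltW.
apply: (@mgf_lower_leaf _ (th * mu / 16 - J * mu ^+ 2) (th / 16 - 2 * J * mu)) => //.
move=> m x y /goodP[x' [y' [xx yy gain]]]; rewrite -/mu.
have h := tree_child_ge beta0 N m g0 xx yy.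
have := @jensen_tree R beta beta0 (N.+1 + M) W th Wmean W01 N M.+1 m x' y' ltac:(lia).
move=> hj; rewrite -(ler_pM2l (ell_gt0 beta0 N m)); apply: le_trans h.
apply: le_trans (ler_wpM2l _ hj); last first.
  by rewrite mulr_ge0// ltW ?allin_gt0 ?ell_gt0.
rewrite [leRHS](_ : _ = ell beta N m * (ell beta N.+1 m * (allin beta m * expR (th * (m%:R * W M.+1 x' y')))));
  last by ring.
rewrite ler_pM2l ?ell_gt0// ler_pM2l ?ell_gt0//.
apply: (@le_trans _ _ (expR (- (J * m%:R ^+ 2)) * expR (th * (m%:R * W M.+1 x' y')))); last first.
  by rewrite ler_wpM2r ?expR_ge0// allin_ge.
rewrite -expRD ler_expR.
have tm : 0 <= th * m%:R by rewrite mulr_ge0.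
have := ler_wpM2l tm gain; move: (W M.+1 _ _) (W M _ _) => w' w.
rewrite -subr_ge0 => hg; rewrite -subr_ge0.
by apply: le_trans hg _; rewrite le_eqVlt; apply/orP; left; apply/eqP; field.
Qed.

(** A single level-M cell, much larger than the disc, is used: all its points descend j levels into
    a cell inside the disc, at price J m^2. *)
Lemma mgf_lower_chain j x y (J := j%:R * (beta + ln 4)) (mu := n%:R / 4 ^+ M) :
  (j <= N.+1)%N -> (x < 2 ^ (M + j))%N -> (y < 2 ^ (M + j))%N ->
  W (M + j) x y = 1 -> rho * 2 ^+ M <= 4^-1 ->
  0 <= th * mu / 16 - J * mu ^+ 2 - 2 * J * var ->
  ell beta (N.+1 + M) n * expR (th * (n%:R * W 0 0 0) +
    (th * mu / 16 - J * mu ^+ 2 - 2 * J * var)) <=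
  tree beta g (N.+1 + M) n 0 0.
Proof.
move=> jN xM yM W1 small pos.
have J0 : 0 <= J by rewrite mulr_ge0// addr_ge0 ?ln_ge0 ?ler1n// ltW.
pose X := (x %/ 2 ^ j)%N; pose Y := (y %/ 2 ^ j)%N.
pose ind a b := (a == X) && (b == Y).
apply: (@le_trans _ _ (ell beta (N.+1 + M) n * expR (th * (n%:R * W 0 0 0) +
    desc M (fun a b => (ind a b)%:R) 0 0 * (th * mu / 16 - J * mu ^+ 2 - 2 * J * var)))).
  rewrite ler_pM2l ?ell_gt0// ler_expR lerD2l ler_peMl//.
  have XM : (X < 2 ^ M)%N by rewrite /X ltn_divLR ?expn_gt0// -expnD.
  have YM : (Y < 2 ^ M)%N by rewrite /Y ltn_divLR ?expn_gt0// -expnD.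
  rewrite desc_root (bigD1 (Ordinal XM))//= (bigD1 (Ordinal YM))//=.
  rewrite /ind !eqxx /= -addrA lerDl addr_ge0// !sumr_ge0// => i _; exact: sumr_ge0.
apply: (@mgf_lower_leaf _ (th * mu / 16 - J * mu ^+ 2) (th / 16 - 2 * J * mu)) => //.
move=> m a b /andP[/eqP -> /eqP ->]; rewrite -/mu.
have := @tree_chain R beta beta0 (N.+1 + M) W th Wmean W01 th0 (N.+1 - j) (M + j) j m x y
  ltac:(lia) W1.
rewrite subnKC//; apply: le_trans; rewrite ler_pM2l ?ell_gt0//.
apply: (@le_trans _ _ (expR (- (J * m%:R ^+ 2)) * expR (th * m%:R))); last first.
  rewrite ler_wpM2r ?expR_ge0//.
  have -> : - (J * m%:R ^+ 2) = (- ((beta + ln 4) * m%:R ^+ 2)) * j%:R by rewrite /J; ring.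
  by rewrite expRM_natr lerXn2r ?nnegrE ?expR_ge0 ?(ltW (allin_gt0 _ _))// allin_ge.
rewrite -expRD ler_expR.
(* A cruder bound than the computation gives, chosen to produce the same gain th m / 16 as for good
   cells. *)
have w16 : W M X Y <= 15 / 16.
  apply: (le_trans (frac_eball_le _ _ _ _ rho0)).
  have -> : 4 ^+ M * (pi * rho ^+ 2) = pi * (rho * 2 ^+ M) ^+ 2.
    have -> : 4 ^+ M = 2 ^+ M * 2 ^+ M :> R by rewrite -exprMn -natrM.
    by ring.
  have x0 : 0 <= rho * 2 ^+ M by rewrite mulr_ge0 ?exprn_ge0// ltW.
  have : (rho * 2 ^+ M) ^+ 2 <= 16^-1.
    have -> : 16^-1 = 4^-1 ^+ 2 :> R by field.
    by rewrite lerXn2r// nnegrE.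
  have pi4 : pi <= 4 :> R by have := pihalf_lt2 R; rewrite ltr_pdivrMr// => /ltW; lra.
  move=> v16; apply: (le_trans (ler_wpM2r (sqr_ge0 _) pi4)).
  by apply: (le_trans (ler_wpM2l _ v16)) => //; lra.
have tm : 0 <= th * m%:R by rewrite mulr_ge0.
have := ler_wpM2l tm w16; move: (W M X Y) => w hg.
rewrite -subr_ge0 in hg; rewrite -subr_ge0.
by apply: le_trans hg _; rewrite le_eqVlt; apply/orP; left; apply/eqP; field.
Qed.

(** For 1 <= m <= 2 mu, [tree_gain] yields a factor of at least 1 + tau. To fit the recursion this
    gain is replaced by the parabola (tau/2) m (2 mu - m) / mu^2, which is zero at 0 and 2 mu,
    negative beyond, and at most tau/2; [4 * var <= mu ^+ 2] keeps half of it after averaging. *)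
Lemma mgf_lower_variance (mu := n%:R / 4 ^+ M)
    (tau := expR (- ((beta + ln 4) * (2 * mu) ^+ 2)) * (th / 32) ^+ 2) :
  th <= 1 -> 0 < mu -> 4 * var <= mu ^+ 2 ->
  ell beta (N.+1 + M) n * expR (th * (n%:R * W 0 0 0) +
    desc M (fun a b => (good z rho M a b)%:R) 0 0 * (tau / 4)) <=
  tree beta g (N.+1 + M) n 0 0.
Proof.
move=> th1 mu0 muvar.
have tau0 : 0 <= tau by apply: mulr_ge0; [exact: expR_ge0|exact: sqr_ge0].
have J0 : 0 <= beta + ln 4 by rewrite addr_ge0 ?ln_ge0 ?ler1n// ltW.
have tau1 : tau <= 1.
  have e1 : expR (- ((beta + ln 4) * (2 * mu) ^+ 2)) <= 1.
    by rewrite -[leRHS]expR0 ler_expR oppr_le0; exact: mulr_ge0 J0 (sqr_ge0 _).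
  rewrite /tau -[leRHS]mulr1; apply: ler_pM; [exact: expR_ge0|exact: sqr_ge0|exact: e1|].
  by rewrite exprn_ile1 ?divr_ge0//; lra.
apply: (@le_trans _ _ (ell beta (N.+1 + M) n * expR (th * (n%:R * W 0 0 0) +
  desc M (fun a b => (good z rho M a b)%:R) 0 0 *
   (tau / 2 - 2 * (tau / (2 * mu ^+ 2)) * var)))).
  rewrite ler_pM2l ?ell_gt0// ler_expR lerD2l ler_wpM2l ?desc_ge0//.
  have -> : 2 * (tau / (2 * mu ^+ 2)) * var = tau * (var / mu ^+ 2).
    by field; rewrite gt_eqF.
  have : var / mu ^+ 2 <= 4^-1 by rewrite ler_pdivrMr ?exprn_gt0//; lra.
  by move: (var / _) => v v4; nra.
have h2 : 0 <= tau / (2 * mu ^+ 2).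
  by apply: divr_ge0 => //; apply: mulr_ge0 => //; exact: sqr_ge0.
apply: (@mgf_lower_leaf _ (tau / 2) 0) => // m x y /goodP[x' [y' [xx yy gain]]].
rewrite -/mu mul0r addr0.
have := @tree_gain R beta beta0 (N.+1 + M) W th Wmean W01 th0 N M m x y x' y'
  (addnC M N.+1) xx yy gain.
apply: le_trans; rewrite ler_pM2l ?ell_gt0// expRD ler_pM2l ?expR_gt0//.
have -> : tau / 2 - tau / (2 * mu ^+ 2) * (m%:R - mu) ^+ 2 =
  tau / 2 * (m%:R * (2 * mu - m%:R) / mu ^+ 2) by field; rewrite gt_eqF.
set G := allin _ _ * _; have G0 : 0 <= G.
  apply: mulr_ge0; first exact/ltW/allin_gt0.
  by apply: divr_ge0 => //; exact: sqr_ge0.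
have [m0|m0] := posnP m.
  by rewrite m0 !mul0r mulr0 expR0 lerDl.
have [m2|m2] := leP (2 * mu) m%:R.
  apply: (@le_trans _ _ 1); last by rewrite lerDl.
  rewrite -[leRHS]expR0 ler_expR mulr_ge0_le0 ?divr_ge0//.
  by rewrite mulr_le0_ge0 ?invr_ge0 ?sqr_ge0// mulr_ge0_le0// subr_le0.
apply: (@le_trans _ _ (expR (tau / 2))).
  rewrite ler_expR ler_piMr ?divr_ge0// ler_pdivrMr ?exprn_gt0// mul1r -subr_ge0.
  by rewrite (_ : _ - _ = (m%:R - mu) ^+ 2) ?sqr_ge0//; ring.
apply: (le_trans (expR_half_le tau0 tau1)).
rewrite lerD2l /tau /G; apply: ler_pM; [exact: expR_ge0|exact: sqr_ge0| |].
  apply: le_trans (allin_ge beta0 m); rewrite ler_expR lerN2 ler_wpM2l//.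
  by rewrite lerXn2r ?nnegrE ?(ltW m2)// mulr_ge0// ltW.
have -> : (th * m%:R / 16) ^+ 2 / 4 = (th / 32) ^+ 2 * m%:R ^+ 2 by field.
by apply: ler_peMr; [exact: sqr_ge0|rewrite exprn_ege1// ler1n].
Qed.

End mgf_lower.

(** * Depth-free bounds for the partition function *)

Section normalization.
Context {R : realType}.
Variable beta : R.
Hypothesis beta0 : 0 < beta.
Local Notation ell := (ell beta).

Lemma ell_one d : ell d 1 = 4 ^+ d.
Proof.
elim: d => [|d IH]; first by rewrite ell0 invr1.
rewrite ellSE /repulsion bin_small// mulr0 oppr0 expR0 mul1r.
have c0 a b : convol a b 0 = a 0%N * b 0%N by rewrite /convol big_ord1.
have c1 a b : convol a b 1 = a 0%N * b 1%N + a 1%N * b 0%N.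
  by rewrite /convol !big_ord_recr big_ord0 /= add0r subn0 subnn.
by rewrite !c1 !c0 ell_m0 IH exprS; ring.
Qed.

Fixpoint ell_floor (m : nat) : R :=
  if m is m'.+1 then repulsion beta m / 4 ^+ m * ell_floor m' else 1.

Lemma ell_floor_gt0 m : 0 < ell_floor m.
Proof. by elim: m => [//|m IH] /=; rewrite !mulr_gt0 ?repulsion_gt0 ?invr_gt0 ?exprn_gt0. Qed.

Lemma convol_term (a b : nat -> R) m i : (forall n, 0 <= a n) -> (forall n, 0 <= b n) ->
  (i <= m)%N -> a i * b (m - i)%N <= convol a b m.
Proof.
move=> a0 b0 im; have im' : (i < m.+1)%N by [].
by rewrite /convol (bigD1 (Ordinal im'))//= lerDl sumr_ge0// => j _; rewrite mulr_ge0.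
Qed.

                                                                            
(** Keep only the configurations that split off one point at each level; m levels suffice, and the
    resulting bound does not depend on d, so the limit partition function is positive. *)
Lemma ell_floor_le d m : (m <= d)%N -> ell_floor m <= 4^-1 ^+ d ^+ m * ell d m.
Proof.
elim: m d => [|m IH] d md; first by rewrite expr0 mul1r ell_m0.
case: d md => // d md; rewrite /= ellSE.
have l0 n : 0 <= ell d n by exact/ltW/ell_gt0.
have c0 n : 0 <= convol (ell d) (ell d) n by apply: sumr_ge0 => i _; rewrite mulr_ge0.
have h1 := convol_term l0 l0 (leq_addr m 1); rewrite addKn ell_one in h1.
have h2 := convol_term c0 c0 (leqnn m.+1); rewrite subnn in h2.
have c1 : convol (ell d) (ell d) 0 = 1 by rewrite /convol big_ord1 ell_m0 mulr1.
rewrite c1 mulr1 in h2; rewrite add1n in h1.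
have := IH d md; move: (ell_floor m) (ell d m) h1 h2 (l0 m) => u v h1 h2 v0 h3.
rewrite mulrCA -[leLHS]mulrA; apply: ler_wpM2l; first exact: expR_ge0.
apply: le_trans (ler_wpM2l _ h2); last by rewrite !exprn_ge0// invr_ge0.
apply: le_trans (ler_wpM2l _ h1); last by rewrite !exprn_ge0// invr_ge0.
apply: (le_trans (ler_wpM2l _ h3)); first by rewrite invr_ge0 exprn_ge0.
rewrite -!exprM !exprVn le_eqVlt; apply/orP; left; apply/eqP.
have -> : (d.+1 * m.+1 = m.+1 + d * m + d)%N by lia.
by rewrite !exprD; field; rewrite !gt_eqF ?exprn_gt0.
Qed.

Lemma ell_ceil d m : 4^-1 ^+ d ^+ m * ell d m <= 1.
Proof.
elim: d => [|d IH].
  rewrite expr0 expr1n mul1r ell0 invf_le1 ?ltr0n ?fact_gt0//.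
  by rewrite ler1n fact_gt0.
apply: le_trans IH.
apply: (le_trans (ler_wpM2l _ (ell_le beta0 d m))); first by rewrite !exprn_ge0// invr_ge0.
rewrite exprS exprMn mulrCA mulrA -exprMn.
by rewrite -exprMn [X in X ^+ _]mulrA divff// mul1r.
Qed.

End normalization.

(** * Gibbs sums and exponential tilts *)

Section gas.
Context {R : realType}.
Local Notation plane := (measurableTypeR R * measurableTypeR R)%type.
Let leb2 : {sigma_finite_measure set plane -> \bar R} := @lebesgue2 R.
Variables (beta : R) (n : nat).
Hypotheses (beta0 : 0 < beta) (n2 : (2 <= n)%N).

Let lam := tuple_measure leb2 n.
Let boltz (p : n.-tuple plane) : \bar R := expeR (- (beta%:E * hier_energy p))%E.

(** Unnormalised Gibbs expectation. It is taken over all tuples because the Boltzmann factor already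
    vanishes outside the square. *)
Definition gas_sum (h : n.-tuple plane -> R) : \bar R :=
  (\int[lam]_p ((h p)%:E * boltz p))%E.

Let boltz_ge0 p : (0 <= boltz p)%E. Proof. exact: expeR_ge0. Qed.

Let gas_weight1 p : gas_weight beta (fun=> 1) p = boltz p.
Proof. by rewrite /gas_weight big1_eq mul1e. Qed.

Let measurable_boltz : measurable_fun setT boltz.
Proof.
have := @measurable_gas_weight R beta n (fun=> 1) beta0 n2 (measurable_cst _) (fun=> ler01).
by congr (measurable_fun _ _); apply/funext => p; exact: gas_weight1.
Qed.

Let boltz_restrict A : (boltz \_ (configurations n `&` A) = boltz \_ A)%E.
Proof.
have := @gas_weight_restrict R beta n (fun=> 1) beta0 n2.
move=> h; apply/funext => p.
have e : boltz p = (boltz \_ (configurations n)) p.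
  have := congr1 (fun f => f p) h; rewrite /patch gas_weight1 => ->.
  by case: ifP => // _; rewrite gas_weight1.
move: e; rewrite /patch in_setI; case: (p \in configurations n) => //= ->.
by case: ifP.
Qed.

Lemma gas_sumD (h h' : n.-tuple plane -> R) : measurable_fun setT h -> measurable_fun setT h' ->
  (forall p, 0 <= h p) -> (forall p, 0 <= h' p) ->
  gas_sum (fun p => h p + h' p) = (gas_sum h + gas_sum h')%E.
Proof.
move=> mh mh' h0 h0'; rewrite /gas_sum -ge0_integralD//.
- by apply: eq_integral => p _; rewrite EFinD ge0_muleDl ?lee_fin.
- by move=> p _; rewrite mule_ge0// lee_fin.
- by apply: emeasurable_funM => //; exact/measurable_EFinP.
- by move=> p _; rewrite mule_ge0// lee_fin.
- by apply: emeasurable_funM => //; exact/measurable_EFinP.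
Qed.

Lemma gas_sumZ c (h : n.-tuple plane -> R) : measurable_fun setT h -> (forall p, 0 <= h p) -> 0 <= c ->
  gas_sum (fun p => c * h p) = (c%:E * gas_sum h)%E.
Proof.
move=> mh h0 c0; rewrite /gas_sum -ge0_integralZl//.
- by apply: eq_integral => p _; rewrite EFinM muleA.
- by apply: emeasurable_funM => //; exact/measurable_EFinP.
- by move=> p _; rewrite mule_ge0// lee_fin.
Qed.

Lemma gas_sum_le (h h' : n.-tuple plane -> R) : measurable_fun setT h -> measurable_fun setT h' ->
  (forall p, 0 <= h p) -> (forall p, h p <= h' p) -> (gas_sum h <= gas_sum h')%E.
Proof.
move=> mh mh' h0 hh; apply: ge0_le_integral => //.
- by move=> p _; rewrite mule_ge0// lee_fin.
- by apply: emeasurable_funM => //; exact/measurable_EFinP.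
- by apply: emeasurable_funM => //; exact/measurable_EFinP.
- by move=> p _; rewrite lee_wpmul2r// lee_fin.
Qed.

Lemma partition_functionE : partition_function n beta = gas_sum (fun=> 1).
Proof.
rewrite /partition_function /gas_sum integral_mkcond.
have := boltz_restrict setT; rewrite setIT patch_setT => e.
rewrite -/boltz e; apply: eq_integral => p _; by rewrite mul1e.
Qed.

Lemma coulomb_probE A : measurable A ->
  coulomb_prob beta A = ((fine (partition_function n beta))^-1%:E * gas_sum \1_A)%E.
Proof.
move=> mA; rewrite /coulomb_prob /coulomb_density /gas_sum.
have Zi0 : 0 <= (fine (partition_function n beta))^-1.
  by rewrite invr_ge0 fine_ge0// partition_functionE integral_ge0// => p _; rewrite mul1e.
rewrite integral_mkcond -ge0_integralZl//; last 2 first.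
- apply: emeasurable_funM => //; apply/measurable_EFinP.
  exact: measurable_indic.
- by move=> p _; rewrite mule_ge0// lee_fin.
apply: eq_integral => p _.
have := congr1 (fun f => f p) (boltz_restrict A); rewrite /patch -/(boltz p) indicE.
case: ifP => _; case: ifP => _ e; rewrite ?mul1e ?mul0e ?mule0//; first by rewrite e mule0.
by rewrite -e mule0.
Qed.

Section tilt.
Variables (D : set plane) (th : R).
Hypothesis mD : measurable D.

Definition npoints (p : n.-tuple plane) : R := \sum_(x <- p) \1_D x.

Let tilt (x : plane) : R := expR (th * \1_D x).

Lemma measurable_npoints : measurable_fun setT npoints.
Proof.
rewrite (_ : npoints = fun p => \sum_(i < n) \1_D (tnth p i)).
  apply: measurable_sum => i; apply: measurableT_comp; first exact: measurable_indic.
  exact: measurable_tnth.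
by apply/funext => p; rewrite /npoints big_tuple.
Qed.

Let mtilt : measurable_fun setT tilt.
Proof.
apply: measurableT_comp => //; apply: measurable_funM => //; exact: measurable_indic.
Qed.

Let tilt_le x : tilt x <= expR `|th|.
Proof.
rewrite ler_expR (le_trans (ler_norm _))// normrM ler_piMr//.
by rewrite indicE; case: (x \in D); rewrite ?normr0 ?normr1.
Qed.

Lemma cell_integral_tilt K a b :
  cell_integral K tilt a b = 4^-1 ^+ K * mgf_leaf K (cfrac D) th a b.
Proof.
have mc := measurable_cell (R := R) K a b.
have fD := leb2_cell_fin K a b mD.
pose l : R := fine (leb2 (D `&` cell K a b)).
have lE : leb2 (D `&` cell K a b) = l%:E by rewrite fineK.
have cE : leb2 (cell K a b) = (4^-1 ^+ K)%:E by exact: lebesgue2_cell.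
have lcE : (leb2 (~` D `&` cell K a b) = (4^-1 ^+ K - l)%:E)%E.
  have h : (leb2 (cell K a b) = leb2 (cell K a b `\` D) + leb2 (cell K a b `&` D))%E.
    exact: measureDI.
  by rewrite EFinB -cE h [X in (_ + leb2 X)%E]setIC lE addeK// [~` _ `&` _]setIC -setDE.
suff -> : cell_integral K tilt a b = expR th * l + (4^-1 ^+ K - l).
  rewrite /mgf_leaf /cfrac -/leb2 -/l.
  have : 4^-1 ^+ K * 4 ^+ K = 1 :> R by rewrite -exprMn mulVf// expr1n.
  move: (4^-1 ^+ K) (4 ^+ K) => u v uv.
  by rewrite (_ : u * _ = u + (expR th - 1) * (u * v) * l); [rewrite uv|]; ring.
rewrite /cell_integral (_ : integral _ _ _ = (expR th * l + (4^-1 ^+ K - l))%:E)//.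
transitivity (\int[leb2]_(x in cell K a b)
    ((expR th)%:E * (\1_D x)%:E + (\1_(~` D) x)%:E))%E.
  apply: eq_integral => x _; rewrite /tilt !indicE in_setC.
  by case: (x \in D); rewrite /= ?mulr1 ?mulr0 ?expR0 ?mule1 ?mule0 ?adde0 ?add0e.
have m1 : measurable_fun (cell K a b) (EFin \o \1_D : plane -> \bar R).
  by apply/measurable_EFinP; exact: measurable_indic.
have m2 : measurable_fun (cell K a b) (EFin \o \1_(~` D) : plane -> \bar R).
  by apply/measurable_EFinP; apply: measurable_indic; exact: measurableC.
have m3 : measurable_fun (cell K a b) (fun x => (expR th)%:E * (\1_D x)%:E)%E.
  exact: emeasurable_funM.
rewrite (@ge0_integralD _ _ _ leb2 _ mc (fun x => (expR th)%:E * (\1_D x)%:E)%E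
  (fun x => (\1_(~` D) x)%:E) _ m3 _ m2); last 2 first.
- by move=> x _; rewrite mule_ge0 ?lee_fin ?expR_ge0.
- by move=> x _; rewrite lee_fin.
rewrite (@ge0_integralZl _ _ _ leb2 _ mc (fun x => (\1_D x)%:E)%E m1); last 2 first.
- by move=> x _; rewrite lee_fin.
- by rewrite lee_fin expR_ge0.
rewrite !integral_indic//; last exact: measurableC.
rewrite EFinD EFinM; congr (_ * _ + _)%E; [exact: lE|exact: lcE].
Qed.

Definition tilted_sum : \bar R := gas_sum (fun p => expR (th * npoints p)).

Lemma tilted_limit : (n`!%:R * (4^-1 ^+ K ^+ n * tree beta (mgf_leaf K (cfrac D) th) K n 0 0))%:E
  @[K --> \oo] --> tilted_sum.
Proof.
have := @gas_limit R beta n tilt (expR `|th|) beta0 n2 mtilt (fun x => expR_ge0 _) tilt_le.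
rewrite (_ : (\int[_]_(p in _) _)%E = tilted_sum).
  rewrite (_ : (fun K => (_ * tree _ _ _ _ _ _)%:E) = fun K =>
    (n`!%:R * (4^-1 ^+ K ^+ n * tree beta (mgf_leaf K (cfrac D) th) K n 0 0))%:E)//.
  apply/funext => K; rewrite -tree_scale; congr (_ * tree _ _ _ _ _ _)%:E.
  by apply/funext => a; apply/funext => b; rewrite cell_integral_tilt.
have e := @gas_weight_restrict R beta n tilt beta0 n2.
rewrite integral_mkcond -e; apply: eq_integral => p _.
rewrite /gas_weight -/(boltz p); congr (_%:E * _)%E.
rewrite /npoints mulr_sumr; elim: (val p) => [|x s IH]; rewrite ?big_nil ?expR0//.
by rewrite !big_cons expRD IH.
Qed.

End tilt.

End gas.

(** * Probabilities of deviation from exponential moments *)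

Section tilted_bounds.
Context {R : realType}.
Local Notation plane := (measurableTypeR R * measurableTypeR R)%type.
Variables (beta : R) (n : nat).
Hypotheses (beta0 : 0 < beta) (n2 : (2 <= n)%N).

Lemma partition_limit :
  (n`!%:R * (4^-1 ^+ K ^+ n * ell beta K n))%:E @[K --> \oo] --> partition_function n beta.
Proof.
have := @tilted_limit R beta n beta0 n2 set0 0 measurable0.
rewrite /tilted_sum (_ : (fun p => expR (0 * npoints set0 p)) = fun=> 1); last first.
  by apply/funext => p; rewrite mul0r expR0.
rewrite -partition_functionE// (_ : (fun K => (_ * (_ * tree _ _ _ _ _ _))%:E) =
  fun K => (n`!%:R * (4^-1 ^+ K ^+ n * ell beta K n))%:E)//.
apply/funext => K; congr (_ * (_ * tree _ _ _ _ _ _))%:E.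
by apply/funext => a; apply/funext => b; rewrite /mgf_leaf expR0 subrr mul0r addr0.
Qed.

Lemma partition_function_gt0 : exists2 Z : R, 0 < Z & partition_function n beta = Z%:E.
Proof.
have f0 : 0 < n`!%:R :> R by rewrite ltr0n fact_gt0.
have ge : ((n`!%:R * ell_floor beta n)%:E <= partition_function n beta)%E.
  apply: (cvge_ge _ partition_limit); exists n => // K /= nK.
  by rewrite lee_fin ler_pM2l// ell_floor_le.
have le : (partition_function n beta <= n`!%:R%:E)%E.
  apply: (cvge_le _ partition_limit); exists 0%N => // K _.
  by rewrite lee_fin ler_piMr// ell_ceil.
have fin : partition_function n beta \is a fin_num.
  rewrite ge0_fin_numE; first exact: le_lt_trans le (ltry _).
  by apply: le_trans ge; rewrite lee_fin mulr_ge0// ltW// ell_floor_gt0.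
exists (fine (partition_function n beta)); last by rewrite fineK.
apply: (@lt_le_trans _ _ (n`!%:R * ell_floor beta n)); first by rewrite mulr_gt0// ell_floor_gt0.
by rewrite -lee_fin fineK.
Qed.

Section comparison.
Variables (D : set plane) (th B : R).
Hypothesis mD : measurable D.
Local Notation mgf K := (tree beta (mgf_leaf K (cfrac D) th) K n 0 0).

Let scaled_limit : (n`!%:R * (4^-1 ^+ K ^+ n * ell beta K n) * expR B)%:E @[K --> \oo] -->
  (partition_function n beta * (expR B)%:E)%E.
Proof.
rewrite muleC (_ : (fun K => _) = fun K => ((expR B)%:E * (n`!%:R * (4^-1 ^+ K ^+ n * ell beta K n))%:E)%E).
  by apply: cvgeZl => //; exact: partition_limit.
by apply/funext => K; rewrite -EFinM mulrC.
Qed.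

Lemma tilted_sum_le K0 : (forall K, (K0 <= K)%N -> mgf K <= ell beta K n * expR B) ->
  (@tilted_sum R beta n D th <= partition_function n beta * (expR B)%:E)%E.
Proof.
move=> h; have := lee_cvg_to (@tilted_limit R beta n beta0 n2 D th mD) scaled_limit; apply.
exists K0 => // K /= /h hK; rewrite lee_fin -!mulrA.
by rewrite ler_pM2l ?ltr0n ?fact_gt0// ler_pM2l// !exprn_gt0// invr_gt0.
Qed.

Lemma tilted_sum_ge K0 : (forall K, (K0 <= K)%N -> ell beta K n * expR B <= mgf K) ->
  (partition_function n beta * (expR B)%:E <= @tilted_sum R beta n D th)%E.
Proof.
move=> h; have := lee_cvg_to scaled_limit (@tilted_limit R beta n beta0 n2 D th mD); apply.
exists K0 => // K /= /h hK; rewrite lee_fin -!mulrA.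
by rewrite ler_pM2l ?ltr0n ?fact_gt0// ler_pM2l// !exprn_gt0// invr_gt0.
Qed.

End comparison.

Section tails.
Variables (D : set plane) (th a B delta : R).
Hypotheses (mD : measurable D) (th0 : 0 <= th).
Local Notation N p := (npoints D p).
Local Notation I th := (@tilted_sum R beta n D th).
Let dev : set (n.-tuple plane) := [set p | delta <= `|N p - a|].

Lemma measurable_dev : measurable dev.
Proof.
have mN := @measurable_npoints R n D mD.
have m : measurable_fun setT (fun p : n.-tuple plane => `|N p - a|).
  by apply: measurableT_comp => //; exact: measurable_funB.
rewrite (_ : dev = (fun p : n.-tuple plane => `|N p - a|) @^-1` `[delta, +oo[); last first.
  by apply/seteqP; split => p; rewrite /dev /= in_itv /= andbT.
by rewrite -[X in measurable X]setTI; apply: m => //; exact: measurable_itv.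
Qed.

Let mexp (t c : R) : measurable_fun setT (fun p : n.-tuple plane => expR (t * N p + c)).
Proof.
apply: measurableT_comp => //; apply: measurable_funD => //; apply: measurable_funM => //.
exact: measurable_npoints.
Qed.

Let gas_exp t c : gas_sum beta (fun p : n.-tuple plane => expR (t * N p + c)) =
  ((expR c)%:E * I t)%E.
Proof.
rewrite -gas_sumZ ?expR_ge0//; last first.
  have := mexp t 0; congr (measurable_fun _ _).
  by apply/funext => p; rewrite addr0.
by congr gas_sum; apply/funext => p; rewrite expRD mulrC.
Qed.

(** Two-sided Chernoff bound: the indicator of the deviation is at most e^(th (N - a - delta)) +
    e^(th (a - N - delta)). *)
Lemma gas_markov :
  (I th <= partition_function n beta * (expR (th * a + B))%:E)%E ->
  (I (- th) <= partition_function n beta * (expR (- th * a + B))%:E)%E ->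
  (coulomb_prob beta dev <= (2 * expR (B - th * delta))%:E)%E.
Proof.
move=> h1 h2; rewrite coulomb_probE//; last exact: measurable_dev.
have [Z Z0 ZE] := partition_function_gt0; rewrite ZE /= in h1 h2 *.
apply: (@le_trans _ _ (Z^-1%:E * (Z * (2 * expR (B - th * delta)))%:E)%E); last first.
  by rewrite -EFinM mulKf// gt_eqF.
apply: lee_wpmul2l; first by rewrite lee_fin invr_ge0 ltW.
have mdev := measurable_dev.
apply: (@le_trans _ _ (gas_sum beta (fun p : n.-tuple plane =>
   expR (th * N p + (- th * a - th * delta)) + expR (- th * N p + (th * a - th * delta))))).
  apply: gas_sum_le => //; first by apply: measurable_funD; exact: mexp.
  move=> p; rewrite indicE; case: (boolP (p \in dev)) => [|_]; last first.
    by rewrite addr_ge0// expR_ge0.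
  rewrite inE /dev /= => hp.
  have [Na|Na] := leP 0 (N p - a).
    rewrite ger0_norm// in hp; apply: ler_wpDr; first exact: expR_ge0.
    rewrite -[leLHS]expR0 ler_expR.
    have -> : th * N p + (- th * a - th * delta) = th * (N p - a - delta) by ring.
    by rewrite mulr_ge0// subr_ge0.
  rewrite ltr0_norm// in hp; apply: ler_wpDl; first exact: expR_ge0.
  rewrite -[leLHS]expR0 ler_expR.
  have -> : - th * N p + (th * a - th * delta) = th * (- (N p - a) - delta) by ring.
  by rewrite mulr_ge0// subr_ge0.
rewrite gas_sumD//.
rewrite !gas_exp.
have e0 c : (0 <= (expR c)%:E :> \bar R)%E by rewrite lee_fin expR_ge0.
apply: (le_trans (leeD (lee_wpmul2l (e0 _) h1) (lee_wpmul2l (e0 _) h2))).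
rewrite -!EFinM -EFinD lee_fin !mulrA ![expR _ * Z]mulrC -!mulrA -!expRD -mulrDr.
rewrite ler_pM2l// mulr_natl mulr2n le_eqVlt; apply/orP; left; apply/eqP.
by congr (expR _ + expR _); ring.
Qed.

                                       
                                                                                          
(** Second moment method for Y = e^(th N): pointwise 2tY <= 1_dev + t^2 Y^2 + 2ty, where y bounds Y
    off the deviation event. Integrated, the first moment beats the last two terms because G exceeds
    th delta by ln 4. *)
Lemma gas_paley_zygmund G : 0 <= G -> th * delta + ln 4 <= G ->
  (partition_function n beta * (expR (th * a + G))%:E <= I th)%E ->
  (I (2 * th) <= partition_function n beta * (expR (2 * th * a + B))%:E)%E ->
  ((expR (- B) / 4)%:E <= coulomb_prob beta dev)%E.
Proof.
move=> G0 hG h1 h2; rewrite coulomb_probE//; last exact: measurable_dev.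
have [Z Z0 ZE] := partition_function_gt0; rewrite ZE /= in h1 h2 *.
(* Half the ratio of the lower bound of E Y to the upper bound of E Y^2. *)
pose t := expR (G - B - th * a) / 2.
have t0 : 0 < t by rewrite divr_gt0 ?expR_gt0.
pose y := expR (th * (a + delta)).
have y0 : 0 < y by exact: expR_gt0.
have mdev := measurable_dev.
have mind : measurable_fun setT (\1_dev : n.-tuple plane -> R) by exact: measurable_indic.
pose f1 (p : n.-tuple plane) : R := 2 * t * expR (th * N p + 0).
pose f2 (p : n.-tuple plane) : R := t ^+ 2 * expR (2 * th * N p + 0).
have m1 : measurable_fun setT f1 by apply: measurable_funM => //; exact: mexp.
have m2 : measurable_fun setT f2 by apply: measurable_funM => //; exact: mexp.
have key : (gas_sum beta f1 <= gas_sum beta (fun p : n.-tuple plane =>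
    (\1_dev p + f2 p + 2 * t * y * 1)%R))%E.
  apply: gas_sum_le => //.
  - by apply: measurable_funD => //; exact: measurable_funD.
  - by move=> p; rewrite /f1 !mulr_ge0 ?expR_ge0// ltW.
  move=> p; rewrite /f1 /f2 !addr0 mulr1.
  have -> : expR (2 * th * N p) = expR (th * N p) ^+ 2 by rewrite -expRM_natl; congr expR; ring.
  (* On the event, (1 - tY)^2 >= 0 suffices; off it, Y <= y. *)
  rewrite indicE; case: (boolP (p \in dev)) => [_|].
    have := sqr_ge0 (1 - t * expR (th * N p)).
    have : 0 <= 2 * t * y by rewrite !mulr_ge0// ltW.
    move: (expR (th * N p)) => Y /=; nra.
  rewrite notin_setE /dev /= => /negP; rewrite -ltNge => hp.
  have hY : expR (th * N p) <= y.
    rewrite /y ler_expR ler_wpM2l//.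
    by have := le_lt_trans (ler_norm _) hp; rewrite ltrBlDl => /ltW.
  have := sqr_ge0 (t * expR (th * N p)).
  have : 2 * t * expR (th * N p) <= 2 * t * y by rewrite ler_pM2l// mulr_gt0.
  rewrite exprMn; move: (expR (th * N p)) => Y /=; lra.
have f20 p : 0 <= f2 p by rewrite mulr_ge0 ?sqr_ge0 ?expR_ge0.
have i0 p : 0 <= \1_dev p :> R by [].
have c0 : 0 <= 2 * t * y by rewrite !mulr_ge0// ltW.
rewrite gas_sumD// in key; last 3 first.
- exact: measurable_funD.
- by move=> p; rewrite addr_ge0.
- by move=> p; rewrite mulr1.
have s3 : gas_sum beta (fun _ : n.-tuple plane => 2 * t * y * 1) = ((2 * t * y)%:E * Z%:E)%E.
  by rewrite (@gas_sumZ R beta n beta0 n2 (2 * t * y) (fun=> 1))// -partition_functionE// ZE.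
rewrite s3 gas_sumD// in key.
have mexp0 c d : measurable_fun setT (fun p : n.-tuple plane => expR (c * N p + d)) by [].
rewrite (gas_sumZ beta0 n2 (mexp0 _ _)) ?mulr_ge0 ?(ltW t0)// in key.
rewrite (gas_sumZ beta0 n2 (mexp0 _ _)) ?sqr_ge0// in key.
rewrite !gas_exp expR0 !mul1e in key.
have P0 : (0 <= gas_sum beta \1_dev)%E.
  by apply: integral_ge0 => p _; rewrite mule_ge0 ?expeR_ge0// lee_fin.
have PZ : (gas_sum beta \1_dev <= Z%:E)%E.
  by rewrite -ZE partition_functionE//; apply: gas_sum_le.
have [P PE] : exists P, gas_sum beta \1_dev = P%:E.
  exists (fine (gas_sum beta \1_dev)); rewrite fineK// ge0_fin_numE//.
  exact: le_lt_trans PZ (ltry _).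
have t20 : (0 <= (t ^+ 2)%:E :> \bar R)%E by rewrite lee_fin sqr_ge0.
have t10 : (0 <= (2 * t)%:E :> \bar R)%E by rewrite lee_fin mulr_ge0// ltW.
have := le_trans (lee_wpmul2l t10 h1) (le_trans key (leeD (leeD (lexx _) (lee_wpmul2l t20 h2)) (lexx _))).
rewrite PE -!EFinM -!EFinD !lee_fin => {}key.
rewrite ler_pdivlMl//.
pose E := expR (2 * G - B).
have e1 : 2 * t * (Z * expR (th * a + G)) = Z * E.
  rewrite (_ : E = expR (G - B - th * a) * expR (th * a + G)); last first.
    by rewrite -expRD /E; congr expR; ring.
  by rewrite /t; field.
have e2 : t ^+ 2 * (Z * expR (2 * th * a + B)) = Z * E / 4.
  rewrite (_ : E = expR (G - B - th * a) ^+ 2 * expR (2 * th * a + B)); last first.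
    by rewrite -expRM_natl -expRD /E; congr expR; ring.
  by rewrite /t; field.
have e3 : 2 * t * y * Z <= Z * E / 4.
  have -> : 2 * t * y * Z = Z * expR (G - B + th * delta).
    rewrite (_ : expR (G - B + th * delta) = expR (G - B - th * a) * y); last first.
      by rewrite /y -expRD; congr expR; ring.
    by rewrite /t; field.
  rewrite -mulrA ler_pM2l// ler_pdivlMr// -[4]lnK ?posrE// -expRD ler_expR; lra.
have e4 : expR (- B) <= E by rewrite /E ler_expR; lra.
have v0 : 0 <= Z * expR (- B) by rewrite mulr_ge0 ?expR_ge0// ltW.
have e5 : Z * expR (- B) <= Z * E by rewrite ler_pM2l.
rewrite e1 e2 in key; rewrite mulrA.
move: (Z * E) (Z * expR (- B)) v0 key e3 e5 => u v v0 key e3 e5; lra.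
Qed.


End tails.

End tilted_bounds.

(** * Choice of the stopping level *)

Section scales.
Context {R : realType}.
Local Notation plane := (measurableTypeR R * measurableTypeR R)%type.

(** The mean population of a cell drops by a factor 4 per level, so it cannot jump over the
    window. *)
Lemma scale_window (l : R) n : 0 < l -> l ^+ 2 <= n%:R ->
  exists M, l ^+ 2 <= n%:R / 4 ^+ M <= 4 * l ^+ 2.
Proof.
move=> l0 ln; have l20 : 0 < l ^+ 2 by rewrite exprn_gt0.
pose P (M : nat) := (n%:R : R) < l ^+ 2 * 4 ^+ M.+1.
have ex : exists M, P M.
  exists (Num.trunc (n%:R / l ^+ 2 : R)); rewrite /P mulrC -ltr_pdivrMr//.
  set t := n%:R / l ^+ 2; have t0 : 0 <= t by rewrite divr_ge0// ltW.
  have /andP[_ h] : (Num.trunc t)%:R <= t < (Num.trunc t).+1%:R by exact: truncn_itv.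
  by rewrite (lt_trans h)// -natrX ltr_nat ltn_expl.
exists (ex_minn ex); case: ex_minnP => M PM minM.
have p0 k : 0 < 4 ^+ k :> R by rewrite exprn_gt0.
apply/andP; split; last first.
  by move: PM; rewrite /P (exprS 4) mulrCA mulrA => /ltW; rewrite ler_pdivrMr.
rewrite ler_pdivlMr//; case: M PM minM => [|M] PM minM; first by rewrite expr0 mulr1.
by rewrite leNgt; apply/negP => /minM; rewrite ltnn.
Qed.

(** x is the radius in units of the cell side and mu the mean population of a cell; everything
    follows from x^2 mu = r^2. *)
Lemma scale_bounds (r l : R) n M (x := r / Num.sqrt n%:R * 2 ^+ M) (mu : R := n%:R / 4 ^+ M) :
  0 < r -> 0 < l -> l ^+ 2 <= mu <= 4 * l ^+ 2 ->
  [/\ r / (2 * l) <= x, x <= r / l & mu * x <= 2 * l * r].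
Proof.
move=> r0 l0 /andP[mu1 mu2].
have mu0 : 0 < mu by apply: lt_le_trans mu1; rewrite exprn_gt0.
have n0 : 0 < n%:R :> R by move: mu0; rewrite /mu pmulr_lgt0// invr_gt0 exprn_gt0.
have s0 : 0 < Num.sqrt n%:R :> R by rewrite sqrtr_gt0.
have x0 : 0 < x by rewrite mulr_gt0 ?divr_gt0// exprn_gt0.
have xE : x ^+ 2 * mu = r ^+ 2.
  rewrite /x /mu; have -> : 4 ^+ M = 2 ^+ M * 2 ^+ M :> R by rewrite -exprMn -natrM.
  have {2}-> : n%:R = Num.sqrt n%:R ^+ 2 :> R by rewrite sqr_sqrtr// ltW.
  by field; rewrite !gt_eqF ?exprn_gt0.
clearbody x mu; have sq (u v : R) : 0 <= u -> 0 <= v -> u ^+ 2 <= v ^+ 2 -> u <= v.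
  by move=> u0 v0; rewrite ler_sqr ?nnegrE.
have h1 : r / (2 * l) <= x.
  rewrite ler_pdivrMr ?mulr_gt0//; apply: sq; [exact: ltW|by rewrite !mulr_ge0// ltW|].
  by rewrite -xE exprMn ler_pM2l ?exprn_gt0// exprMn; lra.
split=> //.
  rewrite ler_pdivlMr//; apply: sq; [by rewrite mulr_ge0// ltW|exact: ltW|].
  by rewrite -xE exprMn ler_pM2l// exprn_gt0.
have e : mu * x * x = r ^+ 2 by rewrite -xE; ring.
rewrite -(ler_pM2r x0) e.
move: h1; rewrite ler_pdivrMr ?mulr_gt0// => h1.
by rewrite expr2 [leRHS](_ : _ = r * (x * (2 * l))); [rewrite ler_pM2l|ring].
Qed.

Lemma disc_in_square (z : R * R) (r : R) : 0 < z.1 < 1 -> 0 < z.2 < 1 -> 0 < r ->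
  exists n0, forall n, (n0 <= n)%N -> eball z (r / Num.sqrt n%:R) `<=` cell 0 0 0.
Proof.
move=> /andP[a0 a1] /andP[b0 b1] r0.
pose d := Num.min (Num.min z.1 (1 - z.1)) (Num.min z.2 (1 - z.2)).
have d0 : 0 < d by rewrite /d !lt_min a0 b0 !subr_gt0 a1 b1.
exists (Num.trunc ((r / d) ^+ 2)).+1 => n hn p; rewrite /eball /= => hp.
have q0 : 0 <= (r / d) ^+ 2 by rewrite sqr_ge0.
have /andP[_ h] := truncn_itv q0.
have hn' : (r / d) ^+ 2 < n%:R by rewrite (lt_le_trans h)// ler_nat.
have n0 : 0 < n%:R :> R by exact: le_lt_trans hn'.
have s0 : 0 < Num.sqrt n%:R :> R by rewrite sqrtr_gt0.
have rd : r / Num.sqrt n%:R < d.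
  rewrite ltr_pdivrMr// mulrC -ltr_pdivrMr//.
  by rewrite -[ltLHS]ger0_norm ?divr_ge0 ?(ltW r0) ?(ltW d0)// -sqrtr_sqr ltr_sqrt.
have {hp}rd := le_lt_trans hp rd.
have c1 : `|p.1 - z.1| < d.
  by apply: le_lt_trans rd; rewrite -sqrtr_sqr ler_wsqrtr// lerDl sqr_ge0.
have c2 : `|p.2 - z.2| < d.
  by apply: le_lt_trans rd; rewrite -sqrtr_sqr ler_wsqrtr// lerDr sqr_ge0.
move: c1 c2; rewrite /d !lt_min !ltr_norml /cell /= !in_itv /= !expr0 !divr1.
by move=> /andP[/andP[/andP[? ?] /andP[? ?]] _] /andP[_ /andP[/andP[? ?] /andP[? ?]]]; split; lra.
Qed.

End scales.

(** * Exponential moments in terms of radius and cell population *)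

Section disc_mgf.
Context {R : realType}.
Local Notation plane := (measurableTypeR R * measurableTypeR R)%type.
Variables (beta : R) (z : R * R) (r l : R) (n : nat).
Hypotheses (beta0 : 0 < beta) (r0 : 0 < r) (l0 : 0 < l) (n2 : (2 <= n)%N).
Local Notation rho := (r / Num.sqrt n%:R).
Hypotheses (ball_in : eball z rho `<=` cell 0 0 0) (l_le : l ^+ 2 <= n%:R).
Local Notation I th := (@tilted_sum R beta n (eball z rho) th).
Local Notation Z := (partition_function n beta).
Local Notation a := (pi * r ^+ 2).
Local Notation var := (quad_var_const beta).
Local Notation J := (beta + ln 4).

Let rho0 : 0 < rho.
Proof. by rewrite divr_gt0// sqrtr_gt0 ltr0n; case: (n) n2. Qed.

Let aE th : th * (n%:R * dfrac z rho 0 0 0) = th * a.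
Proof.
rewrite dfrac_root// exprMn exprVn sqr_sqrtr//; field.
by rewrite pnatr_eq0; case: (n) n2.
Qed.

Let upper (M : nat) th B : (forall N, tree beta (mgf_leaf (N.+1 + M) (dfrac z rho) th) (N.+1 + M) n 0 0 <=
    ell beta (N.+1 + M) n * expR (th * (n%:R * dfrac z rho 0 0 0) + B)) ->
  (I th <= Z * (expR (th * a + B))%:E)%E.
Proof.
move=> h; apply: (@tilted_sum_le R beta n beta0 n2 _ th _ (measurable_eball _ _) M.+1).
by move=> K MK; have := h (K - M.+1)%N; rewrite aE; have -> : ((K - M.+1).+1 + M = K)%N by lia.
Qed.

Let lower (M N0 : nat) th B : (forall N, (N0 <= N)%N ->
    ell beta (N.+1 + M) n * expR (th * (n%:R * dfrac z rho 0 0 0) + B) <=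
    tree beta (mgf_leaf (N.+1 + M) (dfrac z rho) th) (N.+1 + M) n 0 0) ->
  (Z * (expR (th * a + B))%:E <= I th)%E.
Proof.
move=> h; apply: (@tilted_sum_ge R beta n beta0 n2 _ th _ (measurable_eball _ _) (N0 + M.+1)).
move=> K MK; have := h (K - M.+1)%N ltac:(lia); rewrite aE.
by have -> : ((K - M.+1).+1 + M = K)%N by lia.
Qed.

Let Z0 : (0 <= Z)%E.
Proof. by have [Zr Zr0 ->] := partition_function_gt0 beta0 n2; rewrite lee_fin ltW. Qed.

Let weaken_le th (B B' : R) : B <= B' -> (I th <= Z * (expR (th * a + B))%:E)%E ->
  (I th <= Z * (expR (th * a + B'))%:E)%E.
Proof.
by move=> BB /le_trans; apply; apply: lee_wpmul2l => //; rewrite lee_fin ler_expR lerD2l.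
Qed.

Let weaken_ge th (B B' : R) : B' <= B -> (Z * (expR (th * a + B))%:E <= I th)%E ->
  (Z * (expR (th * a + B'))%:E <= I th)%E.
Proof.
by move=> BB; apply: le_trans; apply: lee_wpmul2l => //; rewrite lee_fin ler_expR lerD2l.
Qed.

Lemma upper_const_ge0 : 0 <= upper_const beta.
Proof.
have pi0 := pi_gt0 R.
apply: addr_ge0; last by rewrite mulr_ge0// ltW.
apply: mulr_ge0; last by rewrite addr_ge0// mulr_ge0// ltW.
by apply: mulr_ge0; [exact: quad_gauss_const_ge0|rewrite mulr_ge0// ltW].
Qed.

Lemma disc_upper_small (th : R) : l = 1 -> 2 <= r -> 4 * th ^+ 2 <= beta / 16 / 3 ->
  (I th <= Z * (expR (th * a + 69 * upper_const beta * (th ^+ 2 * r)))%:E)%E.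
Proof.
move=> l1 r2 ths; have [M mu] := scale_window l0 l_le.
have [h1 h2 h3] := scale_bounds r0 l0 mu.
apply: (@weaken_le _ (upper_const beta * (69 * th ^+ 2) * (rho * 2 ^+ M))).
  rewrite (_ : 69 * _ * _ = upper_const beta * (69 * th ^+ 2) * r); last by ring.
  apply: ler_wpM2l; last by move: h2; rewrite l1 divr1.
  by apply: mulr_ge0; [exact: upper_const_ge0|apply: mulr_ge0 => //; exact: sqr_ge0].
apply: (@upper M) => N; apply: mgf_upper_small => //.
  by apply: le_trans h1; rewrite l1 mulr1 ler_pdivlMr// mul1r.
by case/andP: mu => _; rewrite l1 expr1n mulr1.
Qed.

Lemma disc_upper_large (th : R) : 2 * l <= r ->
  (I th <= Z * (expR (th * a + (upper_const beta + 64 * pi) *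
    (th ^+ 2 * r / l + `|th| * l * r)))%:E)%E.
Proof.
move=> lr; have [M mu] := scale_window l0 l_le.
have [h1 h2 h3] := scale_bounds r0 l0 mu.
have xM : 1 <= rho * 2 ^+ M.
  by apply: le_trans h1; rewrite ler_pdivlMr ?mulr_gt0// mul1r.
have pi0 := pi_gt0 R.
apply: (@weaken_le _ (upper_const beta * th ^+ 2 * (rho * 2 ^+ M) +
    `|th| * (n%:R / 4 ^+ M) * (32 * pi) * (rho * 2 ^+ M))); last first.
  by apply: (@upper M) => N; rewrite addrA; exact: mgf_upper_large.
have C0 := upper_const_ge0.
have e1 : upper_const beta * th ^+ 2 * (rho * 2 ^+ M) <= upper_const beta * (th ^+ 2 * r / l).
  rewrite -[leLHS]mulrA -[_ * r / l]mulrA.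
  exact: (ler_wpM2l C0 (ler_wpM2l (sqr_ge0 th) h2)).
have e2 : `|th| * (n%:R / 4 ^+ M) * (32 * pi) * (rho * 2 ^+ M) <= 64 * pi * (`|th| * l * r).
  rewrite [leLHS](_ : _ = `|th| * (32 * pi) * (n%:R / 4 ^+ M * (rho * 2 ^+ M))); last by ring.
  rewrite [leRHS](_ : _ = `|th| * (32 * pi) * (2 * l * r)); last by ring.
  by apply: ler_wpM2l => //; rewrite !mulr_ge0// ltW.
have p1 : 0 <= th ^+ 2 * r / l by rewrite divr_ge0 ?(ltW l0)// mulr_ge0 ?sqr_ge0// ltW.
have p2 : 0 <= `|th| * l * r by rewrite !mulr_ge0// ltW.
apply: (le_trans (lerD e1 e2)).
have Q0 : 0 <= 64 * pi :> R by rewrite mulr_ge0// ltW.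
have q1 := mulr_ge0 Q0 p1; have q2 := mulr_ge0 C0 p2.
move: (upper_const beta) (64 * pi) (th ^+ 2 * r / l) (`|th| * l * r) q1 q2 => u v c d q1 q2.
by rewrite -subr_ge0 (_ : _ - _ = v * c + u * d); [exact: addr_ge0|ring].
Qed.

Lemma disc_lower_variance (th : R) : 0 <= th <= 1 -> 4 * var <= l ^+ 4 -> 40 * l <= r ->
  (Z * (expR (th * a + expR (- (64 * J * l ^+ 4)) / (32 ^+ 2 * (160 * l)) * (th ^+ 2 * r)))%:E <= I th)%E.
Proof.
move=> /andP[th0 th1] vl rl; have [M mu] := scale_window l0 l_le.
have [h1 h2 h3] := scale_bounds r0 l0 mu.
have mu0 : 0 < n%:R / 4 ^+ M :> R by case/andP: mu => + _; apply: lt_le_trans; rewrite exprn_gt0.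
have J0 : 0 <= J by rewrite addr_ge0 ?ln_ge0 ?ler1n// ltW.
have xM : 20 <= rho * 2 ^+ M.
  by apply: le_trans h1; rewrite ler_pdivlMr ?mulr_gt0//; lra.
have gc := good_count rho0 ball_in xM.
pose tau := expR (- (J * (2 * (n%:R / 4 ^+ M)) ^+ 2)) * (th / 32) ^+ 2.
have tau0 : 0 <= tau by apply: mulr_ge0; [exact: expR_ge0|exact: sqr_ge0].
apply: (@weaken_ge _ (desc M (fun a b => (good z rho M a b)%:R) 0 0 * (tau / 4))); last first.
  apply: (@lower M 0) => N _; apply: mgf_lower_variance => //.
  apply: (le_trans vl); have -> : l ^+ 4 = (l ^+ 2) ^+ 2 by rewrite -exprM.
  by case/andP: mu => h _; rewrite ler_sqr ?nnegrE ?(ltW mu0) ?sqr_ge0.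
apply: (@le_trans _ _ (r / (2 * l) / 20 * (tau / 4))); last first.
  apply: ler_wpM2r; first by apply: divr_ge0.
  by apply: le_trans gc; rewrite ler_pM2r// invr_gt0.
have e : expR (- (64 * J * l ^+ 4)) <= expR (- (J * (2 * (n%:R / 4 ^+ M)) ^+ 2)).
  rewrite ler_expR lerN2 [leRHS](_ : _ = J * (2 * (4 * l ^+ 2)) ^+ 2); last by ring.
  apply: ler_wpM2l => //; case/andP: mu => _ h.
  by rewrite ler_sqr ?nnegrE ?ler_pM2l// mulr_ge0 ?(ltW mu0)// mulr_ge0 ?sqr_ge0.
rewrite /tau; move: (expR _) (expR _) e => v u uv.
rewrite [leLHS](_ : _ = r / (2 * l) / 20 * (u * (th / 32) ^+ 2 / 4)); last by field; rewrite gt_eqF.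
apply: ler_wpM2l; first by rewrite !divr_ge0 ?mulr_ge0// ltW.
by rewrite ler_pM2r ?invr_gt0// ler_wpM2r// sqr_ge0.
Qed.

Let gain_slope (L th : R) : 0 <= L -> 32 * L * (16 + 2 * var) * l ^+ 2 <= th -> 0 <= th.
Proof.
move=> L0; apply: le_trans; apply: mulr_ge0 (sqr_ge0 l); apply: mulr_ge0.
  exact: mulr_ge0.
by apply: addr_ge0 => //; apply: mulr_ge0 => //; exact/ltW/quad_var_const_gt0.
Qed.

(** The slope condition on th makes half of the gain th mu / 16 cover the price L mu^2 + 2 L [var],
    which is O(L l^4). *)
Let lower_gain (L th mu : R) : 0 <= L -> 1 <= l -> l ^+ 2 <= mu <= 4 * l ^+ 2 -> 0 <= th ->
  32 * L * (16 + 2 * var) * l ^+ 2 <= th ->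
  th * l ^+ 2 / 32 <= th * mu / 16 - L * mu ^+ 2 - 2 * L * var.
Proof.
move=> L0 l1 /andP[m1 m2] th0 hth.
have v0 : 0 < var by exact: quad_var_const_gt0.
have l21 : 1 <= l ^+ 2 by rewrite exprn_ege1.
have mu0 : 0 <= mu by apply: le_trans m1; lra.
have a1 : th * l ^+ 2 <= th * mu by rewrite ler_wpM2l.
have a2 : L * mu ^+ 2 <= L * (4 * l ^+ 2) ^+ 2.
  by rewrite ler_wpM2l// ler_sqr ?nnegrE//; lra.
have a3 : L * var <= L * var * (l ^+ 2 * l ^+ 2).
  rewrite ler_peMr//; first by rewrite mulr_ge0// ltW.
  by rewrite -[leLHS]mulr1 ler_pM.
have a4 : 32 * L * (16 + 2 * var) * l ^+ 2 * l ^+ 2 <= th * l ^+ 2 by rewrite ler_wpM2r//; lra.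
rewrite exprMn in a2; move: (l ^+ 2) l21 a1 a2 a3 a4 => q q1 a1 a2 a3 a4.
move: v0 a3 a4; move: var => v v0 a3 a4.
have -> : 2 * L * v = 2 * (L * v) by ring.
have e5 : L * (4 ^+ 2 * q ^+ 2) = 16 * (L * (q * q)) by ring.
have e6 : 32 * L * (16 + 2 * v) * q * q = 512 * (L * (q * q)) + 64 * (L * v * (q * q)) by ring.
rewrite e5 in a2; rewrite e6 in a4; lra.
Qed.

(** At least r / (40 l) good cells, each gaining th l^2 / 32. *)
Lemma disc_lower_good (th : R) : 1 <= l -> 40 * l <= r ->
  32 * J * (16 + 2 * var) * l ^+ 2 <= th ->
  (Z * (expR (th * a + th * l * r / (32 * 40)))%:E <= I th)%E.
Proof.
move=> l1 rl hth; have [M mu] := scale_window l0 l_le.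
have [h1 h2 h3] := scale_bounds r0 l0 mu.
have v0 : 0 < var by exact: quad_var_const_gt0.
have J0 : 0 <= J by rewrite addr_ge0 ?ln_ge0 ?ler1n// ltW.
have th0 := gain_slope J0 hth.
have xM : 20 <= rho * 2 ^+ M.
  by apply: le_trans h1; rewrite ler_pdivlMr ?mulr_gt0//; lra.
have gc := good_count rho0 ball_in xM.
have gain := lower_gain J0 l1 mu th0 hth.
apply: (@weaken_ge _ (desc M (fun a b => (good z rho M a b)%:R) 0 0 *
   (th * (n%:R / 4 ^+ M) / 16 - J * (n%:R / 4 ^+ M) ^+ 2 - 2 * J * var))); last first.
  by apply: (@lower M 0) => N _; exact: mgf_lower_good.
have g0 : 0 <= th * l ^+ 2 / 32 by rewrite divr_ge0// mulr_ge0// sqr_ge0.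
apply: (@le_trans _ _ (r / (2 * l) / 20 * (th * l ^+ 2 / 32))).
  by rewrite le_eqVlt; apply/orP; left; apply/eqP; field; rewrite gt_eqF.
apply: ler_pM => //; first by rewrite !divr_ge0 ?mulr_ge0// ltW.
by apply: le_trans gc; rewrite ler_pM2r// invr_gt0.
Qed.

Lemma disc_lower_chain (th : R) j : 1 <= l -> 4 * r <= l -> 4 * l <= r * 2 ^+ j ->
  32 * (j%:R * J) * (16 + 2 * var) * l ^+ 2 <= th ->
  (Z * (expR (th * a + th * l ^+ 2 / 32))%:E <= I th)%E.
Proof.
move=> l1 rl jl hth; have [M mu] := scale_window l0 l_le.
have [h1 h2 h3] := scale_bounds r0 l0 mu.
have v0 : 0 < var by exact: quad_var_const_gt0.
have J0 : 0 <= j%:R * J by rewrite mulr_ge0// addr_ge0 ?ln_ge0 ?ler1n// ltW.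
have th0 := gain_slope J0 hth.
have gain := lower_gain J0 l1 mu th0 hth.
have xM : rho * 2 ^+ M <= 4^-1.
  by apply: (le_trans h2); rewrite ler_pdivrMr//; lra.
have [z1 z1' z2 z2'] := eball_center rho0 ball_in.
pose k := (M + j)%N.
have p0 : 0 < 2 ^+ k :> R by rewrite exprn_gt0.
have side : 2 / 2 ^+ k <= rho.
  rewrite ler_pdivrMr// /k exprD mulrA.
  apply: (@le_trans _ _ (r / (2 * l) * 2 ^+ j)); last by rewrite ler_wpM2r// exprn_ge0.
  by rewrite mulrAC ler_pdivlMr ?mulr_gt0//; lra.
(* The level-k cell of the centre has diameter at most rho by [side], so it lies in the disc. *)
pose x := Num.trunc (z.1 * 2 ^+ k); pose y := Num.trunc (z.2 * 2 ^+ k).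
have /andP[x1 x2] : x%:R <= z.1 * 2 ^+ k < x.+1%:R by apply: truncn_itv; rewrite mulr_ge0// ltW.
have /andP[y1 y2] : y%:R <= z.2 * 2 ^+ k < y.+1%:R by apply: truncn_itv; rewrite mulr_ge0// ltW.
have lt2 (c : nat) (t : R) : t < 1 -> c%:R <= t * 2 ^+ k -> (c < 2 ^ k)%N.
  move=> t1 ct; rewrite -(ltr_nat R) natrX (le_lt_trans ct)//.
  by rewrite gtr_pMl.
have zc : cell (R := R) k x y z.
  by rewrite /cell /= !in_itv /= !ler_pdivrMr// !ltr_pdivlMr// x1 x2 y1 y2.
have W1 : dfrac z rho k x y = 1.
  apply: frac_full => q cq; rewrite /eball /=; apply: le_trans side.
  exact: cell_diam cq zc.
apply: (@weaken_ge _ _ _ gain).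
apply: (@lower M j) => N jN; apply: mgf_lower_chain W1 xM _ => //.
- exact: leqW.
- exact: lt2 x1.
- exact: lt2 y1.
- by apply: le_trans gain; rewrite divr_ge0// mulr_ge0// sqr_ge0.
Qed.

End disc_mgf.

                                  

(** * Asymptotic comparison of powers *)

Section powers.
Context {R : realType}.

Lemma powR_le1 (r p : R) : 1 <= r -> p <= 0 -> r `^ p <= 1.
Proof. by move=> r1 p0; rewrite -[leRHS](powRr0 r) ler_powR. Qed.

Lemma powR_ge1 (r p : R) : 1 <= r -> 0 <= p -> 1 <= r `^ p.
Proof. by move=> r1 p0; rewrite -[leLHS](powRr0 r) ler_powR. Qed.

Lemma exponent_between (a b e : R) : a < b -> 0 < e ->
  exists a', [/\ a < a', a' < b & a' < a + e].
Proof.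
move=> ab e0; pose d := Num.min ((b - a) / 2) (e / 2).
have d0 : 0 < d by rewrite /d lt_min !divr_gt0// subr_gt0.
have d1 : d <= (b - a) / 2 by rewrite /d ge_min lexx.
have d2 : d <= e / 2 by rewrite /d ge_min lexx orbT.
by exists (a + d); split; lra.
Qed.

Lemma sum_le_halves (u v w : R) : 2 * u <= w -> 2 * v <= w -> u + v <= w.
Proof. by move=> uw vw; lra. Qed.

Lemma near_powR_le (C p q : R) : p < q -> \forall r \near +oo, C * r `^ p <= r `^ q.
Proof.
move=> pq; pose K := (`|C| + 1) `^ (q - p)^-1.
have qp0 : 0 < q - p by rewrite subr_gt0.
near=> r.
have r0 : 0 < r by near: r; exact: nbhs_pinfty_gt.
have rK : K <= r by near: r; apply: nbhs_pinfty_ge; rewrite num_real.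
have -> : r `^ q = r `^ (q - p) * r `^ p.
  by rewrite -powRD ?subrK// (gt_eqF r0) implybT.
rewrite ler_wpM2r ?powR_ge0//; apply: (@le_trans _ _ (K `^ (q - p))).
  rewrite /K -powRrM mulVf ?gt_eqF// powRr1 ?addr_ge0//.
  by rewrite (le_trans (ler_norm _))// lerDl.
by rewrite ge0_ler_powR ?(ltW qp0) ?nnegrE ?powR_ge0// ltW.
Unshelve. all: by end_near. Qed.

Lemma near_cst_le (C q : R) : 0 < q -> \forall r \near +oo, C <= r `^ q.
Proof. by move=> /(near_powR_le C); apply: filterS => r; rewrite powRr0 mulr1. Qed.

Lemma near_ln_le (C p q : R) : 0 <= p -> 0 < q -> \forall r \near +oo, C + p * ln r <= ln 2 * r `^ q.
Proof.
move=> p0 q0; have q20 : 0 < q / 2 by rewrite divr_gt0.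
have l2 : 0 < ln 2 :> R by rewrite ln_gt0// ltr1n.
near=> r.
have r0 : 0 < r by near: r; exact: nbhs_pinfty_gt.
have lnr : ln r <= 2 / q * r `^ (q / 2).
  have h : q / 2 * ln r <= r `^ (q / 2).
    by rewrite -ln_powR; apply: ltW; apply: lt_le_trans (ln_sublinear (powR_gt0 _ r0)) _.
  rewrite -(ler_pM2l q20); apply: le_trans h _; rewrite mulrA.
  by rewrite (_ : q / 2 * (2 / q) = 1) ?mul1r//; field; rewrite gt_eqF.
have h1 : 2 * C / ln 2 <= r `^ q by near: r; exact: near_cst_le.
have h2 : 4 * p / q / ln 2 * r `^ (q / 2) <= r `^ q by near: r; apply: near_powR_le; lra.
have {h1} : 2 * C <= ln 2 * r `^ q by move: h1; rewrite ler_pdivrMr// [_ * ln 2]mulrC.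
have {h2} : 4 * p / q * r `^ (q / 2) <= ln 2 * r `^ q.
  move: h2; rewrite mulrAC ler_pdivrMr// [_ * ln 2]mulrC //.
have := ler_wpM2l p0 lnr.
rewrite (_ : p * (2 / q * _) = (4 * p / q * r `^ (q / 2)) / 2); last by field; rewrite gt_eqF.
move: (p * ln r) (ln 2 * _) (4 * p / q * _) => u v w; lra.
Unshelve. all: by end_near. Qed.

Lemma near_expR_upper (K phi e : R) : 0 < K -> 0 < phi -> 0 < e ->
  \forall r \near +oo, 2 * expR (- (K * r `^ phi)) <= expR (- (r `^ (phi - e))).
Proof.
move=> K0 phi0 e0; near=> r.
have h1 : 2 / K * r `^ (phi - e) <= r `^ phi by near: r; apply: near_powR_le; lra.
have h2 : 2 * ln 2 / K <= r `^ phi by near: r; exact: near_cst_le.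
rewrite -[X in X * _]lnK ?posrE// -expRD ler_expR.
move: h1 h2; rewrite mulrAC !ler_pdivrMr// [_ * K]mulrC.
move: (K * _) (r `^ _) (ln 2) => u v w; lra.
Unshelve. all: by end_near. Qed.

Lemma near_expR_lower (C q p : R) : q < p -> 0 < p ->
  \forall r \near +oo, expR (- r `^ p) <= expR (- (C * r `^ q)) / 4.
Proof.
move=> qp p0; near=> r.
have h1 : 2 * C * r `^ q <= r `^ p by near: r; exact: near_powR_le.
have h2 : 2 * ln 4 <= r `^ p by near: r; exact: near_cst_le.
rewrite ler_pdivlMr// mulrC -[X in X * _]lnK ?posrE// -expRD ler_expR.
move: h1 h2; rewrite -mulrA; move: (C * r `^ q) (r `^ p) (ln 4) => u v w; lra.
Unshelve. all: by end_near. Qed.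

End powers.

(** * The discrepancy event and moment bounds with uniform constants *)

Section discrepancy.
Context {R : realType}.
Local Notation plane := (measurableTypeR R * measurableTypeR R)%type.
Variables (beta : R) (z : R * R) (alpha : R).
Hypotheses (beta0 : 0 < beta) (z1 : 0 < z.1 < 1) (z2 : 0 < z.2 < 1).
Local Notation I n r th := (@tilted_sum R beta n (eball z (r / Num.sqrt n%:R)) th).
Local Notation Z n := (partition_function n beta).
Local Notation prob n r := (coulomb_prob beta (@large_discrepancy R n z r alpha)).

Lemma large_discrepancyE n (r : R) : @large_discrepancy R n z r alpha =
  [set p : n.-tuple plane | r `^ alpha <= `|npoints (eball z (r / Num.sqrt n%:R)) p - pi * r ^+ 2|].
Proof.
apply/seteqP; split=> p; rewrite /large_discrepancy /=;
  have -> : point_count p (disc n z r) = (npoints (eball z (r / Num.sqrt n%:R)) p)%:E by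
    rewrite /point_count /npoints big_tuple -sumEFin; apply: eq_bigr => i _; rewrite diracE indicE.
- by rewrite -EFinB abse_EFin lee_fin.
- by rewrite -EFinB abse_EFin lee_fin.
Qed.

Lemma prob_le n (r th B : R) : (2 <= n)%N -> 0 <= th ->
  (I n r th <= Z n * (expR (th * (pi * r ^+ 2) + B))%:E)%E ->
  (I n r (- th) <= Z n * (expR (- th * (pi * r ^+ 2) + B))%:E)%E ->
  (prob n r <= (2 * expR (B - th * r `^ alpha))%:E)%E.
Proof.
move=> n2 th0 h1 h2; rewrite large_discrepancyE.
exact: (@gas_markov R beta n beta0 n2 _ th _ B (r `^ alpha) (measurable_eball _ _) th0 h1 h2).
Qed.

Lemma prob_ge n (r th B G : R) : (2 <= n)%N -> 0 <= th -> 0 <= G -> th * r `^ alpha + ln 4 <= G ->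
  (Z n * (expR (th * (pi * r ^+ 2) + G))%:E <= I n r th)%E ->
  (I n r (2 * th) <= Z n * (expR (2 * th * (pi * r ^+ 2) + B))%:E)%E ->
  ((expR (- B) / 4)%:E <= prob n r)%E.
Proof.
move=> n2 th0 G0 hG h1 h2; rewrite large_discrepancyE.
exact: (@gas_paley_zygmund R beta n beta0 n2 _ th _ B (r `^ alpha) (measurable_eball _ _) th0 G G0 hG h1 h2).
Qed.

Lemma eventually_n (r l1 l2 : R) : 0 < r -> exists n0, forall n, (n0 <= n)%N ->
  [/\ (2 <= n)%N, eball z (r / Num.sqrt n%:R) `<=` cell 0 0 0, l1 ^+ 2 <= n%:R & l2 ^+ 2 <= n%:R].
Proof.
move=> r0; have [n0 h] := disc_in_square z1 z2 r0.
have lt (l : R) n : ((Num.trunc (l ^+ 2)).+1 <= n)%N -> l ^+ 2 <= n%:R.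
  move=> hn; have /andP[_ /ltW/le_trans] := truncn_itv (sqr_ge0 l); apply.
  by rewrite ler_nat.
exists (maxn (maxn 2 n0) (maxn (Num.trunc (l1 ^+ 2)).+1 (Num.trunc (l2 ^+ 2)).+1)) => n.
rewrite !geq_max => /andP[/andP[? ?] /andP[? ?]]; split=> //; [exact: h|exact: lt|exact: lt].
Qed.

Local Notation ball n r := (eball z (r / Num.sqrt n%:R) `<=` cell 0 0 0).

(** This lemma and the four other [mgf_] lemmas of the section hide the explicit constants behind
    ones independent of r, n and th, which is all the asymptotics use. *)
Lemma mgf_small : exists2 C, 0 <= C & forall (r : R) n (th : R), 2 <= r -> (2 <= n)%N -> ball n r ->
  4 * th ^+ 2 <= beta / 16 / 3 ->
  (I n r th <= Z n * (expR (th * (pi * r ^+ 2) + C * (th ^+ 2 * r)))%:E)%E.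
Proof.
exists (69 * upper_const beta); first exact: mulr_ge0 (upper_const_ge0 beta0).
move=> r n th r2 n2 bn; apply: (@disc_upper_small R beta z r 1 n) => //.
  exact: lt_le_trans r2.
by rewrite expr1n ler1n; case: (n) n2.
Qed.

Lemma mgf_large : exists2 C, 0 < C & forall (r l : R) n (th : R), 0 < r -> 0 < l -> (2 <= n)%N ->
  ball n r -> l ^+ 2 <= n%:R -> 2 * l <= r ->
  (I n r th <= Z n * (expR (th * (pi * r ^+ 2) + C * (th ^+ 2 * r / l + `|th| * l * r)))%:E)%E.
Proof.
exists (upper_const beta + 64 * pi); last by move=> *; exact: disc_upper_large.
by apply: ltr_wpDl; [exact: upper_const_ge0|rewrite mulr_gt0// pi_gt0].
Qed.

Let var0 : 0 < quad_var_const beta.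
Proof. exact: quad_var_const_gt0. Qed.

Let J0 : 0 < beta + ln 4.
Proof. by rewrite addr_gt0// ln_gt0// ltr1n. Qed.

Lemma mgf_variance : exists l k : R, [/\ 1 <= l, 0 < k & forall (r : R) n (th : R), 0 < r -> (2 <= n)%N ->
  ball n r -> l ^+ 2 <= n%:R -> 0 <= th <= 1 -> 40 * l <= r ->
  (Z n * (expR (th * (pi * r ^+ 2) + k * (th ^+ 2 * r)))%:E <= I n r th)%E].
Proof.
pose l : R := 1 + 4 * quad_var_const beta.
have l1 : 1 <= l by rewrite lerDl mulr_ge0// ltW.
have l0 : 0 < l by exact: lt_le_trans l1.
have lv : 4 * quad_var_const beta <= l ^+ 4.
  apply: (@le_trans _ _ l); first by rewrite /l lerDr.
  by rewrite -[leLHS]expr1 ler_weXn2l.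
exists l, (expR (- (64 * (beta + ln 4) * l ^+ 4)) / (32 ^+ 2 * (160 * l))); split => //.
  by apply: divr_gt0; [exact: expR_gt0|apply: mulr_gt0; [exact: exprn_gt0|exact: mulr_gt0]].
by move=> *; exact: disc_lower_variance.
Qed.

Let slope0 : 0 < 32 * (beta + ln 4) * (16 + 2 * quad_var_const beta).
Proof. by apply: mulr_gt0; [exact: mulr_gt0|apply: addr_gt0 => //; exact: mulr_gt0]. Qed.

Lemma mgf_good : exists2 s, 0 < s & forall (r l : R) n (th : R), 0 < r -> (2 <= n)%N ->
  ball n r -> l ^+ 2 <= n%:R -> 1 <= l -> 40 * l <= r -> s * l ^+ 2 <= th ->
  (Z n * (expR (th * (pi * r ^+ 2) + th * l * r / (32 * 40)))%:E <= I n r th)%E.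
Proof.
exists (32 * (beta + ln 4) * (16 + 2 * quad_var_const beta)) => // r l n th r0 n2 bn ll l1.
by apply: disc_lower_good => //; exact: lt_le_trans l1.
Qed.

Lemma mgf_chain : exists2 s, 0 < s & forall (r l : R) n (th : R) j, 0 < r -> (2 <= n)%N ->
  ball n r -> l ^+ 2 <= n%:R -> 1 <= l -> 4 * r <= l -> 4 * l <= r * 2 ^+ j ->
  s * j%:R * l ^+ 2 <= th ->
  (Z n * (expR (th * (pi * r ^+ 2) + th * l ^+ 2 / 32))%:E <= I n r th)%E.
Proof.
exists (32 * (beta + ln 4) * (16 + 2 * quad_var_const beta)) => //.
move=> r l n th j r0 n2 bn ll l1 rl jl hth.
apply: (@disc_lower_chain R beta z r l n _ _ _ _ _ _ _ j) => //.
  exact: lt_le_trans l1.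
by apply: le_trans hth; rewrite le_eqVlt; apply/orP; left; apply/eqP; ring.
Qed.

End discrepancy.

(** * Upper and lower tails in each range of alpha *)

Section tails.
Context {R : realType}.
Local Notation plane := (measurableTypeR R * measurableTypeR R)%type.
Variables (beta : R) (z : R * R) (alpha : R).
Hypotheses (beta0 : 0 < beta) (z1 : 0 < z.1 < 1) (z2 : 0 < z.2 < 1).
Local Notation I n r th := (@tilted_sum R beta n (eball z (r / Num.sqrt n%:R)) th).
Local Notation Z n := (partition_function n beta).
Local Notation prob n r := (coulomb_prob beta (@large_discrepancy R n z r alpha)).

                          
(** Chernoff with th = c r^(alpha-1): both th r^alpha and th^2 r are of order r^(2 alpha - 1), and a
    small c lets the first one win. *)
Lemma upper_tail_small (e : R) : 2^-1 < alpha -> alpha <= 1 -> 0 < e ->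
  \forall r \near +oo, exists n0, forall n, (n0 <= n)%N -> (2 <= n)%N ->
    (prob n r <= (expR (- r `^ (2 * alpha - 1 - e)))%:E)%E.
Proof.
have [C1 C10 bound] := @mgf_small R beta z beta0.
move=> a12 a1 e0.
(* The first entry gives C1 c <= 1/2; the other two give 4 th^2 <= 4 c <= beta/48, the range of
   [mgf_small]. *)
pose c := Num.min (2 * C1 + 1)^-1 (Num.min 1 (beta / 192)).
have c0 : 0 < c by rewrite /c !lt_min ltr01 !divr_gt0// invr_gt0 ltr_wpDl// mulr_ge0.
have cC : C1 * c <= 2^-1.
  have c1 : c <= (2 * C1 + 1)^-1 by rewrite /c ge_min lexx.
  have C1p : 0 < 2 * C1 + 1 by rewrite ltr_wpDl// mulr_ge0.
  move: c1; rewrite -[_^-1]mul1r ler_pdivlMr// => c1.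
  by nra.
have c1 : c <= 1 by rewrite /c !ge_min lexx orbT.
have cb : c <= beta / 192 by rewrite /c !ge_min lexx !orbT.
near=> r.
have r2 : 2 <= r by near: r; apply: nbhs_pinfty_ge; rewrite num_real.
have r0 : 0 < r by lra.
have fin : 2 * expR (- (c / 2 * r `^ (2 * alpha - 1))) <= expR (- r `^ (2 * alpha - 1 - e)).
  near: r; apply: near_expR_upper => //; first by rewrite divr_gt0.
  lra.
pose th := c * r `^ (alpha - 1).
have th0 : 0 <= th by rewrite mulr_ge0 ?powR_ge0// ltW.
have thc : th <= c.
  by rewrite ler_piMr ?(ltW c0)// powR_le1; lra.
have small t : t ^+ 2 = th ^+ 2 -> 4 * t ^+ 2 <= beta / 16 / 3.
  by move=> ->; nra.
have [n0 hn] := eventually_n z1 z2 1 1 r0; exists n0 => n /hn[_ bn _ _] n2.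
have up t : t ^+ 2 = th ^+ 2 ->
    (I n r t <= Z n * (expR (t * (pi * r ^+ 2) + C1 * (th ^+ 2 * r)))%:E)%E.
  by move=> tE; rewrite -tE; apply: bound => //; exact: small.
apply: (le_trans (prob_le alpha beta0 n2 th0 (up th erefl) (up (- th) (sqrrN th)))).
rewrite lee_fin; apply: le_trans fin; rewrite ler_pM2l// ler_expR.
have p0 : 0 < r `^ (alpha - 1) by exact: powR_gt0.
have e1 : r `^ (2 * alpha - 1) = r `^ (alpha - 1) * (r `^ (alpha - 1) * r).
  rewrite -[X in _ * (_ * X)](powRr1 (ltW r0)) -!powRD ?(gt_eqF r0) ?implybT//.
  by congr (_ `^ _); ring.
have e2 : th * r `^ alpha = c * r `^ (2 * alpha - 1).
  rewrite /th -mulrA -powRD ?(gt_eqF r0) ?implybT//.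
  by congr (_ * _ `^ _); ring.
have e3 : C1 * (th ^+ 2 * r) = C1 * c * (c * r `^ (2 * alpha - 1)).
  by rewrite e1 /th; ring.
have q0 : 0 <= c * r `^ (2 * alpha - 1) by rewrite mulr_ge0 ?powR_ge0// ltW.
rewrite e2 e3; have := ler_wpM2r q0 cC.
by rewrite [c / 2 * _]mulrAC; move: (c * _) (C1 * c) => u v; lra.
Unshelve. all: by end_near. Qed.

                                                                                
(** For given l, th is chosen so that the quadratic cost is a quarter of th r^alpha. The linear cost
    requires l r to be below a multiple of r^alpha, and the geometry requires 2 l <= r; l = c r^g is
    the largest order allowed by both, whence the minimum in g. *)
Lemma upper_tail_large (e : R) (g := Num.min (alpha - 1) 1) : 1 < alpha -> 0 < e ->
  \forall r \near +oo, exists n0, forall n, (n0 <= n)%N -> (2 <= n)%N ->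
    (prob n r <= (expR (- r `^ (2 * alpha - 1 + g - e)))%:E)%E.
Proof.
have [C2 C20 bound] := @mgf_large R beta z beta0.
move=> a1 e0.
have g0 : 0 < g by rewrite /g lt_min ltr01 andbT subr_gt0.
have ga : g <= alpha - 1 by rewrite /g ge_min lexx.
have g1 : g <= 1 by rewrite /g ge_min lexx orbT.
clearbody g.
pose c := (4 * C2 + 2)^-1.
have Cp : 0 < 4 * C2 + 2 by rewrite addr_gt0// mulr_gt0.
have c0 : 0 < c by rewrite invr_gt0.
have cC : c * (4 * C2 + 2) = 1 by rewrite /c mulVf// gt_eqF.
have c2 : 2 * c <= 1 by have := mulr_gt0 c0 C20; lra.
have c4 : 4 * C2 * c <= 1 by lra.
near=> r.
have r1 : 1 <= r by near: r; apply: nbhs_pinfty_ge; rewrite num_real.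
have r0 : 0 < r by lra.
have fin : 2 * expR (- (c / (8 * C2) * r `^ (2 * alpha - 1 + g))) <=
    expR (- r `^ (2 * alpha - 1 + g - e)).
  near: r; apply: near_expR_upper => //; last lra.
  by rewrite divr_gt0// mulr_gt0.
pose l := c * r `^ g.
have l0 : 0 < l by rewrite mulr_gt0// powR_gt0.
have pr (u v : R) : r `^ u * r `^ v = r `^ (u + v).
  by rewrite -powRD// (gt_eqF r0) implybT.
have rr : r `^ 1 = r by rewrite powRr1// ltW.
have lr : 2 * l <= r.
  rewrite /l mulrA -[leRHS]mul1r -[X in _ <= _ * X]rr ler_pM ?powR_ge0//.
    by rewrite mulr_ge0// ltW.
  by rewrite ler_powR.
pose th := r `^ alpha * l / (4 * C2 * r).
have d0 : 0 < 4 * C2 * r by rewrite !mulr_gt0.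
have th0 : 0 <= th by rewrite divr_ge0 ?(ltW d0)// mulr_ge0 ?powR_ge0// ltW.
have [n0 hn] := eventually_n z1 z2 l l r0; exists n0 => n /hn[_ bn ll _] n2.
have up t : t ^+ 2 = th ^+ 2 -> `|t| = th ->
    (I n r t <= Z n * (expR (t * (pi * r ^+ 2) + C2 * (th ^+ 2 * r / l + th * l * r)))%:E)%E.
  by move=> <- <-; exact: bound.
apply: (le_trans (prob_le alpha beta0 n2 th0 (up th erefl (ger0_norm th0))
  (up (- th) (sqrrN th) (etrans (normrN th) (ger0_norm th0))))).
rewrite lee_fin; apply: le_trans fin; rewrite ler_pM2l// ler_expR.
have e1 : C2 * (th ^+ 2 * r / l) = th * r `^ alpha / 4.
  have id (C q s A : R) : C != 0 -> q != 0 -> s != 0 ->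
      C * ((A * q / (4 * C * s)) ^+ 2 * s / q) = A * q / (4 * C * s) * A / 4.
    by move=> h1 h2 h3; field; rewrite h1 h2 h3.
  by apply: id; rewrite gt_eqF.
have e2 : C2 * (th * l * r) <= th * r `^ alpha / 4.
  have -> : C2 * (th * l * r) = th * (4 * C2 * c * (r `^ g * r)) / 4 by rewrite /l; field.
  rewrite ler_pM2r ?invr_gt0// ler_wpM2l// -{2}rr pr.
  apply: (@le_trans _ _ (1 * r `^ (g + 1))); first by rewrite ler_wpM2r ?powR_ge0.
  rewrite mul1r ler_powR//; lra.
have e3 : c / (8 * C2) * r `^ (2 * alpha - 1 + g) = th * r `^ alpha / 2.
  rewrite /th /l (_ : 2 * alpha - 1 + g = alpha + alpha + g - 1); last by ring.
  rewrite -pr -pr -pr powRN rr.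
  have id (C q s A G : R) : C != 0 -> s != 0 ->
      q / (8 * C) * (A * A * G * s^-1) = A * (q * G) / (4 * C * s) * A / 2.
    by move=> h1 h2; field; rewrite h1 h2.
  by apply: id; rewrite gt_eqF.
have half (u v : R) : v <= u / 4 -> u / 4 + v - u <= - (u / 2) by move=> ?; lra.
by rewrite mulrDr e1 e3; exact: half.
Unshelve. all: by end_near. Qed.

                                                                    
(** With a' slightly above alpha and th = r^(a'-1), the gain of order th^2 r = r^(2a'-1) beats th
    r^alpha, and the moment at 2 th costs the same order, still below r^(2 alpha - 1 + e). *)
Lemma lower_tail_variance (e : R) : 2^-1 < alpha -> alpha < 1 -> 0 < e ->
  \forall r \near +oo, exists n0, forall n, (n0 <= n)%N -> (2 <= n)%N ->
    ((expR (- r `^ (2 * alpha - 1 + e)))%:E <= prob n r)%E.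
Proof.
have [C1 C10 bound] := @mgf_small R beta z beta0; have [l [k0 [l1 k00 gain]]] := @mgf_variance R beta z beta0.
move=> a12 a1 e0.
have [a' [aa' a'1 a'e]] := exponent_between a1 (divr_gt0 e0 (ltr0n R 2)).
have [i1 i2 i3] : [/\ 2 * a' - 1 < 2 * alpha - 1 + e, 0 < 2 * alpha - 1 + e &
  a' + alpha - 1 < 2 * a' - 1] by split; lra.
have [i4 i5 i6] : [/\ 0 < 2 * a' - 1, 2 * a' - 2 < 0 & a' - 1 <= 0] by split; lra.
near=> r.
have r2 : 2 <= r by near: r; apply: nbhs_pinfty_ge; rewrite num_real.
have r0 : 0 < r by lra.
have lr : 40 * l <= r by near: r; apply: nbhs_pinfty_ge; rewrite num_real.
pose X := r `^ (2 * a' - 1).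
have fin : expR (- r `^ (2 * alpha - 1 + e)) <= expR (- (C1 * 4 * X)) / 4.
  by rewrite /X; near: r; exact: near_expR_lower.
have h1 : 2 / k0 * r `^ (a' + alpha - 1) <= X by rewrite /X; near: r; exact: near_powR_le.
have h2 : 2 * ln 4 / k0 <= X by rewrite /X; near: r; exact: near_cst_le.
have h3 : 16 * r `^ (2 * a' - 2) <= beta / 16 / 3.
  have : 16 / (beta / 16 / 3) * r `^ (2 * a' - 2) <= r `^ 0 by near: r; exact: near_powR_le.
  by rewrite powRr0 mulrAC ler_pdivrMr ?mul1r// !divr_gt0.
have pr (u v : R) : r `^ u * r `^ v = r `^ (u + v).
  by rewrite -powRD// (gt_eqF r0) implybT.
have rr : r `^ 1 = r by rewrite powRr1// ltW.
pose th := r `^ (a' - 1).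
have th0 : 0 <= th by exact: powR_ge0.
have th1 : th <= 1 by apply: powR_le1 i6; apply: le_trans r2; rewrite ler1n.
have th2 : th ^+ 2 = r `^ (2 * a' - 2) by rewrite /th expr2 pr; congr (_ `^ _); ring.
have thX : th ^+ 2 * r = X by rewrite th2 -[X in _ * X]rr pr; congr (_ `^ _); ring.
have thA : th * r `^ alpha = r `^ (a' + alpha - 1) by rewrite /th pr; congr (_ `^ _); ring.
have X0 : 0 <= X by exact: powR_ge0.
have [n0 hn] := eventually_n z1 z2 l 1 r0; exists n0 => n /hn[_ bn ll _] n2.
have small : 4 * (2 * th) ^+ 2 <= beta / 16 / 3.
  rewrite (_ : 4 * (2 * th) ^+ 2 = 16 * th ^+ 2); last by ring.
  by rewrite th2.
have lo := gain r n th r0 n2 bn ll; rewrite th0 th1 thX in lo.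
have up := bound r n (2 * th) r2 n2 bn small.
have {}up : (I n r (2 * th) <= Z n * (expR (2 * th * (pi * r ^+ 2) + C1 * 4 * X))%:E)%E.
  by move: up; rewrite (_ : (2 * th) ^+ 2 * r = 4 * X) ?mulrA// -thX; ring.
apply: le_trans (prob_ge beta0 n2 th0 _ _ (lo isT lr) up); first by rewrite lee_fin.
  by rewrite mulr_ge0// ltW.
rewrite thA; apply: sum_le_halves.
  by move: h1; rewrite mulrAC ler_pdivrMr// [X * k0]mulrC.
by move: h2; rewrite ler_pdivrMr// [X * k0]mulrC.
Unshelve. all: by end_near. Qed.

                                                   
(** With a' slightly above alpha, l = r^(a'-1) and th = K l^2, the gain is of order th l r = th
    r^a', which beats th r^alpha; the moment at 2 th costs O(l^3 r) = O(r^(3a'-2)). *)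
Lemma lower_tail_good (e : R) : 1 <= alpha -> alpha < 2 -> 0 < e ->
  \forall r \near +oo, exists n0, forall n, (n0 <= n)%N -> (2 <= n)%N ->
    ((expR (- r `^ (3 * alpha - 2 + e)))%:E <= prob n r)%E.
Proof.
have [C2 C20 bound] := @mgf_large R beta z beta0; have [slope slope0 gain] := @mgf_good R beta z beta0.
move=> a1 a2 e0.
have [a' [aa' a'2 a'e]] := exponent_between a2 (divr_gt0 e0 (ltr0n R 3)).
have [i1 i2 i3] : [/\ 3 * a' - 2 < 3 * alpha - 2 + e, 0 < 3 * alpha - 2 + e &
  0 <= a' - 1] by split; lra.
have [i4 i5] : a' - 1 < 1 /\ 0 < a' by split; lra.
pose K := slope + 1.
have K0 : 0 < K by rewrite addr_gt0.
near=> r.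
have r2 : 2 <= r by near: r; apply: nbhs_pinfty_ge; rewrite num_real.
have r0 : 0 < r by lra.
pose X := r `^ (3 * a' - 2).
have fin : expR (- r `^ (3 * alpha - 2 + e)) <= expR (- (C2 * (4 * K ^+ 2 + 2 * K) * X)) / 4.
  by rewrite /X; near: r; exact: near_expR_lower.
have pr (u v : R) : r `^ u * r `^ v = r `^ (u + v).
  by rewrite -powRD// (gt_eqF r0) implybT.
have rr : r `^ 1 = r by rewrite powRr1// ltW.
have r1 : 1 <= r by apply: le_trans r2; rewrite ler1n.
pose l := r `^ (a' - 1).
have l1 : 1 <= l by exact: powR_ge1.
have l0 : 0 < l by exact: lt_le_trans l1.
have lr : 40 * l <= r.
  by have : 40 * r `^ (a' - 1) <= r `^ 1 by [near: r; exact: near_powR_le]; rewrite rr.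
have h1 : 2 * (32 * 40) * r `^ alpha <= r `^ a' by near: r; exact: near_powR_le.
have h2 : 2 * (32 * 40) * ln 4 <= r `^ a' by near: r; exact: near_cst_le.
pose th := K * l ^+ 2.
have l2 : 1 <= l ^+ 2 by rewrite exprn_ege1.
have th1 : 1 <= th by rewrite /th mulr_ege1// lerDr ltW.
have th0 : 0 <= th by exact: le_trans th1.
have lE : l * r = r `^ a' by rewrite -[X in _ * X]rr pr subrK.
have lX : l ^+ 3 * r = X.
  rewrite -[X in _ * X]rr !exprS expr0 mulr1 !pr; congr (_ `^ _); ring.
have [n0 hn] := eventually_n z1 z2 l l r0; exists n0 => n /hn[_ bn ll _] n2.
have hs : slope * l ^+ 2 <= th by rewrite /th /K ler_wpM2r ?sqr_ge0// lerDl.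
have lo := gain r l n th r0 n2 bn ll l1 lr hs.
have lr2 : 2 * l <= r by apply: le_trans lr; rewrite ler_pM2r// ler_nat.
have up := bound r l n (2 * th) r0 l0 n2 bn ll lr2.
have {}up : (I n r (2 * th) <= Z n * (expR (2 * th * (pi * r ^+ 2) + C2 * (4 * K ^+ 2 + 2 * K) * X))%:E)%E.
  move: up; rewrite ger0_norm; last by rewrite mulr_ge0.
  rewrite -[C2 * _ * X]mulrA (_ : (2 * th) ^+ 2 * r / l + 2 * th * l * r = (4 * K ^+ 2 + 2 * K) * X)//.
  by rewrite -lX /th; field; rewrite gt_eqF.
have g0 : 0 <= th * l * r / (32 * 40).
  by apply: divr_ge0 => //; apply: mulr_ge0; [exact: mulr_ge0 th0 (ltW l0)|exact: ltW].
apply: le_trans (prob_ge beta0 n2 th0 g0 _ lo up); first by rewrite lee_fin.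
rewrite -[th * l * r]mulrA lE.
have p1 : th * r `^ alpha * (2 * (32 * 40)) <= th * r `^ a'.
  by rewrite -mulrA ler_wpM2l// mulrC.
have p2 : 2 * (32 * 40) * ln 4 <= th * r `^ a'.
  by apply: (le_trans h2); rewrite ler_peMl// powR_ge0.
rewrite ler_pdivlMr// mulrDl; apply: sum_le_halves; first by rewrite mulrCA.
by rewrite mulrCA mulrC.
Unshelve. all: by end_near. Qed.

                                                                           
                                            
(** One cell with about l^2 = r^a' points, a' slightly above alpha, is emptied into the disc through
    j levels, so th is of order j l^2. The gain of order th r^a' beats th r^alpha, and the moment at
    2 th costs O(th^2). *)
Lemma lower_tail_chain (e : R) : 2 <= alpha -> 0 < e ->
  \forall r \near +oo, exists n0, forall n, (n0 <= n)%N -> (2 <= n)%N ->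
    ((expR (- r `^ (2 * alpha + e)))%:E <= prob n r)%E.
Proof.
have [C2 C20 bound] := @mgf_large R beta z beta0; have [slope slope0 gain] := @mgf_chain R beta z beta0.
move=> a2 e0; pose d := e / 8; have d0 : 0 < d by rewrite divr_gt0.
have [a' [aa' i1 i2]] : exists a', [/\ alpha < a', 2 * (a' + d) < 2 * alpha + e &
  0 < 2 * alpha + e] by exists (alpha + d); rewrite /d; split; lra.
clearbody d.
have [i3 i4 i5] : [/\ 1 < a' / 2, 0 <= a' / 2 & 0 < a'] by split; lra.
near=> r.
have r2 : 2 <= r by near: r; apply: nbhs_pinfty_ge; rewrite num_real.
have r0 : 0 < r by lra.
pose X := r `^ (2 * (a' + d)); pose K := 2 * slope + 1.
have K0 : 0 < K by rewrite addr_gt0// mulr_gt0.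
have fin : expR (- r `^ (2 * alpha + e)) <= expR (- (C2 * 17 * K ^+ 2 * X)) / 4.
  by rewrite /X; near: r; exact: near_expR_lower.
have pr (u v : R) : r `^ u * r `^ v = r `^ (u + v).
  by rewrite -powRD// (gt_eqF r0) implybT.
have rr : r `^ 1 = r by rewrite powRr1// ltW.
pose l := r `^ (a' / 2).
have r1 : 1 <= r by apply: le_trans r2; rewrite ler1n.
have l1 : 1 <= l by exact: powR_ge1.
have l0 : 0 < l by exact: lt_le_trans l1.
have lr : 4 * r <= l.
  by have : 4 * r `^ 1 <= r `^ (a' / 2) by [near: r; exact: near_powR_le]; rewrite rr.
have h1 : 2 * 32 * r `^ alpha <= r `^ a' by near: r; exact: near_powR_le.
have h2 : 2 * 32 * ln 4 <= r `^ a' by near: r; exact: near_cst_le.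
have h3 : ln 4 + a' / 2 * ln r <= ln 2 * r `^ d by near: r; exact: near_ln_le.
have l2E : l ^+ 2 = r `^ a' by rewrite expr2 pr; congr (_ `^ _); field.
(* The chain needs 2^j to exceed 4 l, so a multiple of ln r would do; the small power r^d is simpler
   and is absorbed in e. *)
pose j := (Num.trunc (r `^ d)).+1.
have rd1 : 1 <= r `^ d by apply: powR_ge1 => //; exact: ltW.
have /andP[j1 j2] : (Num.trunc (r `^ d))%:R <= r `^ d < j%:R by apply: truncn_itv; exact: powR_ge0.
have j3 : j%:R <= 2 * r `^ d by rewrite /j -natr1 mulr_natl mulr2n lerD.
have jl : 4 * l <= r * 2 ^+ j.
  have e4 : 4 * l = expR (ln 4 + a' / 2 * ln r).
    by rewrite expRD lnK ?posrE// /l /powR gt_eqF.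
  have e2 : 2 ^+ j = expR (ln 2 * j%:R) :> R by rewrite expRM_natr lnK ?posrE.
  apply: (@le_trans _ _ (2 ^+ j)); last by rewrite ler_peMl ?exprn_ge0.
  rewrite e4 e2 ler_expR (le_trans h3)// ler_wpM2l ?ln_ge0 ?ler1n//; exact: ltW.
pose th := (slope * j%:R + 1) * l ^+ 2.
have l2 : 1 <= l ^+ 2 by rewrite exprn_ege1.
have sj : 0 <= slope * j%:R by rewrite mulr_ge0// ltW.
have th1 : l ^+ 2 <= th by rewrite /th ler_peMl ?sqr_ge0// lerDr.
have th0 : 0 <= th by apply: le_trans th1; exact: sqr_ge0.
have thK : th <= K * r `^ (a' + d).
  rewrite -pr -l2E /th [leRHS](_ : _ = (K * r `^ d) * l ^+ 2); last by ring.
  rewrite ler_wpM2r ?sqr_ge0// /K.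
  rewrite mulrDl mul1r lerD// -mulrA mulrCA; exact: (ler_wpM2l (ltW slope0) j3).
have [n0 hn] := eventually_n z1 z2 l (r / 4) r0; exists n0 => n /hn[_ bn ll l4] n2.
have hs : slope * j%:R * l ^+ 2 <= th by rewrite /th ler_wpM2r ?sqr_ge0// lerDl.
have lo := gain r l n th j r0 n2 bn ll l1 lr jl hs.
have r4 : 0 < r / 4 by rewrite divr_gt0.
have lr2 : 2 * (r / 4) <= r by rewrite mulrA ler_pdivrMr// mulrC ler_pM2l// ler_nat.
(* The upper bound is taken at another scale, cells comparable with the disc, where its cost is 16
   th^2 + th r^2 / 2, and r^2 <= th. *)
have up := bound r (r / 4) n (2 * th) r0 r4 n2 bn l4 lr2.
have thr : r ^+ 2 <= th.
  apply: le_trans th1; rewrite ler_sqr ?nnegrE ?(ltW r0) ?(ltW l0)//.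
  by apply: le_trans lr; rewrite ler_peMl ?(ltW r0)// ler1n.
have r20 : 0 <= r ^+ 2 by exact: sqr_ge0.
have B : C2 * ((2 * th) ^+ 2 * r / (r / 4) + `|2 * th| * (r / 4) * r) <= C2 * 17 * K ^+ 2 * X.
  have XE : X = (r `^ (a' + d)) ^+ 2 by rewrite expr2 pr; congr (_ `^ _); ring.
  have -> : C2 * 17 * K ^+ 2 * X = C2 * (17 * (K * r `^ (a' + d)) ^+ 2) by rewrite XE; ring.
  rewrite ler_pM2l// ger0_norm; last exact: mulr_ge0.
  have -> : (2 * th) ^+ 2 * r / (r / 4) + 2 * th * (r / 4) * r = 16 * th ^+ 2 + th * r ^+ 2 / 2.
    by field; rewrite gt_eqF.
  have q1 : th ^+ 2 <= (K * r `^ (a' + d)) ^+ 2.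
    by rewrite ler_sqr ?nnegrE// (le_trans th0).
  have q2 : th * r ^+ 2 / 2 <= th ^+ 2.
    rewrite ler_pdivrMr// [th ^+ 2]expr2 -[leRHS]mulrA; apply: ler_wpM2l => //.
    by apply: (le_trans thr); rewrite ler_peMr// ler1n.
  rewrite (_ : 17 * _ = 16 * (K * r `^ (a' + d)) ^+ 2 + (K * r `^ (a' + d)) ^+ 2); last by ring.
  apply: lerD; first by rewrite ler_pM2l.
  exact: le_trans q2 q1.
have {}up : (I n r (2 * th) <= Z n * (expR (2 * th * (pi * r ^+ 2) + C2 * 17 * K ^+ 2 * X))%:E)%E.
  apply: (le_trans up); have [Zr Zr0 ->] := partition_function_gt0 beta0 n2.
  by rewrite -!EFinM lee_fin ler_pM2l// ler_expR lerD2l.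
have g0 : 0 <= th * l ^+ 2 / 32 by rewrite divr_ge0// mulr_ge0// sqr_ge0.
apply: le_trans (prob_ge beta0 n2 th0 g0 _ lo up); first by rewrite lee_fin.
rewrite l2E.
have p1 : th * r `^ alpha * (2 * 32) <= th * r `^ a' by rewrite -mulrA ler_wpM2l// mulrC.
have p2 : 2 * 32 * ln 4 <= th * r `^ a'.
  by apply: (le_trans h2); rewrite ler_peMl ?powR_ge0// (le_trans l2).
rewrite ler_pdivlMr// mulrDl; apply: sum_le_halves; first by rewrite mulrCA.
by rewrite mulrCA mulrC.
Unshelve. all: by end_near. Qed.

End tails.

(** * Assembling the ranges of alpha *)

Unset Implicit Arguments.
Set Strict Implicit.
Set Printing Implicit Defensive.

Theorem theorem1 (R : realType) (beta : R) (z : R * R) (alpha eps : R)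
    (hbeta : 0 < beta)
    (hz1 : 0 < z.1 < 1) (hz2 : 0 < z.2 < 1)
    (halpha : 2^-1 < alpha)
    (heps : 0 < eps) :
  exists R0 : R, forall r : R, R0 < r ->
  exists n0 : nat, forall n : nat, (2 <= n)%N -> (n0 <= n)%N ->
    ((expR (- (r `^ (phi alpha + eps))))%:E
       <= coulomb_prob beta (large_discrepancy n z r alpha)
       <= (expR (- (r `^ (phi alpha - eps))))%:E)%E.
Proof.
have upper : \forall r \near +oo, exists n0, forall n, (n0 <= n)%N -> (2 <= n)%N ->
    (coulomb_prob beta (large_discrepancy n z r alpha) <=
     (expR (- (r `^ (phi alpha - eps))))%:E)%E.
  rewrite /phi; have [a1|a1] := leP alpha 1; first exact: upper_tail_small.
  have := @upper_tail_large R beta z alpha hbeta hz1 hz2 eps a1 heps.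
  (* The two upper branches of [phi] are a single formula with a minimum. *)
  rewrite (_ : 2 * alpha - 1 + Num.min (alpha - 1) 1 =
    if alpha <= 2 then 3 * alpha - 2 else 2 * alpha)//.
  by rewrite minEle lerBlDr; case: ifP => _; ring.
have lower : \forall r \near +oo, exists n0, forall n, (n0 <= n)%N -> (2 <= n)%N ->
    ((expR (- (r `^ (phi alpha + eps))))%:E <=
     coulomb_prob beta (large_discrepancy n z r alpha))%E.
  have [a1|a1] := ltP alpha 1.
    by rewrite /phi (ltW a1); exact: lower_tail_variance.
  have [a2|a2] := ltP alpha 2.
    rewrite (_ : phi alpha = 3 * alpha - 2); first exact: lower_tail_good.
    (* At alpha = 1 the first branch of [phi] is selected; it agrees with the second there. *)
    rewrite /phi (ltW a2); case: ifP => // a1'; have -> : alpha = 1 by apply/eqP; rewrite eq_le a1 a1'.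
    by ring.
  rewrite (_ : phi alpha = 2 * alpha); first exact: lower_tail_chain.
  rewrite /phi leNgt (lt_le_trans _ a2) ?ltr1n//=; case: ifP => // a2'.
  by have -> : alpha = 2 by [apply/eqP; rewrite eq_le a2 a2']; ring.
have [R0 [_ both]] : \forall r \near +oo, exists n0 : nat, forall n : nat, (2 <= n)%N ->
    (n0 <= n)%N -> ((expR (- (r `^ (phi alpha + eps))))%:E
       <= coulomb_prob beta (large_discrepancy n z r alpha)
       <= (expR (- (r `^ (phi alpha - eps))))%:E)%E.
  apply: filterS2 lower upper => r [n1 h1] [n2 h2]; exists (maxn n1 n2) => n n_ge2.
  by rewrite geq_max => /andP[n1n n2n]; rewrite h1// h2.
by exists R0.
Qed.
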